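(* Let $J$ and $\widetilde J$ be Jacobi operators in $l_2(\mathbb{N})$ such that $\widetilde J=J+C$ with $\operatorname{rank}(C)<\infty$, and let $\rho$ and $\widetilde\rho$ be the corresponding spectral measures. If $\rho$ is determinate, then $\widetilde\rho$ is determinate and $\operatorname{ind}\rho=\operatorname{ind}\widetilde\rho$. If $\rho$ is indeterminate $N$-extremal, then $\widetilde\rho$ is indeterminate $N$-extremal.
   Context: $\mathbb{N}=\{1,2,\dots\}$ and $\{e_k\}$ is the canonical basis of $l_2(\mathbb{N})$. Given real $q_k$ and positive $b_k$ ($k\in\mathbb{N}$), let $J_0$ be the symmetric operator on finitely supported sequences given by $(J_0f)_1=q_1f_1+b_1f_2$, $(J_0f)_k=b_{k-1}f_{k-1}+q_kf_k+b_kf_{k+1}$ for $k\ge2$. A Jacobi operator is any self-adjoint extension $J$ of such a $J_0$. Its spectral measure is $\rho(\Delta)=\langle e_1,E_J(\Delta)e_1\rangle$, with $E_J$ the resolution of the identity of $J$. Let $\mathcal M$ be the set of Borel measures on $\mathbb{R}$ with infinite support and all moments finite. $\mu\in\mathcal M$ is determinate if no other Borel measure has the same moments, and indeterminate otherwise. $\mu\in\mathcal M$ is $N$-extremal if the polynomials are dense in $L_2(\mathbb{R},\mu)$ (all determinate measures are $N$-extremal). For a determinate measure $\mu$, the index of determinacy is $\operatorname{ind}\mu:=\sup\{k\in\mathbb{N}\cup\{0\}:\ |t-z|^{2k}\mu\text{ is determinate}\}\in\{0,1,\dots\}\cup\{\infty\}$ for any $z\in\mathbb{C}\setminus\operatorname{supp}\mu$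 (the value does not depend on the choice of such $z$). *)

(* Defs.v *)
From HB Require Import structures.
From mathcomp Require Import all_boot all_order all_algebra.
From mathcomp Require Import complex.
From mathcomp Require Import all_classical all_reals all_analysis measurable_realfun.

Set Implicit Arguments.
Unset Strict Implicit.
Unset Printing Implicit Defensive.

Import Order.TTheory GRing.Theory Num.Theory.
Import numFieldNormedType.Exports.
Local Open Scope classical_set_scope.
Local Open Scope complex_scope.
Local Open Scope ring_scope.

(* Sequences are indexed from 0: the index k here is k + 1 in the mathematical
   convention N = {1, 2, ...}, so [basis_vec 0] below is the vector e_1. *)

Section Operators.
Context {R : realType}.
Local Notation C := R[i].
Implicit Types (f g h : nat -> C).

Definition norm_sq f (k : nat) : R := Normc.normc (f k) ^+ 2.

Definition l2 : set (nat -> C) := [set f | cvgn (series (norm_sq f))].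

(* Antilinear in the first argument. *)
Definition inner f g : C := limn (series (fun k => (f k)^* * g k)).

Definition l2_dist_sq f g : R := limn (series (norm_sq (fun k => f k - g k))).

Definition basis_vec (j : nat) : nat -> C := fun k => (k == j)%:R.

(* A partially defined operator; the values of [app] outside [dom] are
   irrelevant. *)
Record operator := Operator {
  dom : set (nat -> C);
  app :> (nat -> C) -> (nat -> C) }.

Definition linear_operator (A : operator) :=
  [/\ dom A `<=` l2,
      forall f, dom A f -> l2 (A f),
      dom A (fun=> 0) &
      forall (a : C) f g, dom A f -> dom A g ->
        dom A (fun k => a * f k + g k) /\
        A (fun k => a * f k + g k) = (fun k => a * A f k + A g k)].

Definition extends (A B : operator) :=
  dom A `<=` dom B /\ forall f, dom A f -> B f = A f.

Definition same_operator (A B : operator) := extends A B /\ extends B A.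

Definition add_operator (A B : operator) : operator :=
  Operator (dom A `&` dom B) (fun f k => A f k + B f k).

Definition finite_rank (A : operator) :=
  exists n (v : 'I_n -> nat -> C), forall f, dom A f ->
    exists c : 'I_n -> C, A f = (fun k => \sum_(i < n) c i * v i k).

Definition densely_defined (A : operator) :=
  forall f, l2 f -> forall eps : R, 0 < eps ->
    exists2 g, dom A g & l2_dist_sq f g < eps.

Definition adjoint_graph (A : operator) g h :=
  [/\ l2 g, l2 h & forall f, dom A f -> inner (A f) g = inner f h].

Definition self_adjoint (A : operator) :=
  [/\ linear_operator A, densely_defined A &
      forall g h, adjoint_graph A g h <-> dom A g /\ h = A g].

Definition jacobi0 (q b : nat -> R) : operator :=
  Operator [set f | exists N, forall k, (N <= k)%N -> f k = 0]
    (fun f k =>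
      if k is k'.+1 then
        (b k')%:C * f k' + (q k)%:C * f k + (b k)%:C * f k.+1
      else (q 0%N)%:C * f 0%N + (b 0%N)%:C * f 1%N).

Definition jacobi_operator (J : operator) :=
  exists q b : nat -> R,
    [/\ forall k, 0 < b k, self_adjoint J & extends (jacobi0 q b) J].

Definition orthogonal_projection (P : operator) :=
  [/\ linear_operator P,
      dom P = l2,
      forall f, l2 f -> P (P f) = P f &
      forall f g, l2 f -> l2 g -> inner (P f) g = inner f (P g)].

End Operators.

Arguments operator : clear implicits.

Section Measures.
Context {R : realType}.
Local Notation C := R[i].
Local Notation RB := (measurableTypeR R).
Local Notation borel_measure := {measure set RB -> \bar R}.
Implicit Types mu nu : borel_measure.

(* <f, E(D) f> is real since E(D) is an orthogonal projection. *)
Definition quadratic_measure (E : set R -> operator R) (f : nat -> C) mu :=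
  forall D : set RB, measurable D -> mu D = (complex.Re (inner f (E D f)))%:E.

(* Countable additivity is in the weak sense, on the quadratic forms. *)
Definition projection_valued_measure (E : set R -> operator R) :=
  [/\ forall D : set RB, measurable D -> orthogonal_projection (E D),
      forall f, l2 f -> E setT f = f,
      forall D D' : set RB, measurable D -> measurable D' ->
        forall f, l2 f -> E (D `&` D') f = E D (E D' f) &
      forall f, l2 f -> exists mu, quadratic_measure E f mu].

(* J is the integral of t with respect to E: its domain consists of the f with
   t square integrable for <f, E(.) f>, and <f, J f> is the integral of t with
   respect to <f, E(.) f>; by polarization this determines J. *)
Definition resolution_of_identity (J : operator R) (E : set R -> operator R) :=
  projection_valued_measure E /\
  forall f mu, l2 f -> quadratic_measure E f mu ->
    (dom J f <-> (\int[mu]_t (t ^+ 2)%:E < +oo)%E) /\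
    (dom J f -> inner f (J f) = (\int[mu]_t (t : R))%:C).

Definition spectral_measure (J : operator R) mu :=
  exists2 E, resolution_of_identity J E & quadratic_measure E (basis_vec 0) mu.

Definition supp mu : set R :=
  [set x | forall eps : R, 0 < eps -> (0 < mu (ball x eps))%E].

Definition finite_moments mu :=
  forall n : nat, mu.-integrable setT (fun t : RB => (t ^+ n)%:E).

Definition same_moments mu nu :=
  forall n : nat, (\int[mu]_t (t ^+ n)%:E = \int[nu]_t (t ^+ n)%:E)%E.

Definition classM mu := infinite_set (supp mu) /\ finite_moments mu.

Definition determinate mu :=
  classM mu /\
  forall nu, finite_moments nu -> same_moments mu nu ->
    forall D : set RB, measurable D -> nu D = mu D.

Definition indeterminate mu := classM mu /\ ~ determinate mu.

(* Density of C[t] in the complex space L_2(R, mu). *)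
Definition N_extremal mu :=
  classM mu /\
  forall phi : RB -> C,
    measurable_fun setT (fun t => complex.Re (phi t)) ->
    measurable_fun setT (fun t => complex.Im (phi t)) ->
    (\int[mu]_t (Normc.normc (phi t) ^+ 2)%:E < +oo)%E ->
    forall eps : R, 0 < eps -> exists p : {poly C},
      (\int[mu]_t (Normc.normc (phi t - p.[t%:C]) ^+ 2)%:E < eps%:E)%E.

Section Weighted.
Variables (z : C) (k : nat) (mu : borel_measure).

Definition weight (t : RB) : R := Normc.normc (t%:C - z) ^+ (2 * k).

Lemma weight_ge0 t : 0 <= weight t.
Proof. by rewrite /weight exprM exprn_ge0// sqr_ge0. Qed.

Lemma measurable_weight : measurable_fun setT weight.
Proof.
rewrite (_ : weight = fun t => ((t - complex.Re z) ^+ 2 + (complex.Im z) ^+ 2) ^+ k).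
  apply: measurable_funX; apply: measurable_funD => //.
  by apply: measurable_funX; apply: measurable_funB.
apply/funext => t; rewrite /weight exprM; congr (_ ^+ k).
case: z => x y /=.
by rewrite sub0r sqrrN sqr_sqrtr// addr_ge0// sqr_ge0.
Qed.

(* The measure |t - z|^(2 k) mu. *)
Definition weighted (D : set RB) : \bar R := (\int[mu]_(t in D) (weight t)%:E)%E.

Let weighted0 : weighted set0 = 0%E.
Proof. by rewrite /weighted integral_set0. Qed.

Let weighted_ge0 D : (0 <= weighted D)%E.
Proof. by apply: integral_ge0 => t _; rewrite lee_fin weight_ge0. Qed.

Let weighted_sigma_additive : semi_sigma_additive weighted.
Proof.
move=> F mF tF mUF; rewrite /weighted; apply: cvg_toP.
  apply: ereal_nondecreasing_is_cvgn => m n mn.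
  apply: lee_sum_nneg_natr => // j _ _; apply: integral_ge0 => t _.
  by rewrite lee_fin weight_ge0.
rewrite ge0_integral_bigcup//=.
- apply/measurable_funTS/measurableT_comp => //.
  exact: measurable_weight.
- by move=> t _; rewrite lee_fin weight_ge0.
Qed.

HB.instance Definition _ := isMeasure.Build _ _ _ weighted
  weighted0 weighted_ge0 weighted_sigma_additive.

End Weighted.

(* The index of determinacy computed at the point z. *)
Definition ind (z : C) mu : \bar R :=
  ereal_sup [set k%:R%:E | k in
    [set k | determinate (weighted z k mu : borel_measure)]].

End Measures.

(* Main.v *)
(* Let m >= 0 and z outside supp rho. The heart of the proof is the equivalence of
   (a) |t - z|^(2 m) rho is determinate, and
   (b) (J_0 - i)^(m+1) has a dense range,
   where J_0 acts on finitely supported sequences. Condition (b) depends only on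
   the entries of the Jacobi matrix far away from the origin: changing finitely
   many of them leaves (J_0 - i)^(m+1) unchanged on a subspace of finite
   codimension, and as the new operator is bounded below its range is dense too.
   A tridiagonal matrix of finite rank has finitely many nonzero entries, so J and
   J + C satisfy (b) for the same m.

   The polynomials p(J_0) e_1 exhaust the finitely supported sequences, with
   |p(J_0) e_1|^2 = int |p|^2 d rho, and truncating E(D) e_1 shows that rho is
   N-extremal.

   (b) => (a): (t - i)^(m+1) / (t - w) is approximated in L_2(rho) by polynomials
   (t - i)^(m+1) s(t), so that 1/(t - w) is approximated by s in the weighted
   space of |t - i|^(2 m + 2) rho. Hence two measures with the moments of
   |t - z|^(2 m) rho have the same integrals of rational functions without real
   poles, which converge to indicators of intervals.

   (a) => (b): for a determinate mu the infimum of int |p|^2 d mu over p(i) = 1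
   is 0. Otherwise, by determinacy and Hahn-Banach, 1/(1 + t^2) is squeezed
   between polynomials whose integrals are arbitrarily close, and factoring the
   differences as squared moduli gives polynomials with large value at i or -i
   and small norm. For mu = |t - z|^(2 m) rho this means p(i) = 1 with
   (J_0 - i)^m p(J_0) e_1 small, and then a given r can be replaced by
   r - r(i) p, which is divisible by t - i: (b) follows by induction on m. *)

Require Import Defs.
From HB Require Import structures.
From mathcomp Require Import all_boot all_order all_algebra.
From mathcomp Require Import complex.
From mathcomp Require Import all_classical all_reals all_analysis measurable_realfun.
From mathcomp Require zify.
From mathcomp Require Import ring lra.

Set Implicit Arguments.
Unset Strict Implicit.
Unset Printing Implicit Defensive.

Import Order.TTheory GRing.Theory Num.Theory.
Import numFieldNormedType.Exports.
Local Open Scope classical_set_scope.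
Local Open Scope complex_scope.
Local Open Scope ring_scope.

(** * Finitely supported sequences and Jacobi matrices *)

(** The index is a sharp threshold, so both directions between (a) and (b) must hold with the same
    m, without losing a power of t. This is possible because |t - z|^2 and |t - i|^2 = 1 + t^2 are
    comparable on supp rho; as (b) does not mention z, the two indices may be computed at unrelated
    points. N-extremality holds for every spectral measure, so the indeterminate case is the
    contrapositive of the transfer of (b) for m = 0.

    On the spectral side the obstacle is that the resolution of the identity yields integrals for
    the measures <f, E(.) f> only. The moments involve <e_1, E(D) J_0^n e_1>, which is reached by
    polarization and treated as a difference of two positive measures with a density against rho.

    On the moment side the Hahn-Banach functional has to come from a measure. It is therefore built
    on all functions of polynomial growth, steps included: its distribution function can be read
    off, and the second moment keeps mass from escaping to infinity. *)

Section ComplexSquare.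
Context {R : realType}.
Local Notation C := R[i].
Implicit Types (x y z : C).

Lemma conj_realc (a : R) : (a%:C)^* = a%:C.
Proof. by apply/eqP; rewrite eq_complex /= oppr0 !eqxx. Qed.

Definition csq z : R := complex.Re z ^+ 2 + complex.Im z ^+ 2.

Lemma csq_normc z : Normc.normc z ^+ 2 = csq z.
Proof. by case: z => a b; rewrite /= sqr_sqrtr// addr_ge0// sqr_ge0. Qed.

Lemma csq_ge0 z : 0 <= csq z.
Proof. by rewrite addr_ge0// sqr_ge0. Qed.

Lemma csq0 : csq 0 = 0 :> R.
Proof. by rewrite /csq /=; ring. Qed.

Lemma csq_eq0 z : (csq z == 0) = (z == 0).
Proof.
case: z => a b; rewrite /csq eq_complex /= paddr_eq0 ?sqr_ge0//.
by rewrite !sqrf_eq0.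
Qed.

Lemma csq_gt0 z : (0 < csq z) = (z != 0).
Proof. by rewrite lt_def csq_ge0 andbT csq_eq0. Qed.

Lemma csqM x y : csq (x * y) = csq x * csq y.
Proof. by case: x y => [a b] [c d]; rewrite /csq /=; ring. Qed.

Lemma csqX x n : csq (x ^+ n) = csq x ^+ n.
Proof.
by elim: n => [|n IH]; rewrite ?expr0 ?exprS ?csqM ?IH// /csq /=; ring.
Qed.

Lemma csqN x : csq (- x) = csq x.
Proof. by case: x => a b; rewrite /csq /=; ring. Qed.

Lemma csqJ x : csq x^* = csq x.
Proof. by case: x => a b; rewrite /csq /=; ring. Qed.

Lemma csqV x : csq x^-1 = (csq x)^-1.
Proof. by rewrite -!csq_normc Normc.normcV exprVn. Qed.

Lemma csqR (a : R) : csq a%:C = a ^+ 2.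
Proof. by rewrite /csq /=; ring. Qed.

Lemma mulJc x : x * x^* = (csq x)%:C.
Proof. by case: x => a b; apply/eqP; rewrite eq_complex /csq /=; apply/andP; split; apply/eqP; ring. Qed.

Lemma csqD_le x y : csq (x + y) <= 2 * (csq x + csq y).
Proof.
case: x y => [a b] [c d]; rewrite /csq /=.
by have := sqr_ge0 (a - c); have := sqr_ge0 (b - d); nra.
Qed.

Lemma csq_sum_le n (F : 'I_n -> C) :
  csq (\sum_i F i) <= n%:R * \sum_i csq (F i).
Proof.
elim: n F => [|n IH] F; first by rewrite !big_ord0 csq0 mul0r.
rewrite !big_ord_recl; have [n0|n0] := posnP n.
  by subst n; rewrite !big_ord0 !addr0 mul1r.
set S := \sum_(i < n) _ in IH *; set T := \sum_(i < n) _.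
have {IH} hS : csq S <= n%:R * T by exact: IH.
case: (F ord0) S hS => [a b] [c d]; rewrite /csq /= -[n.+1%:R]natr1 => hS.
have n0' : 0 < n%:R :> R by rewrite ltr0n.
(* This square divided by n bounds the cross term of |F_0 + S|^2 by n |F_0|^2 + |S|^2 / n, and the
   induction hypothesis bounds |S|^2 / n by T. *)
have : 0 <= (n%:R * a - c) ^+ 2 / n%:R + (n%:R * b - d) ^+ 2 / n%:R.
  by rewrite addr_ge0// divr_ge0// ?sqr_ge0// ltW.
have -> : (n%:R * a - c) ^+ 2 / n%:R + (n%:R * b - d) ^+ 2 / n%:R =
   n%:R * (a ^+ 2 + b ^+ 2) - 2 * (a * c + b * d) + (c ^+ 2 + d ^+ 2) / n%:R.
  by field; rewrite gt_eqF.
have : (c ^+ 2 + d ^+ 2) / n%:R <= T by rewrite ler_pdivrMr// mulrC.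
nra.
Qed.

Lemma RejD x y : complex.Re (x + y) = complex.Re x + complex.Re y.
Proof. by case: x y => [a b] [c d]. Qed.
Lemma ImjD x y : complex.Im (x + y) = complex.Im x + complex.Im y.
Proof. by case: x y => [a b] [c d]. Qed.
Lemma RejM x y : complex.Re (x * y) =
  complex.Re x * complex.Re y - complex.Im x * complex.Im y.
Proof. by case: x y => [a b] [c d]. Qed.
Lemma ImjM x y : complex.Im (x * y) =
  complex.Re x * complex.Im y + complex.Im x * complex.Re y.
Proof. by case: x y => [a b] [c d]. Qed.
Lemma Rej_mulr x (a : R) : complex.Re (x * a%:C) = complex.Re x * a.
Proof. by case: x => u v; rewrite /= mulr0 subr0. Qed.
Lemma Rej_sum (I : Type) (r : seq I) P (F : I -> C) :
  complex.Re (\sum_(i <- r | P i) F i) = \sum_(i <- r | P i) complex.Re (F i).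
Proof. exact: (big_morph _ RejD). Qed.
Lemma Imj_sum (I : Type) (r : seq I) P (F : I -> C) :
  complex.Im (\sum_(i <- r | P i) F i) = \sum_(i <- r | P i) complex.Im (F i).
Proof. exact: (big_morph _ ImjD). Qed.

End ComplexSquare.

Section FiniteSequences.
Context {R : realType}.
Local Notation C := R[i].
Implicit Types (f g : {poly C}).

(* A finitely supported sequence is encoded as the polynomial having it as
   coefficients; [n2] is then its squared norm in l_2. *)
Definition n2 f : R := \sum_(k < size f) csq f`_k.

Lemma n2E f N : (size f <= N)%N -> n2 f = \sum_(k < N) csq f`_k.
Proof.
move=> fN; rewrite /n2 (big_ord_widen_cond _ (fun=> true) (fun k => csq f`_k) fN).
rewrite big_mkcond/=; apply: eq_bigr => k _; case: ltnP => // fk.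
by rewrite nth_default// csq0.
Qed.

Lemma n2_ge0 f : 0 <= n2 f.
Proof. by apply: sumr_ge0 => k _; exact: csq_ge0. Qed.

Lemma csq_coef_le f k : csq f`_k <= n2 f.
Proof.
have [kf|fk] := ltnP k (size f); last by rewrite nth_default// csq0 n2_ge0.
rewrite /n2 (bigD1 (Ordinal kf))//= lerDl; apply: sumr_ge0 => ? _.
exact: csq_ge0.
Qed.

Lemma sum_csq_coef_le f K : \sum_(k < K) csq f`_k <= n2 f.
Proof.
rewrite (@n2E f (maxn K (size f))) ?leq_maxr//.
rewrite (big_ord_widen_cond _ (fun=> true) (fun k => csq f`_k) (leq_maxl K (size f))).
by rewrite big_mkcond; apply: ler_sum => k _; case: ifP => // _; exact: csq_ge0.
Qed.

Lemma n2D_le f g : n2 (f + g) <= 2 * (n2 f + n2 g).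
Proof.
rewrite (@n2E f (maxn (size f) (size g))) ?leq_maxl//.
rewrite (@n2E g (maxn (size f) (size g))) ?leq_maxr//.
rewrite (@n2E (f + g) (maxn (size f) (size g))) ?size_polyD//.
rewrite -big_split/= mulr_sumr; apply: ler_sum => k _.
by rewrite coefD csqD_le.
Qed.

Lemma n2Z (a : C) f : n2 (a *: f) = csq a * n2 f.
Proof.
rewrite (@n2E _ (size f)) ?size_scale_leq// mulr_sumr.
by apply: eq_bigr => k _; rewrite coefZ csqM.
Qed.

Lemma n2N f : n2 (- f) = n2 f.
Proof. by rewrite -scaleN1r n2Z /csq /= oppr0 expr0n addr0 sqrrN expr1n mul1r. Qed.

Lemma n2_0 : n2 0 = 0.
Proof. by rewrite /n2 size_poly0 big_ord0. Qed.

Lemma n2_sum_le n (F : 'I_n -> {poly C}) :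
  n2 (\sum_i F i) <= n%:R * \sum_i n2 (F i).
Proof.
pose N := \max_(i < n) size (F i).
rewrite (@n2E _ N); last first.
  apply: (leq_trans (size_sum _ _ _)); exact: leqnn.
under eq_bigr do rewrite coef_sum.
under [X in _ <= _ * X]eq_bigr => i _.
  rewrite (@n2E _ N); last exact: leq_bigmax.
  over.
rewrite exchange_big/= mulr_sumr; apply: ler_sum => k _.
exact: csq_sum_le.
Qed.

Definition ip f g : C := \sum_(k < size f) (f`_k)^* * g`_k.

Lemma ipE f g N : (size f <= N)%N -> ip f g = \sum_(k < N) (f`_k)^* * g`_k.
Proof.
move=> fN; rewrite /ip.
rewrite (big_ord_widen_cond _ (fun=> true) (fun k => (f`_k)^* * g`_k) fN).
rewrite big_mkcond/=; apply: eq_bigr => k _; case: ltnP => // fk.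
by rewrite nth_default// rmorph0 mul0r.
Qed.

Lemma ipff f : ip f f = (n2 f)%:C.
Proof.
rewrite /ip /n2 rmorph_sum; apply: eq_bigr => k _.
by rewrite mulrC mulJc.
Qed.

End FiniteSequences.

Section JacobiOp.
Context {R : realType}.
Local Notation C := R[i].
Variables (q b : nat -> R).
Implicit Types (f g : {poly C}).

(* [J_0] in this encoding. *)
Definition Jop f : {poly C} :=
  \poly_(k < (size f).+1) jacobi0 q b (fun j => f`_j) k.

Lemma coef_Jop f k : (Jop f)`_k = jacobi0 q b (fun j => f`_j) k.
Proof.
rewrite coef_poly; case: ltnP => // fk.
case: k fk => // k; rewrite ltnS => fk /=.
rewrite (nth_default _ fk) (nth_default _ (leq_trans fk (leqnSn _))).
by rewrite (nth_default _ (leq_trans fk (leq_trans (leqnSn _) (leqnSn _)))) !mulr0 !addr0.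
Qed.

Lemma Jop_is_linear : linear Jop.
Proof.
move=> a f g; apply/polyP => k; rewrite coefD coefZ !coef_Jop.
by case: k => [|k] /=; rewrite !coefD !coefZ; ring.
Qed.

HB.instance Definition _ := GRing.isLinear.Build C {poly C} {poly C} _ Jop
  Jop_is_linear.

Lemma size_Jop f : (size (Jop f) <= (size f).+1)%N.
Proof. exact: size_poly. Qed.

(** Discrete Green formula: the inner terms telescope and the Wronskian at N remains. It vanishes
    once N is at least the size of f, whence [Jop_sym]. *)
Lemma Jop_sym_partial f g N :
  \sum_(k < N.+1) (((Jop f)`_k)^* * g`_k - (f`_k)^* * (Jop g)`_k) =
  (b N)%:C * ((f`_N.+1)^* * g`_N - (f`_N)^* * g`_N.+1).
Proof.
elim: N => [|N IH].
  by rewrite big_ord1 /= !coef_Jop /= !(rmorphD, rmorphM) /= !conj_realc; ring.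
rewrite big_ord_recr/= IH !coef_Jop /= !(rmorphD, rmorphM) /= !conj_realc; ring.
Qed.

Lemma Jop_sym f g : ip (Jop f) g = ip f (Jop g).
Proof.
pose N := maxn (size f).+1 (size g).
have fN : (size f <= N)%N by rewrite (leq_trans (leqnSn _))// leq_maxl.
rewrite (@ipE _ _ _ N.+1); last first.
  by rewrite (leq_trans (size_Jop f))// (leq_trans (leq_maxl _ (size g)))// leqnSn.
rewrite (@ipE _ _ _ N.+1) ?(leq_trans fN)//.
apply/eqP; rewrite -subr_eq0 -sumrB Jop_sym_partial.
rewrite (nth_default _ fN) (nth_default _ (leq_trans fN (leqnSn _))) rmorph0.
by rewrite !mul0r subrr mulr0.
Qed.

Definition Jshift f := Jop f - 'i *: f.

Lemma Jshift_is_linear : linear Jshift.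
Proof.
move=> a f g; rewrite /Jshift linearP !scalerDr !scalerA opprD mulrC.
by rewrite scalerN scalerA mulrC !addrA; congr (_ - _); rewrite -!addrA; congr (_ + _); rewrite addrC.
Qed.

HB.instance Definition _ := GRing.isLinear.Build C {poly C} {poly C} _ Jshift
  Jshift_is_linear.

(** The cross term is a multiple of the imaginary part of <f, J_0 f>, which is real by symmetry.
    Hence J_0 - i never decreases the norm. *)
Lemma n2_Jshift f : n2 (Jshift f) = n2 (Jop f) + n2 f.
Proof.
pose N := (size f).+1.
have fN : (size f <= N)%N by exact: leqnSn.
have JN := size_Jop f.
rewrite (@n2E _ _ N); last first.
  rewrite (leq_trans (size_polyD _ _))// geq_max JN size_polyN.
  by rewrite (leq_trans (size_scale_leq _ _)).
rewrite (n2E JN) (n2E fN) -big_split/=.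
have : complex.Im (ip f (Jop f)) = 0.
  have h : (ip f (Jop f))^* = ip f (Jop f).
    rewrite -[RHS]Jop_sym (@ipE _ f _ N)// (@ipE _ (Jop f) _ N)// rmorph_sum/=.
    by apply: eq_bigr => k _; rewrite rmorphM /= conjCK mulrC.
  by move: h; case: (ip _ _) => u v [] {}h; rewrite /=; lra.
rewrite (ipE _ fN) Imj_sum => h.
transitivity (\sum_(k < N) (csq (Jop f)`_k + csq f`_k) -
  2 * \sum_(k < N) complex.Im ((f`_k)^* * (Jop f)`_k)); last by rewrite h mulr0 subr0.
rewrite mulr_sumr -sumrB.
apply: eq_bigr => k _; rewrite coefB coefZ.
by case: (f`_k) ((Jop f)`_k) => [x y] [z w]; rewrite /csq /=; ring.
Qed.

Lemma n2_iter_Jshift_ge m f : n2 f <= n2 (iter m Jshift f).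
Proof.
elim: m => // m IH; rewrite (le_trans IH)// iterS n2_Jshift lerDr n2_ge0//.
Qed.

Lemma iter_Jshift_is_linear m : linear (iter m Jshift).
Proof. by move=> a f g; elim: m => // m IH; rewrite !iterS IH linearP. Qed.

HB.instance Definition _ m := GRing.isLinear.Build C {poly C} {poly C} _
  (iter m Jshift) (iter_Jshift_is_linear m).

(** Finitely supported targets y suffice for density in l_2. This exponent is the m + 1 of condition
    (b). *)
Definition range_dense m := forall y : {poly C}, forall eps : R, 0 < eps ->
  exists g, n2 (y - iter m Jshift g) < eps.

End JacobiOp.

(** * Stability of a dense range under finitely many changes *)

Section FinitePerturbation.
Context {R : realType}.
Local Notation C := R[i].
Implicit Types (f g r y : {poly C}).

(** A tridiagonal matrix lowers the first nonzero index by at most one, so m is the number of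
    further applications still allowed. The extra 1 in [(N + m).+1] makes f vanish at N, so that
    b_(N-1), which links N - 1 to N and may differ, has no effect. *)
Lemma Jshift_agree (q b q' b' : nat -> R) N :
    (forall k, (N <= k)%N -> q k = q' k /\ b k = b' k) ->
  forall f m, (forall k, (k < (N + m).+1)%N -> f`_k = 0) ->
  Jshift q b f = Jshift q' b' f /\
  forall k, (k < N + m)%N -> (Jshift q b f)`_k = 0.
Proof.
move=> h f m f0; split.
  congr (_ - _); apply/polyP => k; rewrite !coef_Jop.
  have e j : (j < N)%N -> f`_j = 0.
    by move=> jN; rewrite f0// (leq_trans jN)// (leq_trans (leq_addr m N)).
  case: k => [|k] /=.
    have [N0|N0] := posnP N.
      by subst N; have [-> ->] := h 0%N (leqnn 0).
    by rewrite !f0 ?mulr0//= ltnS (leq_trans N0)// leq_addr.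
  have [Nk|kN] := leqP N k.
    by have [_ ->] := h _ Nk; have [] := h _ (leq_trans Nk (leqnSn k)) => -> ->.
  rewrite [f`_k]e// [f`_k.+1]f0 ?mulr0; last by rewrite ltnS (leq_trans kN)// leq_addr.
  have [Nk|kN'] := leqP N k.+1; first by have [_ ->] := h _ Nk.
  by rewrite f0 ?mulr0// ltnS (leq_trans kN')// leq_addr.
move=> k km; rewrite coefB coefZ coef_Jop.
rewrite [f`_k]f0 ?mulr0 ?subr0; last exact: ltnW.
case: k km => [|k] km /=; first by rewrite !f0 ?mulr0 ?addr0.
rewrite [f`_k]f0; last by rewrite (leq_trans _ (leqW km))// ltnW.
by rewrite [f`_k.+1]f0 ?[f`_k.+2]f0 ?mulr0 ?addr0// ltnW.
Qed.

Lemma iter_Jshift_agree (q b q' b' : nat -> R) N :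
    (forall k, (N <= k)%N -> q k = q' k /\ b k = b' k) ->
  forall m f, (forall k, (k < (N + m).+1)%N -> f`_k = 0) ->
  iter m (Jshift q b) f = iter m (Jshift q' b') f.
Proof.
move=> h; elim => // m IH f f0; rewrite !iterSr.
have [<- f0'] := Jshift_agree h f0.
by apply: IH; rewrite -addnS.
Qed.

Section Transfer.
Variables (A B : {linear {poly C} -> {poly C}}) (K : nat).
Hypothesis B_ge : forall f, n2 f <= n2 (B f).
Hypothesis AB : forall f, (forall k, (k < K)%N -> f`_k = 0) -> A f = B f.
Hypothesis A_dense : forall y (eps : R), 0 < eps -> exists g, n2 (y - A g) < eps.

Let head f : f = \sum_(a < K) f`_a *: 'X^a + (f - take_poly K f).
Proof. by rewrite -poly_def addrC subrK. Qed.

Let tail0 f k : (k < K)%N -> (f - take_poly K f)`_k = 0.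
Proof. by move=> kK; rewrite coefB coef_take_poly kK subrr. Qed.

(* Modulo the closure of the common image of the [f] vanishing below [K], each
   [B 'X^b] with [b < K] is a combination of the [A 'X^a] with [a < K]; as [B] is
   bounded below, the coefficient matrix is invertible. *)
Let approx_basis a (eps : R) : (a < K)%N -> 0 < eps ->
  exists g, n2 (A 'X^a - B g) < eps.
Proof.
move=> aK eps0; have K0 : (0 < K%:R :> R) by rewrite ltr0n (leq_ltn_trans _ aK).
pose W := n2 (A 'X^a) + 1.
have W0 : 0 < W by rewrite ltr_wpDl// n2_ge0.
(* The first bound makes K eta at most 1/4, so that the errors can be absorbed into [nc c]; the
   second makes 4 K eta W, the final error, at most eps. *)
pose eta := Num.min (4 * K%:R)^-1 (eps / (4 * K%:R * W)).
have eta0 : 0 < eta by rewrite lt_min invr_gt0 divr_gt0 ?mulr_gt0.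
have eta1 : K%:R * eta <= 4^-1.
  have <- : K%:R * (4 * K%:R)^-1 = 4^-1 :> R by field; rewrite gt_eqF.
  apply: ler_wpM2l; [exact: ltW|by rewrite ge_min lexx].
have eta2 : 4 * (K%:R * eta) * W <= eps.
  have <- : 4 * (K%:R * (eps / (4 * K%:R * W))) * W = eps.
    by field; rewrite !gt_eqF.
  apply: ler_wpM2r; first exact: ltW.
  by do 2 (apply: ler_wpM2l; first by rewrite ?(ltW K0)); rewrite ge_min lexx orbT.
have /choice[F HF] (b : 'I_K) : exists f, n2 (B 'X^b - A f) < eta by exact: A_dense.
pose M : 'M[C]_K := \matrix_(b, a) (F b)`_a.
pose rr b := F b - take_poly K (F b).
pose e (c : 'rV[C]_K) : {poly C} := \sum_b c 0 b *: 'X^b.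
pose f' (c : 'rV[C]_K) : {poly C} := \sum_b c 0 b *: rr b.
pose nc (c : 'rV[C]_K) : R := \sum_b csq (c 0 b).
pose err (c : 'rV[C]_K) := \sum_b c 0 b *: (B 'X^b - A (F b)).
(* On the tail of [F b] the operators coincide, so only its K head coefficients, the row b of M,
   still involve A. *)
have AF b : A (F b) = \sum_a M b a *: A 'X^a + B (rr b).
  rewrite {1}[F b]head linearD linear_sum/= AB; last exact: tail0.
  by congr (_ + _); apply: eq_bigr => j _; rewrite (linearZ_LR A) mxE.
have BE c : B (e c - f' c) = err c + \sum_a (c *m M) 0 a *: A 'X^a.
  have -> : B (e c - f' c) = \sum_b c 0 b *: (B 'X^b - B (rr b)).
    rewrite linearB [B (e c)]linear_sum [B (f' c)]linear_sum/= -sumrB.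
    by apply: eq_bigr => j _; rewrite !(linearZ_LR B) scalerBr.
  have -> : \sum_a (c *m M) 0 a *: A 'X^a = \sum_b c 0 b *: (\sum_a M b a *: A 'X^a).
    under eq_bigr do rewrite mxE scaler_suml.
    rewrite exchange_big/=; apply: eq_bigr => j _.
    by rewrite scaler_sumr; apply: eq_bigr => l _; rewrite scalerA.
  rewrite /err -big_split/=; apply: eq_bigr => j _.
  rewrite -scalerDr AF opprD; congr (_ *: _).
  by rewrite -!addrA; congr (_ + _); rewrite addrCA addNr addr0.
have errle c : n2 (err c) <= K%:R * eta * nc c.
  rewrite (le_trans (n2_sum_le _))// -mulrA ler_wpM2l ?(ltW K0)//.
  rewrite /nc mulr_sumr; apply: ler_sum => j _; rewrite n2Z mulrC.
  by rewrite ler_wpM2r ?csq_ge0// ltW.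
(* [f' c] vanishes below K, so the first K coefficients of [e c - f' c] are the entries of c. *)
have ncle c : nc c <= n2 (e c - f' c).
  apply: le_trans (sum_csq_coef_le _ K); apply: ler_sum => k _.
  rewrite coefB !coef_sum (bigD1 k)//= coefZ coefXn eqxx mulr1 !big1 ?addr0 ?subr0//.
    by move=> j _; rewrite coefZ tail0 ?mulr0.
  move=> j jk; rewrite coefZ coefXn eq_sym.
  by rewrite (_ : (j == k :> nat) = false) ?mulr0//; apply/negbTE.
have nc_bound c : nc c <= 4 * n2 (\sum_a (c *m M) 0 a *: A 'X^a).
  have := le_trans (ncle c) (le_trans (B_ge _) _).
  move=> /(_ _ _)/[!BE]; move: (n2D_le (err c) (\sum_a (c *m M) 0 a *: A 'X^a)).
  move=> h1 /(_ _ h1); have := errle c.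
  have : K%:R * eta * nc c <= 4^-1 * nc c.
    by rewrite ler_wpM2r// sumr_ge0// => ? _; exact: csq_ge0.
  lra.
have Mu : M \in unitmx.
  rewrite -row_free_unit; apply: inj_row_free => c cM0.
  have := nc_bound c; rewrite cM0 big1 ?n2_0 ?mulr0; last by move=> j _; rewrite mxE scale0r.
  move=> c0; apply/rowP => j; rewrite mxE; apply/eqP; rewrite -csq_eq0.
  rewrite eq_le csq_ge0 andbT (le_trans _ c0)// /nc (bigD1 j)//= lerDl.
  by apply: sumr_ge0 => ? _; exact: csq_ge0.
(* This row of the inverse of M reduces the combination of the A X^j to A X^a alone. *)
pose i := Ordinal aK; pose c := row i (invmx M).
have cM : c *m M = delta_mx 0 i by rewrite -row_mul mulVmx// row1.
have wE : \sum_a (c *m M) 0 a *: A 'X^a = A 'X^i.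
  rewrite (bigD1 i)//= cM mxE !eqxx scale1r big1 ?addr0// => j ji.
  by rewrite mxE (negbTE ji) andbF scale0r.
exists (e c - f' c); rewrite BE wE opprD addrCA subrr addr0 n2N.
have := nc_bound c; rewrite wE => hc.
have n2w : n2 (A 'X^i) < W by rewrite ltrDl.
have K1 : 0 < K%:R * eta by rewrite mulr_gt0.
apply: le_lt_trans (errle c) _; apply: lt_le_trans eta2.
have -> : 4 * (K%:R * eta) * W = K%:R * eta * (4 * W) by ring.
rewrite ltr_pM2l//; lra.
Qed.

(** Take f with A f close to y: on its tail A and B agree, and the K images A X^a coming from its
    head are replaced by nearby values of B. *)
Lemma range_dense_transfer y (eps : R) : 0 < eps -> exists g, n2 (y - B g) < eps.
Proof.
move=> eps0; have eps4 : 0 < eps / 4 by rewrite divr_gt0.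
have [f hf] := A_dense y eps4.
pose S := K%:R * \sum_(a < K) csq f`_a.
have S0 : 0 <= S by rewrite mulr_ge0// sumr_ge0// => a _; exact: csq_ge0.
pose delta := eps / (4 * (S + 1)).
have delta0 : 0 < delta by rewrite divr_gt0// mulr_gt0// ltr_wpDl.
have hS : S * delta <= eps / 4.
  have <- : (S + 1) * delta = eps / 4 by rewrite /delta; field; rewrite gt_eqF// ltr_wpDl.
  by rewrite ler_wpM2r ?(ltW delta0)// lerDl.
have /choice[g hg] (a : 'I_K) := approx_basis (ltn_ord a) delta0.
exists (\sum_(a < K) f`_a *: g a + (f - take_poly K f)).
have -> : y - B (\sum_(a < K) f`_a *: g a + (f - take_poly K f)) =
    (y - A f) + \sum_(a < K) f`_a *: (A 'X^a - B (g a)).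
  have -> : A f = \sum_(a < K) f`_a *: A 'X^a + B (f - take_poly K f).
    rewrite {1}(head f) (linearD A) (AB (tail0 f)) [A (\sum_(a < K) _)]linear_sum.
    by congr (_ + _); apply: eq_bigr => a _; rewrite (linearZ_LR A).
  rewrite (linearD B) [B (\sum_(a < K) _)]linear_sum.
  have -> : \sum_(a < K) f`_a *: (A 'X^a - B (g a)) =
      \sum_(a < K) f`_a *: A 'X^a - \sum_(a < K) B (f`_a *: g a).
    by rewrite -sumrB; apply: eq_bigr => a _; rewrite scalerBr (linearZ_LR B).
  by ring.
rewrite (le_lt_trans (n2D_le _ _))//.
have : n2 (\sum_(a < K) f`_a *: (A 'X^a - B (g a))) <= S * delta.
  apply: le_trans (n2_sum_le _) _; rewrite -mulrA ler_wpM2l// mulr_suml.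
  apply: ler_sum => a _; rewrite n2Z ler_wpM2l ?csq_ge0// ltW//; exact: hg.
lra.
Qed.

End Transfer.

Lemma range_dense_agree (q b q' b' : nat -> R) N m :
    (forall k, (N <= k)%N -> q k = q' k /\ b k = b' k) ->
  range_dense q b m -> range_dense q' b' m.
Proof.
move=> h hd y eps eps0.
apply: (@range_dense_transfer (iter m (Jshift q b)) (iter m (Jshift q' b')) (N + m).+1) => //.
- by move=> f; exact: n2_iter_Jshift_ge.
- by move=> f f0; exact: iter_Jshift_agree f0.
Qed.

End FinitePerturbation.

(** * Finite rank perturbations of tridiagonal matrices *)

Section FiniteRank.
Context {R : realType}.
Local Notation C := R[i].
Import zify.

Lemma jacobi0_basis_far (q b : nat -> R) k r :
  (r.+1 < k)%N || (k.+1 < r)%N -> jacobi0 q b (basis_vec k) r = 0.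
Proof.
move=> kr; have e j : (j <= r.+1)%N -> (r <= j.+1)%N -> basis_vec k j = 0 :> C.
  by rewrite /basis_vec; case: eqP => // -> h1 h2; exfalso; lia.
case: r kr e => [|r] kr e /=; first by rewrite !e ?mulr0 ?addr0.
by rewrite !e ?mulr0 ?addr0//; lia.
Qed.

Lemma jacobi0_basis_diag (q b : nat -> R) k :
  jacobi0 q b (basis_vec k) k = (q k)%:C.
Proof.
case: k => [|k] /=; rewrite /basis_vec eqxx mulr1.
  by rewrite mulr0 addr0.
have -> : (k == k.+1) = false by lia.
have -> : (k.+2 == k.+1) = false by lia.
by rewrite mulr0n !mulr0 add0r addr0.
Qed.

Lemma jacobi0_basis_sub (q b : nat -> R) k :
  jacobi0 q b (basis_vec k) k.+1 = (b k)%:C.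
Proof.
rewrite /= /basis_vec eqxx mulr1.
have -> : (k.+1 == k) = false by lia.
have -> : (k.+2 == k) = false by lia.
by rewrite mulr0n !mulr0 !addr0.
Qed.

(* Columns of the tridiagonal difference taken at distance at least 3 have
   disjoint supports, so infinitely many nonzero ones have infinite rank. *)
Lemma finite_rank_agree (J Jt P : operator R) (q b q' b' : nat -> R) :
    extends (jacobi0 q b) J -> extends (jacobi0 q' b') Jt ->
    finite_rank P -> same_operator Jt (add_operator J P) ->
  exists N, forall k, (N <= k)%N -> q k = q' k /\ b k = b' k.
Proof.
move=> [dJ eJ] [dJt eJt] [n [v hv]] [[dJtJP eJtJP] _].
apply: contrapT => /forallNP hN.
have /choice[kf hkf] N : exists k, (N <= k)%N /\ ~ (q k = q' k /\ b k = b' k).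
  by have := hN N => /existsNP[k /not_implyP[Nk ?]]; exists k.
(* Indices where the matrices differ, each at least 3 beyond the previous one. *)
pose k i := iter i (fun j => kf (j + 3)%N) (kf 0%N).
have ks i : (k i + 3 <= k i.+1)%N by rewrite /k iterS; have [] := hkf (iter i (fun j => kf (j + 3)%N) (kf 0%N) + 3)%N.
have klt i l : (i < l)%N -> (k i + 3 <= k l)%N.
  elim: l => // l IH; rewrite ltnS leq_eqVlt => /predU1P[->//|/IH h].
  by rewrite (leq_trans h)// (leq_trans _ (ks l))// leq_addr.
have kne i : ~ (q (k i) = q' (k i) /\ b (k i) = b' (k i)).
  by case: i => [|i]; rewrite /k ?iterS; apply: (hkf _).2.
(* A row in which column [k i] of the difference is nonzero: the diagonal one if the q differ,
   otherwise the next one, where the b differ. *)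
pose r i := if q (k i) == q' (k i) then (k i).+1 else k i.
have domP j : dom P (basis_vec j).
  have : dom Jt (basis_vec j).
    apply: dJt; exists j.+1 => l jl; rewrite /basis_vec.
    by rewrite (_ : (l == j) = false)//; lia.
  by case/dJtJP.
have PE j l : P (basis_vec j) l =
    jacobi0 q' b' (basis_vec j) l - jacobi0 q b (basis_vec j) l.
  have fj : dom (jacobi0 q b) (basis_vec j).
    exists j.+1 => m jm; rewrite /basis_vec.
    by rewrite (_ : (m == j) = false)//; lia.
  have -> := esym (eJt _ fj); rewrite -(eJ _ fj).
  by rewrite -(eJtJP _ (dJt _ fj)) /= addrC addKr.
have /choice[c hc] (i : 'I_n.+1) : exists c : 'I_n -> C,
    P (basis_vec (k i)) = (fun l => \sum_(j < n) c j * v j l).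
  exact: hv.
(* The matrix of the entries of the difference in columns k_i and rows r_l is diagonal and
   invertible of size n + 1, yet it factors through dimension n. *)
pose D : 'M[C]_n.+1 := \matrix_(i, l) P (basis_vec (k i)) (r l).
pose A : 'M[C]_(n.+1, n) := \matrix_(i, j) c i j.
pose V : 'M[C]_(n, n.+1) := \matrix_(j, l) v j (r l).
have DE : D = A *m V.
  apply/matrixP => i l; rewrite !mxE hc; apply: eq_bigr => j _.
  by rewrite !mxE.
have Doff i l : i != l -> D i l = 0.
  move=> il; rewrite mxE PE !jacobi0_basis_far ?subrr// /r.
  - have [il'|il'|/val_inj eil] := ltngtP i l; last by rewrite eil eqxx in il.
      by have := klt _ _ il'; case: ifP => _ h; lia.
    by have := klt _ _ il'; case: ifP => _ h; lia.
  - have [il'|il'|/val_inj eil] := ltngtP i l; last by rewrite eil eqxx in il.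
      by have := klt _ _ il'; case: ifP => _ h; lia.
    by have := klt _ _ il'; case: ifP => _ h; lia.
have Ddiag i : D i i != 0.
  rewrite mxE PE /r; case: ifPn => [/eqP qq|qq].
    rewrite !jacobi0_basis_sub subr_eq0; apply/eqP => /complexI bb.
    by apply: (kne i).
  by rewrite !jacobi0_basis_diag subr_eq0; apply: contra qq => /eqP/complexI ->.
have : row_free D.
  apply: inj_row_free => u uD; apply/rowP => i; rewrite mxE.
  have /rowP/(_ i) := uD; rewrite !mxE (bigD1 i)//= big1 ?addr0; last first.
    by move=> j ji; rewrite Doff// mulr0.
  by move/eqP; rewrite mulf_eq0 (negbTE (Ddiag i)) orbF => /eqP.
rewrite /row_free DE => /eqP h.
have := mxrankM_maxl A V.
by rewrite h => /leq_trans /(_ (rank_leq_col _)); rewrite ltnn.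
Qed.

End FiniteRank.

(** * Determinate measures have vanishing Christoffel function *)

Section HahnBanach.
Context {R : realType} {V : lmodType R}.
Variable D : set V.
Hypothesis D0 : D 0.
Hypothesis DD : forall f g, D f -> D g -> D (f + g).
Hypothesis DZ : forall (a : R) f, D f -> D (a *: f).
Implicit Types (p : V -> R) (f g h : V) (a t : R).

(** Everything is relative to a subspace D, later that of the functions of polynomial growth.
    Homogeneity at 0 is the separate condition [p 0 = 0]. *)
Definition sublinear p :=
  [/\ p 0 = 0, forall f g, D f -> D g -> p (f + g) <= p f + p g &
      forall a f, 0 < a -> D f -> p (a *: f) = a * p f].

Let DN f : D f -> D (- f).
Proof. by move=> Df; rewrite -scaleN1r; exact: DZ. Qed.

Lemma sublinear_opp p f : sublinear p -> D f -> - p (- f) <= p f.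
Proof.
move=> [p0 pD _] Df; have := pD _ _ Df (DN Df).
by rewrite subrr p0; lra.
Qed.

(* Lowers [p] to a sublinear functional that is linear along [f]: hence a
   minimal sublinear functional is linear. *)
Definition shave p f g :=
  inf [set p (g + t *: f) - t * p f | t in [set t | 0 <= t]].

Section Shave.
Variables (p : V -> R) (f : V).
Hypotheses (sp : sublinear p) (Df : D f).

Let lb g : D g ->
  lbound [set p (g + t *: f) - t * p f | t in [set t | 0 <= t]] (- p (- g)).
Proof.
move=> Dg _ [t t0 <-]; have [p0 pD pZ] := sp.
have [->|tn0] := eqVneq t 0.
  by rewrite scale0r mul0r addr0 subr0; exact: sublinear_opp.
have t0' : 0 < t by rewrite lt_def tn0.
have := pD _ _ (DD Dg (DZ t Df)) (DN Dg).
by rewrite addrAC subrr add0r pZ//; lra.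
Qed.

Lemma shave_le g t : D g -> 0 <= t -> shave p f g <= p (g + t *: f) - t * p f.
Proof.
move=> Dg t0; apply: ge_inf; last by exists t.
by exists (- p (- g)); exact: lb.
Qed.

Lemma le_shave g x : (forall t, 0 <= t -> x <= p (g + t *: f) - t * p f) ->
  x <= shave p f g.
Proof.
move=> h; apply: lb_le_inf; last by move=> _ [t t0 <-]; exact: h.
by exists (p (g + 0 *: f) - 0 * p f), 0 => //=.
Qed.

Lemma shave_le_id g : D g -> shave p f g <= p g.
Proof.
move=> Dg; have := shave_le Dg (lexx 0).
by rewrite scale0r addr0 mul0r subr0.
Qed.

Lemma sublinear_shave : sublinear (shave p f).
Proof.
have [p0 pD pZ] := sp; split.
- apply/eqP; rewrite eq_le; apply/andP; split.
    by rewrite -[leRHS]p0 shave_le_id.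
  apply: le_shave => t; rewrite le_eqVlt => /predU1P[<-|t0].
    by rewrite scale0r mul0r addr0 p0 subr0.
  by rewrite add0r pZ// subrr.
- move=> g h Dg Dh; rewrite -lerBlDr; apply: le_shave => t t0.
  rewrite lerBlDr -lerBlDl; apply: le_shave => s s0.
  have := shave_le (DD Dg Dh) (addr_ge0 t0 s0).
  have := pD _ _ (DD Dg (DZ t Df)) (DD Dh (DZ s Df)).
  by rewrite addrACA -scalerDl; lra.
- move=> a g a0 Dg; have an0 : a != 0 by rewrite gt_eqF.
  have scal (t : R) (h : V) : p (a *: h + t *: f) - t * p f =
      a * (p (h + (t / a) *: f) - t / a * p f) \/ ~ D h.
    have [Dh|] := pselect (D h); last by right.
    left; have -> : a *: h + t *: f = a *: (h + (t / a) *: f).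
      by rewrite scalerDr scalerA mulrCA mulfV// mulr1.
    rewrite pZ//; last by apply: DD => //; exact: DZ.
    by field.
  apply/eqP; rewrite eq_le; apply/andP; split.
    rewrite mulrC -ler_pdivrMr//; apply: le_shave => t t0.
    have := shave_le (DZ a Dg) (mulr_ge0 (ltW a0) t0).
    have [->|//] := scal (a * t) g; have -> : a * t / a = t by field.
    by move=> h; rewrite ler_pdivrMr// mulrC.
  apply: le_shave => t t0; have [->|//] := scal t g.
  by rewrite ler_pM2l//; apply: shave_le => //; rewrite divr_ge0// ltW.
Qed.

Lemma shave_opp : shave p f (- f) <= - p f.
Proof.
have [p0 _ _] := sp; have := shave_le (DN Df) ler01.
by rewrite scale1r addNr p0 mul1r sub0r.
Qed.

End Shave.

(** Zorn's lemma: the pointwise infimum of a chain is finite because each member is at least - S (-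
    f) at f. *)
Lemma exists_minimal_sublinear S : sublinear S ->
  exists2 p, sublinear p /\ (forall f, D f -> p f <= S f) &
    forall p', sublinear p' -> (forall f, D f -> p' f <= p f) ->
      forall f, D f -> p f <= p' f.
Proof.
move=> sS.
pose T := {p : V -> R | sublinear p /\ forall f, D f -> p f <= S f}.
pose t0 : T := exist _ S (conj sS (fun f _ => lexx (S f))).
pose Rel (s t : T) := `[< forall f, D f -> sval t f <= sval s f >].
have [||A totA|[p [sp pS]] pmin] := @ZL_preorder T t0 Rel.
- by move=> t; apply/asboolP.
- move=> r s t /asboolP rs /asboolP st; apply/asboolP => f Df.
  by rewrite (le_trans (st _ Df))// rs.
- have [[s0 As0]|A0] := pselect (exists s, A s); last first.
    by exists t0 => s As; exfalso; apply: A0; exists s.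
  pose p f := inf [set sval s f | s in A].
  have lbp f : D f -> lbound [set sval s f | s in A] (- S (- f)).
    move=> Df _ [[s [ss sS']] As <-] /=.
    by rewrite (le_trans _ (sublinear_opp ss Df))// lerN2 sS'//; exact: DN.
  have ple f s : D f -> A s -> p f <= sval s f.
    by move=> Df As; apply: ge_inf; [exists (- S (- f)); exact: lbp|exists s].
  have lep f x : (forall s, A s -> x <= sval s f) -> x <= p f.
    move=> h; apply: lb_le_inf; first by exists (sval s0 f), s0.
    by move=> _ [s As <-]; exact: h.
  have sp : sublinear p.
    split.
    + apply/eqP; rewrite eq_le; apply/andP; split.
        by rewrite (le_trans (ple _ _ D0 As0))//; have [[-> _ _]] := svalP s0.
      by apply: (lep) => s As; have [[-> _ _]] := svalP s.
    (* The infima for f and for g involve different members s and t of the chain; the smaller of the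
       two serves for both. *)
    + move=> f g Df Dg; rewrite -lerBlDr; apply: (lep) => s As.
      rewrite lerBlDr -lerBlDl; apply: (lep) => t At; rewrite lerBlDl.
      have [/asboolP h|/asboolP h] := totA _ _ As At.
        apply: le_trans (ple _ _ (DD Df Dg) At) _.
        have [[_ tD _] _] := svalP t.
        by rewrite (le_trans (tD _ _ Df Dg))// lerD2r h.
      apply: le_trans (ple _ _ (DD Df Dg) As) _.
      have [[_ sD _] _] := svalP s.
      by rewrite (le_trans (sD _ _ Df Dg))// lerD2l h.
    + move=> a f a0 Df; apply/eqP; rewrite eq_le; apply/andP; split.
        rewrite mulrC -ler_pdivrMr//; apply: (lep) => s As.
        rewrite ler_pdivrMr// mulrC; have [[_ _ sZ] _] := svalP s.
        by rewrite -sZ//; apply: ple => //; exact: DZ.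
      apply: (lep) => s As; have [[_ _ ->//] _] := svalP s.
      by rewrite ler_pM2l// ple.
  have pS f : D f -> p f <= S f.
    by move=> Df; rewrite (le_trans (ple _ _ Df As0))//; apply: (svalP s0).2.
  exists (exist _ p (conj sp pS)) => s As; apply/asboolP => f Df /=.
  exact: ple.
- exists p => // p' sp' p'p f Df.
  have p'S g : D g -> p' g <= S g by move=> Dg; rewrite (le_trans (p'p _ Dg))// pS.
  have := pmin (exist _ p' (conj sp' p'S)).
  by rewrite /Rel /= => h; apply: (asboolW (h _)) => //; apply/asboolP.
Qed.

(** A minimal sublinear functional is odd, since shaving it along f cannot lower it, and an odd
    sublinear functional is linear. Starting from S shaved along f0 yields L (- f0) <= - S f0, hence
    equality at f0. *)
Theorem hahn_banach S f0 : sublinear S -> D f0 ->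
  exists L : V -> R,
    [/\ forall f g, D f -> D g -> L (f + g) = L f + L g,
        forall a f, D f -> L (a *: f) = a * L f,
        forall f, D f -> L f <= S f &
        L f0 = S f0].
Proof.
move=> sS Df0.
have [p [sp pS] pmin] := exists_minimal_sublinear (sublinear_shave sS Df0).
have pN f : D f -> p (- f) = - p f.
  move=> Df; apply/eqP; rewrite eq_le; apply/andP; split; last first.
    by have := sublinear_opp sp Df; lra.
  rewrite (le_trans _ (shave_opp sp Df))//.
  by apply: pmin (DN Df); [exact: sublinear_shave|exact: shave_le_id].
have [p0 pD pZ] := sp.
have pD' f g : D f -> D g -> p (f + g) = p f + p g.
  move=> Df Dg; apply/eqP; rewrite eq_le pD//=.
  have := pD _ _ (DN Df) (DN Dg).
  by rewrite -opprD !pN//; [lra|exact: DD].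
exists p; split => //.
- move=> a f Df; have [a0|a0|->] := ltgtP a 0; last by rewrite scale0r mul0r.
    rewrite -[in LHS](opprK a) scaleNr pN; last exact: DZ.
    by rewrite pZ// ?oppr_gt0// mulNr opprK.
  by rewrite pZ.
- by move=> f Df; rewrite (le_trans (pS _ Df))// shave_le_id.
apply/eqP; rewrite eq_le (le_trans (pS _ Df0)) ?shave_le_id//=.
have := le_trans (pS _ (DN Df0)) (shave_opp sS Df0).
by rewrite pN//; lra.
Qed.

End HahnBanach.

(** * Real polynomials and moment functionals *)

Section RealAndImaginaryParts.
Context {R : realType}.
Local Notation C := R[i].
Implicit Types (p g : {poly C}) (q : {poly R}) (t : R).

Definition reP p : {poly R} := \poly_(k < size p) complex.Re p`_k.
Definition imP p : {poly R} := \poly_(k < size p) complex.Im p`_k.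
(** The real polynomial with values |p(t)|^2 on the real line, which turns int |p|^2 d mu into a
    moment functional. *)
Definition sqn p : {poly R} := reP p ^+ 2 + imP p ^+ 2.

Lemma horner_reP p t : (reP p).[t] = complex.Re p.[t%:C].
Proof.
rewrite horner_poly horner_coef Rej_sum; apply: eq_bigr => k _.
by rewrite -rmorphXn /= RejM /= mulr0 subr0.
Qed.

Lemma horner_imP p t : (imP p).[t] = complex.Im p.[t%:C].
Proof.
rewrite horner_poly horner_coef Imj_sum; apply: eq_bigr => k _.
by rewrite -rmorphXn /= ImjM /= mulr0 add0r.
Qed.

Lemma horner_sqn p t : (sqn p).[t] = csq p.[t%:C].
Proof. by rewrite hornerD !horner_exp horner_reP horner_imP. Qed.

Definition cP q : {poly C} := map_poly (real_complex R) q.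

Lemma horner_cP q t : (cP q).[t%:C] = (q.[t])%:C.
Proof. exact: horner_map. Qed.

End RealAndImaginaryParts.

Section Moments.
Context {R : realType}.
Local Notation C := R[i].
Local Notation RB := (measurableTypeR R).
Implicit Types (mu nu : {measure set RB -> \bar R}) (q : {poly R}).

Lemma measurable_horner q : measurable_fun [set: RB] (fun t : RB => q.[t]).
Proof.
rewrite (_ : (fun t : RB => q.[t]) = fun t => \sum_(k < size q) q`_k * t ^+ k); last first.
  by apply/funext => t; rewrite horner_coef.
by apply: measurable_sum => k; apply: measurable_funM => //; exact: measurable_funX.
Qed.

Lemma measurable_hornerV q : (forall t, q.[t] != 0) ->
  measurable_fun [set: RB] (fun t : RB => (q.[t])^-1).
Proof.
move=> q0; apply: continuous_measurable_fun => t.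
by apply: cvgV => //; exact: continuous_horner.
Qed.

Lemma integrable_horner mu q : finite_moments mu ->
  mu.-integrable setT (fun t : RB => (q.[t])%:E).
Proof.
move=> hm.
rewrite (_ : (fun t : RB => (q.[t])%:E) =
    fun t => (\sum_(k < size q) (q`_k * t ^+ k)%:E)%E); last first.
  by apply/funext => t; rewrite horner_coef sumEFin.
by apply: integrable_sum => //= k _; under eq_fun do rewrite EFinM; exact: integrableZl.
Qed.

Definition mom mu q : R := (\int[mu]_t (q.[t]))%R.

Lemma eq_mom mu p q : (forall t, p.[t] = q.[t]) -> mom mu p = mom mu q.
Proof. by move=> h; apply: eq_Rintegral => t _; rewrite h. Qed.

Lemma momXn mu k : mom mu 'X^k = fine (\int[mu]_t (t ^+ k)%:E)%E.
Proof. by rewrite /mom; under eq_Rintegral do rewrite hornerXn. Qed.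

Lemma integrable_bounded mu (f : RB -> R) (B : R) : mu setT \is a fin_num ->
  measurable_fun setT f -> (forall t, `|f t| <= B) ->
  mu.-integrable setT (EFin \o f).
Proof.
move=> mufin mf fB; apply: measurable_bounded_integrable => //.
  by rewrite -ge0_fin_numE.
exists B; split; first by rewrite num_real.
by move=> x Bx t _; apply: (le_trans (fB t)); exact: ltW.
Qed.

Section MomTheory.
Variable mu : {measure set RB -> \bar R}.
Hypothesis hm : finite_moments mu.

Lemma momE q : (\int[mu]_t (q.[t])%:E = (mom mu q)%:E)%E.
Proof. by rewrite /mom /Rintegral fineK// integrable_fin_num//; exact: integrable_horner. Qed.

Lemma momD p q : mom mu (p + q) = mom mu p + mom mu q.
Proof.
rewrite /mom -RintegralD//; [|exact: integrable_horner..].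
by apply: eq_Rintegral => t _; rewrite hornerD.
Qed.

Lemma momZ a q : mom mu (a *: q) = a * mom mu q.
Proof.
rewrite /mom -RintegralZl//; last exact: integrable_horner.
by apply: eq_Rintegral => t _; rewrite hornerZ.
Qed.

Lemma momN q : mom mu (- q) = - mom mu q.
Proof. by rewrite -scaleN1r momZ mulN1r. Qed.

Lemma mom0 : mom mu 0 = 0.
Proof. by rewrite -[X in mom mu X](scale0r 0) momZ mul0r. Qed.

Lemma mom_sum (I : Type) (r : seq I) P (F : I -> {poly R}) :
  mom mu (\sum_(i <- r | P i) F i) = \sum_(i <- r | P i) mom mu (F i).
Proof. exact: (big_morph _ momD mom0). Qed.

Lemma le_mom p q : (forall t, p.[t] <= q.[t]) -> mom mu p <= mom mu q.
Proof. by move=> h; apply: le_Rintegral => //; exact: integrable_horner. Qed.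

Lemma mom_ge0 q : (forall t, 0 <= q.[t]) -> 0 <= mom mu q.
Proof. by move=> h; apply: Rintegral_ge0. Qed.

Lemma momXn_sum q : mom mu q = \sum_(k < size q) q`_k * mom mu 'X^k.
Proof.
rewrite -[in LHS](coefK q) poly_def mom_sum.
by apply: eq_bigr => k _; rewrite momZ.
Qed.

Lemma finite_moments_fin_num : mu setT \is a fin_num.
Proof.
have := integrable_fin_num measurableT (hm 0).
under eq_integral do rewrite expr0.
by rewrite integral_cst// mul1e.
Qed.

Lemma integrable_dominated (f : RB -> R) q :
  measurable_fun setT f -> (forall t, `|f t| <= q.[t]) ->
  mu.-integrable setT (EFin \o f).
Proof.
move=> mf fq; apply: (le_integrable measurableT _ _ (integrable_horner q hm)).
  exact/measurable_EFinP.
by move=> t _; rewrite /= lee_fin (le_trans (fq t))// ler_norm.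
Qed.

End MomTheory.

Lemma same_moments_mom mu nu : finite_moments mu -> finite_moments nu ->
  same_moments mu nu -> forall q, mom mu q = mom nu q.
Proof.
move=> hm hn h q; rewrite (momXn_sum hm) (momXn_sum hn).
apply: eq_bigr => k _; congr (_ * _); by rewrite !momXn h.
Qed.

Lemma same_momentsP mu nu : finite_moments mu -> finite_moments nu ->
  (forall q, mom mu q = mom nu q) -> same_moments mu nu.
Proof.
move=> hm hn h n; have := congr1 (@EFin R) (h 'X^n); rewrite !momXn.
by rewrite (fineK (integrable_fin_num measurableT (hm n)))
  (fineK (integrable_fin_num measurableT (hn n))).
Qed.

End Moments.

(** * Measures with a given distribution function *)

Section MeasureOfFunctional.
Context {R : realType}.
Local Notation RB := (measurableTypeR R).

Lemma exists_stieltjes_measure (G : R -> R) :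
  {homo G : x y / x <= y} -> (forall x, G @ at_right x --> G x) ->
  exists nu : {measure set RB -> \bar R},
    forall a b, a <= b -> nu `]a, b]%classic = (G b - G a)%:E.
Proof.
move=> nd rc.
pose G' : cumulative R R := HB.pack G (isCumulative.Build R _ R G nd rc).
exists (lebesgue_stieltjes_measure G') => a b ab.
transitivity (wlength G `]a, b]%classic); last by rewrite wlength_itv_bnd.
by have := @measurable_mu_extE _ _ _ (wlength G') `]a, b]%classic (is_ocitv a b).
Qed.

Lemma stieltjes_measure_limits (G : R -> R) (m : R)
    (nu : {measure set RB -> \bar R}) :
  (forall a b, a <= b -> nu `]a, b]%classic = (G b - G a)%:E) ->
  (forall e, 0 < e -> exists y, forall x, x <= - y -> `|G x| <= e) ->
  (forall e, 0 < e -> exists y, forall x, y <= x -> `|m - G x| <= e) ->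
  nu setT = m%:E /\ forall x, nu `]-oo, x]%classic = (G x)%:E.
Proof.
move=> nuE G0 Gm.
(* Continuity from below along increasing half-open intervals; it is applied to the whole line and
   to half-lines. *)
have cvgI (a b : nat -> R) l :
    (forall n, a n <= b n) -> (forall n, a n.+1 <= a n) -> (forall n, b n <= b n.+1) ->
    (forall e, 0 < e -> exists N, forall n, (N <= n)%N -> `|l - (G (b n) - G (a n))| <= e) ->
    nu (\bigcup_n `]a n, b n]%classic) = l%:E.
  move=> ab ad bi h; have c1 : (nu \o (fun n => `]a n, b n]%classic)) x @[x --> \oo] --> l%:E.
    rewrite (_ : nu \o _ = fun n => (G (b n) - G (a n))%:E); last first.
      by apply/funext => n; rewrite /= nuE.
    apply/cvg_EFin; first by near=> n.
    apply/cvgrPdist_le => e e0; have [N hN] := h _ e0.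
    by exists N => // n /= Nn; exact: hN.
  have mI : measurable (\bigcup_n `]a n, b n]%classic : set RB).
    by apply: bigcup_measurable.
  have c2 : (nu \o (fun n => `]a n, b n]%classic)) x @[x --> \oo] -->
      nu (\bigcup_n `]a n, b n]%classic).
    apply: nondecreasing_cvg_mu => //.
    apply/nondecreasing_seqP => n; apply/subsetPset => t /=; rewrite !in_itv/=.
    by case/andP => h1 h2; rewrite (le_lt_trans (ad n))//= (le_trans h2).
  exact: cvg_unique c2 c1.
split.
  rewrite -(_ : \bigcup_n `](- n%:R), n%:R]%classic = setT); last first.
    exact: (bigcup_itvT false false).
  apply: cvgI => [n|n|n|e e0].
  - by rewrite (@le_trans _ _ 0)// oppr_le0.
  - by rewrite lerN2 ler_nat.
  - by rewrite ler_nat.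
  have e2 : 0 < e / 2 by rewrite divr_gt0.
  have [y hy] := G0 _ e2; have [z hz] := Gm _ e2.
  exists (Num.truncn (Num.max 0 (Num.max y z))).+1 => n Nn.
  have nyz : Num.max y z <= n%:R.
    rewrite (@le_trans _ _ (Num.max 0 (Num.max y z)))//; first by rewrite le_max lexx orbT.
    rewrite ltW// (@lt_le_trans _ _ ((Num.truncn (Num.max 0 (Num.max y z))).+1%:R))//; last by rewrite ler_nat.
    by rewrite truncnS_gt.
  have [yn zn] : y <= n%:R /\ z <= n%:R by move: nyz; rewrite ge_max => /andP.
  rewrite opprB addrCA addrC.
  rewrite (le_trans (ler_normD _ _))//.
  have := hy (- n%:R); rewrite lerN2 => /(_ yn).
  by have := hz _ zn; lra.
move=> x; rewrite (_ : `]-oo, x]%classic = \bigcup_n `]x - n%:R, x]%classic); last first.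
  apply/seteqP; split => [t /=|t [n _ /=]]; rewrite !in_itv/=; last by case/andP.
  move=> tx; exists (Num.truncn (x - t)).+1 => //=; rewrite in_itv/= tx andbT.
  by rewrite ltrBlDl -ltrBlDr truncnS_gt.
apply: cvgI => [n|n|n|e e0].
- by rewrite gerBl.
- by rewrite lerB// ler_nat.
- exact: lexx.
have [y hy] := G0 _ e0.
exists (Num.truncn (Num.max 0 (x + y))).+1 => n Nn.
rewrite opprB addrCA subrr addr0; apply: hy.
rewrite lerBlDl -lerBlDr opprK.
rewrite (@le_trans _ _ (Num.max 0 (x + y)))//; first by rewrite le_max lexx orbT.
rewrite ltW// (@lt_le_trans _ _ ((Num.truncn (Num.max 0 (x + y))).+1%:R))//; last by rewrite ler_nat.
by rewrite truncnS_gt.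
Unshelve. all: by end_near. Qed.

End MeasureOfFunctional.

Lemma eq_dist_le (R : realFieldType) (x y : R) :
  (forall e, 0 < e -> `|x - y| <= e) -> x = y.
Proof.
move=> h; apply/eqP; rewrite -subr_eq0 -normr_eq0; apply/eqP.
apply: contrapT => /eqP n0; have n1 : 0 < `|x - y| by rewrite lt_def n0 normr_ge0.
by have := h (`|x - y| / 2); rewrite divr_gt0// => /(_ isT); lra.
Qed.

(** * Integral representation of positive functionals *)

Section Representation.
Context {R : realType}.
Local Notation RB := (measurableTypeR R).
Implicit Types (f g h : R -> R) (q : {poly R}).

Definition polybd f := exists q : {poly R}, forall t, `|f t| <= q.[t].

Lemma polybdD f g : polybd f -> polybd g -> polybd (fun t => f t + g t).
Proof.
move=> [p hp] [q hq]; exists (p + q) => t.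
by rewrite hornerD (le_trans (ler_normD _ _))// lerD.
Qed.

Lemma polybdZ (a : R) f : polybd f -> polybd (fun t => a * f t).
Proof.
move=> [p hp]; exists (`|a| *: p) => t.
by rewrite hornerZ normrM ler_wpM2l.
Qed.

Lemma polybdB f g : polybd f -> polybd g -> polybd (fun t => f t - g t).
Proof.
move=> [p hp] [q hq]; exists (p + q) => t.
by rewrite hornerD (le_trans (ler_normB _ _))// lerD.
Qed.

Lemma polybd_bounded (B : R) f : (forall t, `|f t| <= B) -> polybd f.
Proof. by move=> h; exists B%:P => t; rewrite hornerC. Qed.

Lemma polybd_horner q : polybd (horner q).
Proof.
exists (1 + q ^+ 2) => t; rewrite hornerD hornerC horner_exp.
by rewrite ler_norml; apply/andP; split; nra.
Qed.

Definition step (x t : R) : R := (t <= x)%R%:R.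

Lemma polybd_step x : polybd (step x).
Proof.
by apply: (@polybd_bounded 1) => t; rewrite /step; case: (t <= x); rewrite ?normr1 ?normr0.
Qed.

Definition clip (M t : R) : R := Num.max (- M) (Num.min M t).

Lemma clip_id M t : - M <= t -> t <= M -> clip M t = t.
Proof. by move=> h1 h2; rewrite /clip (min_idPr h2) (max_idPr h1). Qed.

Lemma clip_hi M t : 0 <= M -> M <= t -> clip M t = M.
Proof. by move=> M0 h; rewrite /clip (min_idPl h) (max_idPr _)//; lra. Qed.

Lemma clip_lo M t : 0 <= M -> t <= - M -> clip M t = - M.
Proof.
move=> M0 h; rewrite /clip (max_idPl _)// ge_min h orbT //.
Qed.

Lemma clip_bound M t : 0 <= M -> `|clip M t| <= M.
Proof.
move=> M0; rewrite /clip ler_norml; apply/andP; split.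
  by rewrite le_max lexx.
by rewrite ge_max ge_min lexx/= andbT; lra.
Qed.

Lemma clip_lip M s t : 0 <= M -> `|clip M s - clip M t| <= `|s - t|.
Proof.
move=> M0; wlog st : s t / s <= t.
  move=> h; have [/h//|/ltW/h] := leP s t.
  by rewrite distrC [leRHS]distrC.
have h : clip M s <= clip M t.
  rewrite /clip ge_max !le_max lexx ge_min; apply/orP; right.
  by rewrite !le_min !ge_min lexx st !orbT.
rewrite [leRHS]ler0_norm ?subr_le0// ler0_norm ?subr_le0// !opprB.
have [tM|Mt] := leP t (- M).
  by rewrite !clip_lo ?subrr ?subr_ge0// (le_trans st).
have [sM|Ms] := leP M s.
  by rewrite !clip_hi ?subrr ?subr_ge0// (le_trans sM).
have h1 : clip M t <= t.
  by rewrite /clip ge_max (ltW Mt)/= ge_min lexx orbT.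
have h2 : s <= clip M s.
  by rewrite /clip le_max le_min (ltW Ms) lexx orbT.
by rewrite lerB.
Qed.

Lemma measurable_clip M : measurable_fun [set: RB] (clip M : RB -> R).
Proof.
by apply: measurable_funTS; apply: measurable_maxr => //; apply: measurable_minr.
Qed.

Variable Lam : (R -> R) -> R.
Hypothesis LamD : forall f g, polybd f -> polybd g ->
  Lam (fun t => f t + g t) = Lam f + Lam g.
Hypothesis LamZ : forall a f, polybd f -> Lam (fun t => a * f t) = a * Lam f.
Hypothesis Lam_mono : forall f g, polybd f -> polybd g ->
  (forall t, f t <= g t) -> Lam f <= Lam g.

Local Notation m0 := (Lam (fun=> 1)).

Lemma polybd_cst (a : R) : polybd (fun=> a).
Proof. by apply: (@polybd_bounded `|a|) => t. Qed.

Lemma Lam_cst a : Lam (fun=> a) = a * m0.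
Proof.
rewrite -LamZ; last exact: polybd_cst.
by congr Lam; apply/funext => t; rewrite mulr1.
Qed.

Lemma LamB f g : polybd f -> polybd g -> Lam (fun t => f t - g t) = Lam f - Lam g.
Proof.
move=> hf hg; have := LamD hf (polybdZ (-1) hg); rewrite LamZ// mulN1r => <-.
by congr Lam; apply/funext => t; rewrite mulN1r.
Qed.

Lemma Lam_ge0 f : polybd f -> (forall t, 0 <= f t) -> 0 <= Lam f.
Proof.
move=> hf f0; have := Lam_mono (polybd_cst 0) hf f0.
by rewrite Lam_cst mul0r.
Qed.

Lemma Lam_dist f g (q : {poly R}) : polybd f -> polybd g ->
  (forall t, `|f t - g t| <= q.[t]) -> `|Lam f - Lam g| <= Lam (horner q).
Proof.
move=> hf hg h; rewrite -LamB// ler_norml; apply/andP; split.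
  rewrite -mulN1r -LamZ; last exact: polybd_horner.
  apply: Lam_mono => [||t]; [exact/polybdZ/polybd_horner|exact: polybdB|].
  by have := h t; rewrite ler_norml mulN1r => /andP[].
apply: Lam_mono => [||t]; [exact: polybdB|exact: polybd_horner|].
by have := h t; rewrite ler_norml => /andP[].
Qed.

Lemma Lam_sum (I : Type) (r : seq I) (F : I -> R -> R) :
  (forall i, polybd (F i)) ->
  polybd (fun t => \sum_(i <- r) F i t) /\
  Lam (fun t => \sum_(i <- r) F i t) = \sum_(i <- r) Lam (F i).
Proof.
move=> hF; elim: r => [|i r [IH1 IH2]].
  rewrite big_nil (_ : (fun t : R => _) = fun=> 0); last by apply/funext => t; rewrite big_nil.
  by rewrite Lam_cst mul0r; split => //; exact: polybd_cst.
rewrite big_cons (_ : (fun t : R => _) = fun t => F i t + \sum_(i <- r) F i t); last first.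
  by apply/funext => t; rewrite big_cons.
by split; [exact: polybdD|rewrite LamD// IH2].
Qed.

(** [Lam] is defined on step functions as well, so a distribution function can be read off. F may
    fail to be right-continuous; G is its right-continuous version. *)
Let F x := Lam (step x).
Let G x := inf [set F y | y in [set y | x < y]].

Let F_nd x y : x <= y -> F x <= F y.
Proof.
move=> xy; apply: Lam_mono => [||t]; [exact: polybd_step..|].
by rewrite /step ler_nat; case: (leP t x) => // tx; rewrite (le_trans tx xy).
Qed.

Let F_ge0 x : 0 <= F x.
Proof. by apply: Lam_ge0 => [|t]; [exact: polybd_step|exact: ler0n]. Qed.

Let F_le x : F x <= m0.
Proof.
apply: Lam_mono => [||t]; [exact: polybd_step|exact: polybd_cst|].
by rewrite /step lern1 leq_b1.
Qed.

Let G_lt x y : x < y -> G x <= F y.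
Proof. by move=> xy; apply: ge_inf; [exists 0 => _ [z _ <-]|exists y]. Qed.

Let le_G x a : (forall y, x < y -> a <= F y) -> a <= G x.
Proof.
move=> h; apply: lb_le_inf; last by move=> _ [y xy <-]; exact: h.
by exists (F (x + 1)), (x + 1) => //=; rewrite ltrDl.
Qed.

Let F_le_G x : F x <= G x.
Proof. by apply: le_G => y xy; apply: F_nd; exact: ltW. Qed.

Let G_nd : {homo G : x y / x <= y}.
Proof. by move=> x y xy; apply: le_G => z yz; apply: G_lt; exact: le_lt_trans yz. Qed.

Let G_rc x : G @ at_right x --> G x.
Proof.
apply/cvgrPdist_le => e e0.
have [y xy hy] : exists2 y, x < y & F y < G x + e.
  apply: contrapT => /forall2NP h.
  suff : G x + e <= G x by lra.
  by apply: le_G => y xy; rewrite leNgt; apply/negP; have [] := h y.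
near=> z; have xz : x <= z by near: z; exact: nbhs_right_ge.
have zy : z < y by near: z; exact: nbhs_right_lt.
rewrite distrC ger0_norm ?subr_ge0 ?G_nd//.
by have := G_lt zy; lra.
Unshelve. all: by end_near. Qed.

Let m2 := Lam (fun t => t ^+ 2).

Let polybd_sqr : polybd (fun t => t ^+ 2).
Proof. by exists ('X^2) => t; rewrite hornerXn ger0_norm ?sqr_ge0. Qed.

Let small (y e c m : R) : 1 <= y -> m <= y * e -> 0 <= c -> y ^+ 2 * c <= m -> c <= e.
Proof.
move=> y1 hm c0 hc; have y0 : 0 < y by lra.
have : y * (y * c) <= y * e by rewrite mulrA -expr2 (le_trans hc).
by rewrite ler_pM2l//; apply: le_trans; rewrite ler_peMl.
Qed.

(** Chebyshev: y^2 times the indicator of t <= - y lies below t^2, so the second moment bounds the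
    mass near minus infinity. Passing from y to y + 1 creates the strict inequality that [G_lt]
    needs. *)
Let G_Ny (e : R) : 0 < e -> exists y, forall x, x <= - y -> `|G x| <= e.
Proof.
move=> e0; pose y := Num.max 1 (m2 / e).
have y1 : 1 <= y by rewrite le_max lexx.
have ym : m2 <= y * e by rewrite -ler_pdivrMr// le_max lexx orbT.
exists (y + 1) => x xy; rewrite ger0_norm; last exact: le_trans (F_le_G x).
have /G_lt/le_trans : x < - y by lra.
apply; have : y ^+ 2 * F (- y) <= m2.
  rewrite -LamZ; last exact: polybd_step.
  apply: Lam_mono => [||t]; [exact/polybdZ/polybd_step|exact: polybd_sqr|].
  rewrite /step; case: (leP t (- y)) => ty; rewrite ?mulr1 ?mulr0 ?sqr_ge0//.
  have : 0 <= (- t - y) * (- t + y) by apply: mulr_ge0; lra.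
  by rewrite -[y ^+ 2 <= _]subr_ge0 subr_sqr; congr (0 <= _); ring.
exact: (small y1 ym).
Qed.

Let G_y (e : R) : 0 < e -> exists y, forall x, y <= x -> `|m0 - G x| <= e.
Proof.
move=> e0; pose y := Num.max 1 (m2 / e).
have y1 : 1 <= y by rewrite le_max lexx.
have ym : m2 <= y * e by rewrite -ler_pdivrMr// le_max lexx orbT.
exists y => x xy; rewrite ger0_norm; last first.
  rewrite subr_ge0; apply: le_trans (F_le (x + 1)).
  by apply: G_lt; rewrite ltrDl.
apply: (@le_trans _ _ (m0 - F y)).
  by rewrite lerB// (le_trans (F_le_G y))// G_nd.
have : y ^+ 2 * (m0 - F y) <= m2.
  rewrite -LamB; [|exact: polybd_cst|exact: polybd_step].
  rewrite -LamZ; last by apply: polybdB; [exact: polybd_cst|exact: polybd_step].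
  apply: Lam_mono => [||t]; [|exact: polybd_sqr|].
    by apply/polybdZ/polybdB; [exact: polybd_cst|exact: polybd_step].
  rewrite /step; case: (leP t y) => ty; rewrite ?subrr ?subr0 ?mulr1 ?mulr0 ?sqr_ge0//.
  have : 0 <= (t - y) * (t + y) by apply: mulr_ge0; lra.
  by rewrite -[y ^+ 2 <= _]subr_ge0 subr_sqr; congr (0 <= _); ring.
by apply: (small y1 ym); rewrite subr_ge0.
Qed.

Lemma exists_distribution : exists nu : {measure set RB -> \bar R},
  nu setT = m0%:E /\ exists G : R -> R,
  [/\ forall x, nu `]-oo, x]%classic = (G x)%:E,
      forall x, F x <= G x & forall x y, x < y -> G x <= F y].
Proof.
have [nu nuE] := exists_stieltjes_measure G_nd G_rc.
exists nu; have [h1 h2] := stieltjes_measure_limits nuE G_Ny G_y.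
by split => //; exists G; split.
Qed.

Section Quadrature.
Variables (nu : {measure set RB -> \bar R}) (H : R -> R).
Hypothesis nuT : nu setT = m0%:E.
Hypothesis nu_H : forall x, nu `]-oo, x]%classic = (H x)%:E.
Hypothesis H_ge : forall x, F x <= H x.
Hypothesis H_lt : forall x y, x < y -> H x <= F y.

Let nu_fin : nu setT \is a fin_num. Proof. by rewrite nuT. Qed.

Let measurable_step x : measurable_fun setT (step x : RB -> R).
Proof.
rewrite (_ : step x = \1_(`]-oo, x]%classic)); last first.
  by apply/funext => t; rewrite indicE /step mem_setE in_itv.
exact: measurable_indic.
Qed.

Let Rintegral_step x : (\int[nu]_t step x t)%R = H x.
Proof.
rewrite /Rintegral -[RHS]/(fine (H x)%:E) -nu_H -[in RHS](setIT `]-oo, x]%classic).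
rewrite -integral_indic//; congr fine; apply: eq_integral => t _.
by rewrite indicE /step mem_setE in_itv.
Qed.

Section Mesh.
Variables (phi x : R -> R) (y : nat -> R) (K d : R).
Hypothesis K0 : 0 <= K.
Hypothesis d0 : 0 < d.
Hypothesis ynd : forall j, y j.+1 = y j + d.
Hypothesis phi_lip : forall s t, `|phi s - phi t| <= K * `|s - t|.

(** The step function with value phi (y j.+1) on each ]y j, y j.+1], written as a sum of jumps so
    that [Lam] and the integral can be compared one jump at a time. *)
Fixpoint psi m (t : R) : R :=
  if m is m'.+1 then psi m' t + (phi (y m) - phi (y m')) * (1 - step (y m') t)
  else phi (y 0).

Let y_mono m n : (m <= n)%N -> y m <= y n.
Proof.
elim: n => [|n IH]; first by rewrite leqn0 => /eqP ->.
rewrite leq_eqVlt => /predU1P[->//|]; rewrite ltnS => /IH h.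
by rewrite ynd (le_trans h)// lerDl ltW.
Qed.

Let psi_gt m t : y m < t -> psi m t = phi (y m).
Proof.
elim: m => // m IH mt /=.
have ymt : y m < t by rewrite (le_lt_trans _ mt)// y_mono.
by rewrite IH// /step leNgt ymt subr0 mulr1 addrC subrK.
Qed.

Let psi_le m t : (forall s, s <= y 0 -> phi s = phi (y 0)) -> t <= y m ->
  `|phi t - psi m t| <= K * d.
Proof.
move=> h; have Kd0 : 0 <= K * d by rewrite mulr_ge0// ltW.
elim: m => [|m IH] tm; first by rewrite /= h// subrr normr0.
have [tym|ymt] := leP t (y m).
  by rewrite /= /step tym subrr mulr0 addr0 IH.
rewrite /= psi_gt// /step (leNgt t) ymt subr0 mulr1 addrCA subrr addr0.
rewrite (le_trans (phi_lip _ _))// ler_wpM2l// ler0_norm ?subr_le0//.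
by rewrite ynd in tm *; lra.
Qed.

Let psi_meas m : measurable_fun setT (psi m : RB -> R).
Proof.
elim: m => //= m IH; apply: measurable_funD => //.
by apply: measurable_funM => //; apply: measurable_funB.
Qed.

Let psi_bd m : exists B, forall t, `|psi m t| <= B.
Proof.
elim: m => [|m [B hB]]; first by exists `|phi (y 0)|.
exists (B + `|phi (y m.+1) - phi (y m)|) => t /=.
rewrite (le_trans (ler_normD _ _))// lerD// normrM ler_piMr//.
by rewrite /step; case: (t <= y m); rewrite ?subrr ?subr0 ?normr0 ?normr1.
Qed.

Let psi_int m : nu.-integrable setT (EFin \o psi m).
Proof. by have [B hB] := psi_bd m; exact: integrable_bounded (psi_meas m) hB. Qed.

(** F and H may differ at a jump, but H (y j) - F (y j) is at most the increment of F to y j.+1. The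
    increments telescope, so the bound stays below K d m0 for any number of mesh points. *)
Let psi_diff m : `|Lam (psi m) - (\int[nu]_t psi m t)%R| <= K * d * (F (y m) - F (y 0)).
Proof.
have m0E : fine (nu setT) = m0 by rewrite nuT.
have Kd0 : 0 <= K * d by rewrite mulr_ge0// ltW.
elim: m => [|m IH].
  rewrite (_ : Lam (psi 0) = phi (y 0) * m0); last exact: Lam_cst.
  rewrite (_ : (\int[nu]_t psi 0 t)%R = phi (y 0) * m0); last first.
    by rewrite /= Rintegral_cst// m0E.
  by rewrite !subrr normr0 mulr0.
set D := phi (y m.+1) - phi (y m).
have polst : polybd (fun t => 1 - step (y m) t).
  by apply: polybdB; [exact: polybd_cst|exact: polybd_step].
have -> : Lam (psi m.+1) = Lam (psi m) + D * (m0 - F (y m)).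
  rewrite /= LamD; [|have [B hB] := psi_bd m; exact: polybd_bounded hB|exact: polybdZ].
  by rewrite LamZ// LamB//; [exact: polybd_cst|exact: polybd_step].
have stint : nu.-integrable setT (EFin \o (fun t : RB => 1 - step (y m) t)).
  apply: (@integrable_bounded _ _ _ 1) => //.
    by apply: measurable_funB.
  by move=> t; rewrite /step; case: (t <= y m); rewrite ?subrr ?subr0 ?normr0 ?normr1.
have -> : (\int[nu]_t psi m.+1 t)%R = (\int[nu]_t psi m t)%R + D * (m0 - H (y m)).
  rewrite /= RintegralD//; last by apply: (integrableZl measurableT D stint).
  rewrite RintegralZl// RintegralB//.
  - by rewrite Rintegral_cst// mul1r m0E Rintegral_step.
  - by apply: (@integrable_bounded _ _ _ 1) => // t; rewrite normr1.
  - apply: (@integrable_bounded _ _ _ 1) => // t.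
    by rewrite /step; case: (t <= y m); rewrite ?normr0 ?normr1.
rewrite (_ : _ - _ = (Lam (psi m) - (\int[nu]_t psi m t)%R) + D * (H (y m) - F (y m))); last by ring.
rewrite (le_trans (ler_normD _ _))//.
rewrite (_ : K * d * _ = K * d * (F (y m) - F (y 0)) + K * d * (F (y m.+1) - F (y m))); last by ring.
rewrite lerD// normrM (ger0_norm (x := H _ - _)) ?subr_ge0//.
apply: ler_pM => //; first by rewrite subr_ge0.
  rewrite /D (le_trans (phi_lip _ _))// ynd addrAC subrr add0r ger0_norm// ltW//.
by rewrite lerB// H_lt// ynd ltrDl.
Qed.

(** One error K d m0 for each replacement: phi by psi under [Lam], [Lam] by the integral, and psi by
    phi under the integral. *)
Lemma mesh_approx m : (forall s, s <= y 0 -> phi s = phi (y 0)) ->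
  (forall s, y m <= s -> phi s = phi (y m)) -> measurable_fun setT (phi : RB -> R) ->
  polybd phi ->
  (exists B, forall t, `|phi t| <= B) ->
  `|Lam phi - (\int[nu]_t phi t)%R| <= 3 * (K * d * m0).
Proof.
move=> lo hi mphi pphi [B hB]; have Kd0 : 0 <= K * d by rewrite mulr_ge0// ltW.
have close t : `|phi t - psi m t| <= K * d.
  have [tm|mt] := leP t (y m); first exact: psi_le.
  by rewrite psi_gt// (hi _ (ltW mt)) subrr normr0.
have h1 : `|Lam phi - Lam (psi m)| <= K * d * m0.
  have [B' hB'] := psi_bd m.
  rewrite (_ : K * d * m0 = Lam (horner (K * d)%:P)).
    by apply: Lam_dist => // [|t]; [exact: polybd_bounded hB'|rewrite hornerC].
  by rewrite -Lam_cst; congr Lam; apply/funext => t; rewrite hornerC.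
have h2 : `|(\int[nu]_t psi m t)%R - (\int[nu]_t phi t)%R| <= K * d * m0.
  have iphi : nu.-integrable setT (EFin \o phi) by exact: integrable_bounded hB.
  have id : nu.-integrable setT (EFin \o (fun t => psi m t - phi t)).
    apply: (@integrable_bounded _ _ _ (K * d)) => //; first exact: measurable_funB.
    by move=> t; rewrite distrC.
  rewrite -RintegralB// (le_trans (le_normr_Rintegral _ _))//.
  rewrite (_ : m0 = fine (nu setT)); last by rewrite nuT.
  rewrite -Rintegral_cst//; apply: le_Rintegral => //.
  - exact: (integrable_norm id).
  - apply: (@integrable_bounded _ _ _ (K * d)) => // t; rewrite ger0_norm//.
  - by move=> t _; rewrite distrC.
have h3 := psi_diff m.
have h4 : K * d * (F (y m) - F (y 0)) <= K * d * m0.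
  by rewrite ler_wpM2l//; have := F_le (y m); have := F_ge0 (y 0); lra.
rewrite (_ : _ - _ = (Lam phi - Lam (psi m)) + (Lam (psi m) - (\int[nu]_t psi m t)%R)
  + ((\int[nu]_t psi m t)%R - (\int[nu]_t phi t)%R)); last by ring.
rewrite (le_trans (ler_normD _ _))//.
have := ler_normD (Lam phi - Lam (psi m)) (Lam (psi m) - (\int[nu]_t psi m t)%R).
lra.
Qed.

End Mesh.

Let m0_ge0 : 0 <= m0.
Proof. exact: le_trans (F_ge0 0) (F_le 0). Qed.

Lemma clip_repr (h : R -> R) (M K : R) : 0 < M -> 0 <= K ->
  (forall s t, `|s| <= M -> `|t| <= M -> `|h s - h t| <= K * `|s - t|) ->
  measurable_fun setT (h \o clip M : RB -> R) ->
  polybd (h \o clip M) /\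
  Lam (h \o clip M) = (\int[nu]_t (h \o clip M) t)%R.
Proof.
move=> M0 K0 hK mh; have M0' := ltW M0.
have hbd t : `|(h \o clip M) t| <= `|h 0| + K * M.
  rewrite /= -[h (clip M t)](subrK (h 0)) (le_trans (ler_normD _ _))// addrC lerD//.
  rewrite (le_trans (hK _ _ _ _))// ?clip_bound ?normr0//.
  by rewrite subr0 ler_wpM2l// clip_bound.
have pbd := polybd_bounded hbd; split => //.
apply: eq_dist_le => e e0.
(* The mesh width 2 M / m turns the error 3 K d m0 into 6 K M m0 / m, which is then at most e. *)
pose m := (Num.truncn (6 * (K * M * m0) / e)).+1.
have m0' : 0 < m%:R :> R by rewrite ltr0n.
pose d := 2 * M / m%:R; have d0 : 0 < d by rewrite divr_gt0// mulr_gt0.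
pose y (j : nat) := - M + d * j%:R.
have ym : y m = M by rewrite /y /d; field; rewrite gt_eqF.
have y0 : y 0%N = - M by rewrite /y mulr0 addr0.
apply: (le_trans (@mesh_approx _ y K d K0 d0 _ _ m _ _ mh pbd _)).
- by move=> j; rewrite /y -natr1; ring.
- move=> s t; rewrite /= (le_trans (hK _ _ _ _)) ?clip_bound//.
  by rewrite ler_wpM2l// clip_lip.
- by move=> s; rewrite y0 => sM; rewrite /= !clip_lo.
- by move=> s; rewrite ym => sM; rewrite /= !clip_hi.
- by exists (`|h 0| + K * M).
have : 6 * (K * M * m0) / e < m%:R by rewrite truncnS_gt.
rewrite ltr_pdivrMr// => /ltW.
rewrite (_ : 3 * (K * d * m0) = 6 * (K * M * m0) / m%:R); last by rewrite /d; field; rewrite gt_eqF.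
by rewrite ler_pdivrMr// [e * _]mulrC.
Qed.

Let clipX_lip n (M : R) : 0 < M -> exists2 K, 0 <= K &
  forall s t, `|s| <= M -> `|t| <= M -> `|s ^+ n - t ^+ n| <= K * `|s - t|.
Proof.
move=> M0; elim: n => [|n [K K0 hK]].
  by exists 0 => // s t _ _; rewrite !expr0 subrr normr0 mul0r.
exists (M * K + M ^+ n).
  by rewrite addr_ge0 ?mulr_ge0 ?exprn_ge0// ltW.
move=> s t sM tM; rewrite !exprS.
rewrite (_ : s * s ^+ n - t * t ^+ n = s * (s ^+ n - t ^+ n) + (s - t) * t ^+ n); last by ring.
rewrite (le_trans (ler_normD _ _))// [leRHS]mulrDl lerD//.
  rewrite normrM -mulrA ler_pM//; exact: hK.
by rewrite normrM mulrC ler_wpM2r// normrX lerXn2r ?nnegrE// ltW.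
Qed.

Let measurable_clipX n M : measurable_fun setT ((fun t => t ^+ n) \o clip M : RB -> R).
Proof. by apply: measurable_funX; exact: measurable_clip. Qed.

(** Where |t| > M the difference is at most |t|^n <= |t|^(n+1) / M, and u <= 1 + u^2. A polynomial
    majorant can be evaluated by both [Lam] and nu. *)
Let clip_far M t n : 1 <= M ->
  `|t ^+ n - clip M t ^+ n| <= (1 + t ^+ (2 * n.+1)) / M.
Proof.
move=> M1; have M0 : 0 < M by lra.
have even_ge0 k : 0 <= t ^+ (2 * k) by rewrite exprM exprn_ge0// sqr_ge0.
have [tM|Mt] := leP `|t| M.
  rewrite clip_id; [|by move: tM; rewrite ler_norml => /andP[]..].
  by rewrite subrr normr0 divr_ge0 ?(ltW M0)// addr_ge0.
have h1 : `|t ^+ n - clip M t ^+ n| <= `|t| ^+ n.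
  have [t0|t0] := leP 0 t.
    have e : `|t| = t by rewrite ger0_norm.
    rewrite clip_hi ?(ltW M0)//; last by rewrite -e ltW.
    rewrite e ger0_norm ?subr_ge0 ?lerXn2r ?nnegrE//; [|exact: ltW|by rewrite -e ltW].
    by rewrite gerBl exprn_ge0// ltW.
  have e : `|t| = - t by rewrite ltr0_norm.
  rewrite clip_lo ?(ltW M0)//; last by lra.
  have -> : t ^+ n = (-1) ^+ n * (- t) ^+ n by rewrite -exprMn mulN1r opprK.
  rewrite (exprNn M) -mulrBr normrM normrX normrN1 expr1n mul1r e.
  rewrite ger0_norm ?subr_ge0 ?lerXn2r ?nnegrE//; [|lra..].
  by rewrite gerBl exprn_ge0// ltW.
rewrite (le_trans h1)// ler_pdivlMr//.
rewrite (@le_trans _ _ (`|t| ^+ n.+1))//.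
  by rewrite exprSr ler_wpM2l ?exprn_ge0// ltW.
have -> : t ^+ (2 * n.+1) = (`|t| ^+ n.+1) ^+ 2.
  by rewrite mulnC exprM -normrX real_normK ?num_real.
by set u := _ ^+ n.+1; have := sqr_ge0 (u - 1); have := sqr_ge0 u; nra.
Qed.

(** Monotone convergence along the truncations: the integral of each one equals its value under
    [Lam], which is at most that of t^(2 n). *)
Let moments_lty n : (\int[nu]_t (t ^+ (2 * n))%:E < +oo)%E.
Proof.
have even_ge0 (t : R) k : 0 <= t ^+ (2 * k) by rewrite exprM exprn_ge0// sqr_ge0.
pose g (k : nat) (t : RB) := ((clip k.+1%:R t) ^+ (2 * n))%:E.
have clip_nd (j k : nat) (t : R) : (j <= k)%N ->
    clip j.+1%:R t ^+ 2 <= clip k.+1%:R t ^+ 2.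
  move=> jk; have jk' : j.+1%:R <= k.+1%:R :> R by rewrite ler_nat.
  have j0 : 0 < j.+1%:R :> R by rewrite ltr0n.
  have k0 : 0 < k.+1%:R :> R by rewrite ltr0n.
  have [h1|h1] := leP t (- j.+1%:R).
    rewrite (clip_lo _ h1) ?(ltW j0)//.
    have [h2|h2] := leP t (- k.+1%:R); first by rewrite (clip_lo _ h2) ?(ltW k0)//; nra.
    by rewrite clip_id ?(ltW h2)//; [nra|lra].
  have [h2|h2] := leP j.+1%:R t.
    rewrite (clip_hi _ h2) ?(ltW j0)//.
    have [h3|h3] := leP k.+1%:R t; first by rewrite (clip_hi _ h3) ?(ltW k0)//; nra.
    by rewrite clip_id ?(ltW h3)//; [nra|lra].
  by rewrite !clip_id ?(ltW h1) ?(ltW h2)//; lra.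
have lim_g t : limn (g^~ t) = (t ^+ (2 * n))%:E.
  apply/cvg_lim => //; apply/cvg_EFin; first by near=> k.
  apply/cvgrPdist_le => e e0; exists (Num.truncn `|t|) => // k /= hk.
  rewrite clip_id ?subrr ?normr0 ?(ltW e0)//.
    rewrite lerNl (le_trans (ler_norm _))// normrN ltW// (lt_le_trans (truncnS_gt _))//.
    by rewrite ler_nat ltnS.
  rewrite (le_trans (ler_norm _))// ltW// (lt_le_trans (truncnS_gt _))//.
  by rewrite ler_nat ltnS.
have gmeas k : measurable_fun setT (g k).
  by apply/measurable_EFinP; exact: measurable_clipX.
have g0 k t : (0 <= g k t)%E by rewrite lee_fin exprM exprn_ge0// sqr_ge0.
have g_nd t : {homo (g^~ t) : j k / (j <= k)%N >-> (j <= k)%E}.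
  move=> j k jk; rewrite lee_fin !exprM lerXn2r ?nnegrE ?sqr_ge0//.
  exact: clip_nd.
have cvg := @cvg_monotone_convergence _ _ _ nu setT measurableT g gmeas
  (fun k t _ => g0 k t) (fun t _ => g_nd t).
have <- : (\int[nu]_t limn (g^~ t) = \int[nu]_t (t ^+ (2 * n))%:E)%E.
  by apply: eq_integral => t _; rewrite lim_g.
have L0 : polybd (fun t => t ^+ (2 * n)).
  by exists 'X^(2 * n) => t; rewrite hornerXn ger0_norm.
apply: (@le_lt_trans _ _ (Lam (fun t => t ^+ (2 * n)))%:E); last exact: ltry.
have -> : (\int[nu]_t limn (g^~ t))%E = limn (fun k => \int[nu]_t g k t)%E.
  by apply/esym/cvg_lim.
apply: lime_le; first exact: cvgP cvg.
near=> k.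
have k0 : 0 < k.+1%:R :> R by rewrite ltr0n.
have [K K0 hK] := clipX_lip (2 * n) k0.
have [pb e] := clip_repr k0 K0 hK (measurable_clipX _ _).
rewrite /g -[leLHS]fineK; last first.
  apply: integrable_fin_num => //.
  apply: (@integrable_bounded _ _ _ (k.+1%:R ^+ (2 * n))) => //; first exact: measurable_clipX.
  by move=> t; rewrite normrX lerXn2r ?nnegrE ?clip_bound ?(ltW k0).
rewrite lee_fin; apply: (@le_trans _ _ (Lam ((fun t => t ^+ (2 * n)) \o clip k.+1%:R))).
  by rewrite e.
apply: Lam_mono => // t /=.
rewrite !exprM lerXn2r ?nnegrE ?sqr_ge0//.
rewrite -[leLHS]real_normK ?num_real// -[leRHS]real_normK ?num_real//.
rewrite lerXn2r ?nnegrE ?normr_ge0//.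
have := @clip_lip k.+1%:R t 0 (ltW k0).
by rewrite subr0 (clip_id (t := 0)) ?subr0 ?oppr_le0 ?(ltW k0).
Unshelve. all: by end_near. Qed.

Lemma finite_moments_repr : finite_moments nu.
Proof.
move=> n; apply: (@le_integrable _ _ _ _ _ measurableT _
  (fun t : RB => (1 + t ^+ (2 * n))%:E)).
- by apply/measurable_EFinP; exact: measurable_funX.
- move=> t _; rewrite /= lee_fin [leRHS]ger0_norm; last first.
    by rewrite addr_ge0// exprM exprn_ge0// sqr_ge0.
  rewrite mulnC exprM; set u := t ^+ n.
  by have := sqr_ge0 (u - 1); have := sqr_ge0 (u + 1); rewrite ler_norml; nra.
have -> : (fun t : RB => (1 + t ^+ (2 * n))%:E) = (cst 1%:E) \+ (fun t => (t ^+ (2 * n))%:E).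
  by apply/funext => t; rewrite /= EFinD.
apply: integrableD => //.
  by apply: (@integrable_bounded _ nu (cst 1) 1) => // t; rewrite normr1.
apply/integrableP; split; first by apply/measurable_EFinP; exact: measurable_funX.
rewrite (eq_integral (fun t : RB => (t ^+ (2 * n))%:E)); first exact: moments_lty.
by move=> t _; rewrite gee0_abs// lee_fin exprM exprn_ge0// sqr_ge0.
Qed.

(** Truncation at M costs [Lam] at most [Lam (horner Q) / M] and the integral at most
    [mom nu Q / M]; truncated functions are covered by [clip_repr]. *)
Lemma repr (h : R -> R) (Q : {poly R}) :
    measurable_fun setT (h : RB -> R) -> polybd h ->
    (forall M, 1 <= M -> exists2 K, 0 <= K & forall s t, `|s| <= M -> `|t| <= M ->
       `|h s - h t| <= K * `|s - t|) ->
    (forall M t, 1 <= M -> `|h t - h (clip M t)| <= Q.[t] / M) ->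
  Lam h = (\int[nu]_t h t)%R.
Proof.
move=> mh pbh hK hQ; have fm := finite_moments_repr.
apply: eq_dist_le => e e0.
pose M := Num.max 1 ((Lam (horner Q) + mom nu Q) / e).
have M1 : 1 <= M by rewrite le_max lexx.
have M0 : 0 < M by lra.
have hM : Lam (horner Q) + mom nu Q <= M * e by rewrite -ler_pdivrMr// le_max lexx orbT.
have [K K0 hK'] := hK _ M1.
have mhc : measurable_fun setT (h \o clip M : RB -> R).
  by apply: measurableT_comp => //; exact: measurable_clip.
have [pb e1] := clip_repr M0 K0 hK' mhc.
have h1 : `|Lam h - Lam (h \o clip M)| <= Lam (horner Q) / M.
  rewrite mulrC -LamZ; last exact: polybd_horner.
  rewrite (_ : (fun t : R => M^-1 * Q.[t]) = horner (M^-1 *: Q)); last first.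
    by apply/funext => t; rewrite hornerZ.
  by apply: Lam_dist => // t; rewrite hornerZ mulrC; exact: hQ.
have ih : nu.-integrable setT (EFin \o h) by case: pbh => q hq; exact: integrable_dominated hq.
have ihc : nu.-integrable setT (EFin \o (h \o clip M)).
  by case: pb => q hq; exact: integrable_dominated hq.
have h2 : `|(\int[nu]_t (h \o clip M) t)%R - (\int[nu]_t h t)%R| <= mom nu Q / M.
  rewrite -RintegralB// mulrC -momZ//.
  have iB : nu.-integrable setT (EFin \o (fun t => (h \o clip M) t - h t)).
    exact: (integrableB measurableT ihc ih).
  rewrite (le_trans (le_normr_Rintegral _ _))//; apply: le_Rintegral => //.
  - exact: (integrable_norm iB).
  - exact: integrable_horner.
  - by move=> t _; rewrite hornerZ mulrC distrC; exact: hQ.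
rewrite (_ : _ - _ = (Lam h - Lam (h \o clip M)) +
   ((\int[nu]_t (h \o clip M) t)%R - (\int[nu]_t h t)%R)); last by rewrite e1; ring.
rewrite (le_trans (ler_normD _ _))//.
rewrite (le_trans (lerD h1 h2))// -mulrDl ler_pdivrMr// mulrC//.
Qed.

Lemma repr_mom q : Lam (horner q) = mom nu q.
Proof.
have fm := finite_moments_repr.
have hXn n : Lam (fun t => t ^+ n) = mom nu 'X^n.
  rewrite /mom; under eq_Rintegral do rewrite hornerXn.
  apply: (@repr _ (1 + 'X^(2 * n.+1))).
  - exact: measurable_funX.
  - have [p hp] := polybd_horner ('X^n : {poly R}); exists p => t.
    by have := hp t; rewrite hornerXn.
  - by move=> M M1; apply: clipX_lip; lra.
  - by move=> M t M1; rewrite hornerD hornerC hornerXn; exact: clip_far.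
rewrite (momXn_sum fm) (_ : horner q = fun t => \sum_(k < size q) q`_k * t ^+ k); last first.
  by apply/funext => t; rewrite horner_coef.
have pX n : polybd (fun t => t ^+ n).
  have [p hp] := polybd_horner ('X^n : {poly R}); exists p => t.
  by have := hp t; rewrite hornerXn.
have [_ ->] := @Lam_sum _ (index_enum 'I_(size q)) (fun k t => q`_k * t ^+ k) (fun k => polybdZ _ (pX k)).
by apply: eq_bigr => k _; rewrite LamZ// hXn.
Qed.

(** Besides the moments, this is the one value that the determinacy argument compares. *)
Lemma repr_cauchy :
  Lam (fun t => (1 + t ^+ 2)^-1) = (\int[nu]_t (1 + t ^+ 2)^-1)%R.
Proof.
have pos (t : R) : 0 < 1 + t ^+ 2 by have := sqr_ge0 t; lra.
have inv1 (t : R) : 0 <= (1 + t ^+ 2)^-1 <= 1.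
  by rewrite invr_ge0 ltW//= invf_le1// lerDl sqr_ge0.
apply: (@repr _ ('X^2)).
- rewrite (_ : (fun t : R => _) = fun t : R => ((1 + 'X^2).[t])^-1); last first.
    by apply/funext => t; rewrite hornerD hornerC hornerXn.
  by apply: measurable_hornerV => t; rewrite hornerD hornerC hornerXn gt_eqF.
- apply: (@polybd_bounded 1) => t.
  by have /andP[h1 h2] := inv1 t; rewrite ger0_norm.
- move=> M M1; exists 1 => // s t _ _; rewrite mul1r.
  rewrite (_ : _ - _ = (t - s) * ((t + s) / ((1 + s ^+ 2) * (1 + t ^+ 2)))); last first.
    by field; rewrite !gt_eqF.
  rewrite normrM distrC ler_piMr// normrM normfV (gtr0_norm (mulr_gt0 _ _))//.
  rewrite ler_pdivrMr ?mulr_gt0// mul1r ler_norml.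
  have := sqr_ge0 (s + t); have := sqr_ge0 (s - t); have := sqr_ge0 (s * t).
  by move=> *; apply/andP; split; nra.
move=> M t M1; have M0 : 0 < M by lra.
have [tM|Mt] := leP `|t| M.
  rewrite clip_id; [|by move: tM; rewrite ler_norml => /andP[]..].
  by rewrite subrr normr0 hornerXn divr_ge0 ?sqr_ge0// ltW.
apply: (@le_trans _ _ 1).
  have /andP[h1 h2] := inv1 t; have /andP[h3 h4] := inv1 (clip M t).
  by rewrite ler_norml; apply/andP; split; lra.
rewrite hornerXn ler_pdivlMr// mul1r -real_normK ?num_real//; nra.
Qed.

End Quadrature.

Theorem exists_representing_measure :
  exists nu : {measure set RB -> \bar R},
    [/\ finite_moments nu, forall q, Lam (horner q) = mom nu q &
       Lam (fun t => (1 + t ^+ 2)^-1) = (\int[nu]_t (1 + t ^+ 2)^-1)%R].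
Proof.
have [nu [nuT [H [nuH HF HG]]]] := exists_distribution.
exists nu; split.
- exact: finite_moments_repr nuT nuH HF HG.
- exact: repr_mom nuT nuH HF HG.
- exact: repr_cauchy nuT nuH HF HG.
Qed.

End Representation.

(** * Nonnegative polynomials as squared moduli *)

Section NonnegativePolynomials.
Context {R : realType}.
Local Notation C := R[i].
Implicit Types (p g s : {poly C}) (q : {poly R}) (t : R).

Definition conjp p : {poly C} := map_poly (Num.conj : C -> C) p.

Lemma conjpM p g : conjp (p * g) = conjp p * conjp g.
Proof. exact: rmorphM. Qed.

Lemma conjpXsubC z : conjp ('X - z%:P) = 'X - (z^*)%:P.
Proof. exact: map_polyXsubC. Qed.

Lemma horner_conjp p z : (conjp p).[z^*] = (p.[z])^*.
Proof. exact: horner_map. Qed.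

Lemma horner_conjp_real p t : (conjp p).[t%:C] = (p.[t%:C])^*.
Proof. by rewrite -horner_conjp conj_realc. Qed.

Lemma poly_eq_real p g : (forall t, p.[t%:C] = g.[t%:C]) -> p = g.
Proof.
move=> h; apply/eqP; rewrite -subr_eq0; apply/negP => /negP pg0.
pose rs : seq C := [seq (k%:R : R)%:C | k <- iota 0 (size (p - g))].
have h1 : all (root (p - g)) rs.
  by apply/allP => _ /mapP[k _ ->]; rewrite /root hornerD hornerN h subrr.
have h2 : uniq rs.
  rewrite map_inj_uniq ?iota_uniq// => j k /complexI /eqP.
  by rewrite eqr_nat => /eqP.
by have := max_poly_roots pg0 h1 h2; rewrite size_map size_iota ltnn.
Qed.

Lemma ge0_right_limit q (a : R) : (forall t, a < t -> 0 <= q.[t]) -> 0 <= q.[a].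
Proof.
move=> h; have c : q.[t] @[t --> a^'+] --> q.[a].
  by apply: cvg_at_right_filter; exact: continuous_horner.
rewrite -(cvg_lim _ c)//; apply: limr_ge; first exact: cvgP c.
by near=> t; apply: h; near: t; exact: nbhs_right_gt.
Unshelve. all: by end_near. Qed.

Lemma le0_left_limit q (a : R) : (forall t, t < a -> q.[t] <= 0) -> q.[a] <= 0.
Proof.
move=> h; rewrite -oppr_ge0 -[a]opprK.
have -> : - q.[- - a] = (- (q \Po (- 'X))).[- a].
  by rewrite hornerN horner_comp hornerN hornerX.
apply: ge0_right_limit => t at_.
by rewrite hornerN horner_comp hornerN hornerX oppr_ge0 h// ltrNl.
Qed.

(** Induction on the degree: a real root is at least double because p does not change sign there,
    and a nonreal root comes with its conjugate. Either way two linear factors split off, one for g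
    and one for its conjugate. *)
Lemma ge0_poly_factor p : (forall t, 0 <= p.[t%:C]) ->
  exists g, p = g * conjp g.
Proof.
elim: {p}(size p) {-2}p (leqnn (size p)) => [|n IH] p.
  by rewrite leqn0 size_poly_eq0 => /eqP -> _; exists 0; rewrite mul0r.
move=> pn p0; have [p1|p1] := eqVneq (size p) 1%N.
  have /size_poly1P[c _ pE] : size p == 1%N by rewrite p1.
  have c0 : 0 <= c by have := p0 0; rewrite pE hornerC.
  exists (sqrtC c)%:P; rewrite /conjp map_polyC /= -polyCM.
  by rewrite conj_Creal ?ger0_real ?sqrtC_ge0// -expr2 sqrtCK.
have [->|pn0] := eqVneq p 0; first by exists 0; rewrite mul0r.
have pc : conjp p = p.
  apply: poly_eq_real => t; rewrite horner_conjp_real conj_Creal//.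
  by rewrite ger0_real.
have /closed_rootP[z pz] : size p != 1%N by [].
have [s pE] := factor_theorem p z pz.
have ss : (size s < size p)%N.
  rewrite pE size_Mmonic ?monicXsubC ?size_XsubC ?addn2//.
  by apply: contra_neq pn0 => s0; rewrite pE s0 mul0r.
have [zr|znr] := eqVneq (z^*) z.
  have [a zE] : exists a : R, z = a%:C.
    exists (complex.Re z).
    by case: z zr {pz pE} => a b [] h; congr (_ +i* _); lra.
  rewrite zE in pz pE.
  have Xa0 : 'X - (a%:C)%:P != 0 by rewrite polyXsubC_eq0.
  have sc : conjp s = s.
    apply: (mulIf Xa0); rewrite -pE -[in RHS]pc pE conjpM conjpXsubC.
    by rewrite conj_realc.
  have sval t : p.[t%:C] = s.[t%:C] * (t - a)%:C.
    by rewrite pE hornerM hornerXsubC rmorphB.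
  have sreal t : s.[t%:C] = ((reP s).[t])%:C.
    rewrite horner_reP; have : (s.[t%:C])^* = s.[t%:C].
      by rewrite -horner_conjp_real sc.
    by case: (s.[_]) => u v [] h; congr (_ +i* _); lra.
  have prod_ge0 t : 0 <= (reP s).[t] * (t - a).
    by have := p0 t; rewrite sval sreal -rmorphM ler0c.
  (* Since s(t) (t - a) >= 0, the limits from the left and from the right give s(a) <= 0 and s(a) >=
     0. *)
  have sa : s.[a%:C] = 0.
    rewrite sreal; congr (_%:C); apply/eqP; rewrite eq_le; apply/andP; split.
      apply: le0_left_limit => t ta; have := prod_ge0 t.
      by rewrite nmulr_lge0// subr_lt0.
    apply: ge0_right_limit => t ta; have := prod_ge0 t.
    by rewrite pmulr_lge0// subr_gt0.
  have /factor_theorem[s2 sE] : root s a%:C by rewrite /root sa.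
  have s2val t : p.[t%:C] = s2.[t%:C] * ((t - a) ^+ 2)%:C.
    by rewrite sval sE hornerM hornerXsubC -rmorphB -mulrA -rmorphM.
  have s2c : conjp s2 = s2.
    apply: (mulIf Xa0); rewrite -sE -[in RHS]sc sE conjpM conjpXsubC.
    by rewrite conj_realc.
  have s2real t : s2.[t%:C] = ((reP s2).[t])%:C.
    rewrite horner_reP; have : (s2.[t%:C])^* = s2.[t%:C].
      by rewrite -horner_conjp_real s2c.
    by case: (s2.[_]) => u v [] h; congr (_ +i* _); lra.
  have s2_ge0 t : a < t -> 0 <= (reP s2).[t].
    move=> at_; have := p0 t; rewrite s2val s2real -rmorphM ler0c pmulr_lge0//.
    by rewrite exprn_gt0// subr_gt0.
  have s2p t : 0 <= s2.[t%:C].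
    rewrite s2real ler0c; have [at_|ta|<-] := ltgtP a t.
    - exact: s2_ge0.
    - have := p0 t; rewrite s2val s2real -rmorphM ler0c pmulr_lge0//.
      by rewrite -sqrrN exprn_gt0// opprB subr_gt0.
    - exact: ge0_right_limit s2_ge0.
  have s2n : (size s2 <= n)%N.
    rewrite -ltnS (leq_trans _ pn)// (leq_ltn_trans _ ss)//.
    have [->|s20] := eqVneq s2 0; first by rewrite size_poly0.
    by rewrite sE size_Mmonic ?monicXsubC// size_XsubC addn2.
  have [g gE] := IH s2 s2n s2p.
  exists (g * ('X - (a%:C)%:P)).
  by rewrite conjpM conjpXsubC conj_realc pE sE gE; ring.
have : root p (z^*).
  by rewrite /root -[in p.[_]]pc horner_conjp (eqP pz) rmorph0.
rewrite pE rootM root_XsubC (negbTE znr) orbF => /factor_theorem[s2 sE].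
have quad t : ('X - (z^*)%:P).[t%:C] * ('X - z%:P).[t%:C] = (csq (t%:C - z))%:C.
  by rewrite !hornerXsubC -mulJc rmorphB /= conj_realc mulrC.
have zt t : 0 < csq (t%:C - z).
  rewrite csq_gt0 subr_eq0; apply: contra znr => /eqP <-.
  by rewrite conj_realc.
have s2p t : 0 <= s2.[t%:C].
  have := p0 t; rewrite pE sE !hornerM -mulrA quad pmulr_lge0//.
  by rewrite ltcR.
have s2n : (size s2 <= n)%N.
  rewrite -ltnS (leq_trans _ pn)// (leq_ltn_trans _ ss)//.
  have [->|s20] := eqVneq s2 0; first by rewrite size_poly0.
  by rewrite sE size_Mmonic ?monicXsubC// size_XsubC addn2.
have [g gE] := IH s2 s2n s2p.
exists (g * ('X - z%:P)).
by rewrite conjpM conjpXsubC sE gE; ring.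
Qed.

End NonnegativePolynomials.

(** * The Christoffel function at i *)

Section ChristoffelFunction.
Context {R : realType}.
Local Notation C := R[i].
Local Notation RB := (measurableTypeR R).
Implicit Types (p g : {poly C}) (q : {poly R}).
Variable mu : {measure set RB -> \bar R}.
Hypothesis hm : finite_moments mu.

Definition christoffel_vanishes := forall eps : R, 0 < eps ->
  exists2 p : {poly C}, p.['i] = 1 & mom mu (sqn p) < eps.

Local Notation f0 := (fun t : R => (1 + t ^+ 2)^-1).

Let pos (t : R) : 0 < 1 + t ^+ 2. Proof. by have := sqr_ge0 t; lra. Qed.

Lemma conjci : ('i : C)^* = - 'i.
Proof. by apply/eqP; rewrite eq_complex /= oppr0 !eqxx. Qed.

Lemma horner_conjp_i p : (conjp p).['i] = (p.[- 'i])^*.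
Proof. by rewrite -horner_conjp; congr (_.[_]); rewrite rmorphN /= conjci opprK. Qed.

(** Scaling turns the failure for p(i) = 1 into a bound for every p. Conjugating the coefficients
    preserves |p| on the real line and exchanges i and - i, so the bound holds at both points. *)
Lemma christoffel_lower_bound : ~ christoffel_vanishes ->
  exists2 e0 : R, 0 < e0 & forall p,
    csq p.['i] * e0 <= mom mu (sqn p) /\ csq p.[- 'i] * e0 <= mom mu (sqn p).
Proof.
move=> /existsNP[e0 /not_implyP[e00 h]]; exists e0 => //.
have main p : csq p.['i] * e0 <= mom mu (sqn p).
  have [->|pi0] := eqVneq p.['i] 0.
    by rewrite csq0 mul0r; apply: mom_ge0 => t; rewrite horner_sqn csq_ge0.
  rewrite leNgt; apply/negP => hlt; apply: h; exists (p.['i]^-1 *: p).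
    by rewrite hornerZ mulVf.
  have -> : mom mu (sqn (p.['i]^-1 *: p)) = mom mu ((csq p.['i])^-1 *: sqn p).
    by apply: eq_mom => t; rewrite hornerZ !horner_sqn hornerZ csqM csqV.
  rewrite momZ// mulrC ltr_pdivrMr ?csq_gt0//.
  by rewrite mulrC.
move=> p; split => //; have := main (conjp p); rewrite horner_conjp_i csqJ.
by rewrite (@eq_mom _ _ (sqn (conjp p)) (sqn p))// => t; rewrite !horner_sqn horner_conjp_real csqJ.
Qed.

(* If 1/(1+t^2) is squeezed between polynomials q1 <= f0 <= q2 with small
   integral of q2 - q1, then (1+X^2) q2 - 1 = |g|^2 and 1 - (1+X^2) q1 = |g1|^2
   on the real line, and suitable combinations of g and g1 divided by X -+ i have
   a small norm compared with their values at -i and i. *)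
Lemma squeeze_contradiction (e0 : R) (q1 q2 : {poly R}) : 0 < e0 ->
  (forall p, csq p.['i] * e0 <= mom mu (sqn p) /\ csq p.[- 'i] * e0 <= mom mu (sqn p)) ->
  (forall t, q1.[t] <= f0 t) -> (forall t, f0 t <= q2.[t]) ->
  e0 / 5 <= mom mu (q2 - q1).
Proof.
move=> e00 hb h1 h2; rewrite leNgt; apply/negP; set e := mom mu (q2 - q1) => he.
have [g gE] : exists g, cP ((1 + 'X^2) * q2 - 1) = g * conjp g.
  apply: ge0_poly_factor => t; rewrite horner_cP ler0c.
  rewrite hornerD hornerN hornerM hornerD hornerXn hornerC subr_ge0 mulrC.
  by rewrite -ler_pdivrMr// mul1r.
have [g1 g1E] : exists g, cP (1 - (1 + 'X^2) * q1) = g * conjp g.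
  apply: ge0_poly_factor => t; rewrite horner_cP ler0c.
  rewrite hornerD hornerN hornerM hornerD hornerXn hornerC subr_ge0 mulrC.
  by rewrite -ler_pdivlMr// mul1r.
have gval t : csq g.[t%:C] = (1 + t ^+ 2) * q2.[t] - 1.
  apply: complexI; rewrite -mulJc -horner_conjp_real -hornerM -gE horner_cP.
  by rewrite hornerD hornerN hornerM hornerD hornerXn hornerC.
have g1val t : csq g1.[t%:C] = 1 - (1 + t ^+ 2) * q1.[t].
  apply: complexI; rewrite -mulJc -horner_conjp_real -hornerM -g1E horner_cP.
  by rewrite hornerD hornerN hornerM hornerD hornerXn hornerC.
have ii : 1 + 'i ^+ 2 = 0 :> C by rewrite sqr_i addrN.
have cPi q : (cP ((1 + 'X^2) * q)).['i] = 0.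
  rewrite /cP rmorphM rmorphD rmorph1 /= map_polyXn hornerM hornerD hornerC hornerXn.
  by rewrite ii mul0r.
pose a := g.['i]; pose b := g1.['i].
(* The factor 1 + X^2 vanishes at i, so there g (conjp g) and g1 (conjp g1) equal - 1 and 1. This
   expresses the values at - i through a and b. *)
have ga : a * (g.[- 'i])^* = -1.
  by rewrite -horner_conjp_i -hornerM -gE /cP rmorphB hornerD hornerN cPi rmorph1 hornerC sub0r.
have gb : b * (g1.[- 'i])^* = 1.
  by rewrite -horner_conjp_i -hornerM -g1E /cP rmorphB hornerD hornerN cPi rmorph1 hornerC subr0.
have a0 : a != 0 by apply: contra_eq_neq ga => ->; rewrite mul0r eq_sym oppr_eq0 oner_eq0.
have b0 : b != 0 by apply: contra_eq_neq gb => ->; rewrite mul0r eq_sym oner_eq0.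
pose A := csq a; pose B := csq b.
have A0 : 0 < A by rewrite csq_gt0.
have B0 : 0 < B by rewrite csq_gt0.
(* a combination of g and g1 vanishing at w = -+ i, divided by X - w *)
have comb (x y w : C) : (w = 'i \/ w = - 'i) -> x * g.[w] + y * g1.[w] = 0 ->
    exists2 h : {poly C}, x *: g + y *: g1 = h * ('X - w%:P) &
      mom mu (sqn h) <= 2 * (csq x + csq y) * e.
  move=> wi xy0.
  have /factor_theorem[h hE] : root (x *: g + y *: g1) w.
    by rewrite /root hornerD !hornerZ xy0.
  exists h => //; rewrite -mulrA mulrCA -momZ// -momZ//.
  apply: le_mom => // t; rewrite !hornerZ horner_sqn hornerD hornerN.
  have wE : csq (t%:C - w) = 1 + t ^+ 2.
    by case: wi => ->; rewrite /csq /=; ring.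
  have : csq h.[t%:C] * (1 + t ^+ 2) = csq (x * g.[t%:C] + y * g1.[t%:C]).
    by rewrite -wE -csqM -hornerXsubC -hornerM -hE hornerD !hornerZ.
  have := csqD_le (x * g.[t%:C]) (y * g1.[t%:C]); rewrite !csqM gval g1val.
  move=> hle heq.
  (* On the real line both |g|^2 and |g1|^2 are at most (1 + t^2) (q2 - q1), and the division by X -
     w removes the factor 1 + t^2. *)
  rewrite -(ler_pM2r (pos t)) heq (le_trans hle)//.
  have q21 : q1.[t] <= q2.[t] by apply: le_trans (h1 t) (h2 t).
  have k1 : (1 + t ^+ 2) * q1.[t] <= 1 by rewrite mulrC -ler_pdivlMr// mul1r.
  have k2 : 1 <= (1 + t ^+ 2) * q2.[t] by rewrite mulrC -ler_pdivrMr// mul1r.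
  have := csq_ge0 x; have := csq_ge0 y.
  set P := (1 + t ^+ 2) * q1.[t] in k1 *; set Q := (1 + t ^+ 2) * q2.[t] in k2 *.
  move=> X0 Y0; rewrite (@le_trans _ _ (2 * (csq x * (Q - P) + csq y * (Q - P))))//.
    by rewrite ler_wpM2l// lerD// ler_wpM2l//; lra.
  by rewrite /P /Q le_eqVlt; apply/orP; left; apply/eqP; ring.
have gmi : g.[- 'i] = - (a^*)^-1.
  apply: (mulfI (x := a^*)); first by rewrite fmorph_eq0.
  rewrite mulrN mulfV ?fmorph_eq0//; apply: (can_inj (@conjCK C)).
  by rewrite rmorphM /= conjCK ga rmorphN1.
have gmi1 : g1.[- 'i] = (b^*)^-1.
  apply: (mulfI (x := b^*)); first by rewrite fmorph_eq0.
  rewrite mulfV ?fmorph_eq0//; apply: (can_inj (@conjCK C)).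
  by rewrite rmorphM /= conjCK gb rmorph1.
have i2 : csq ('i + 'i) = 4 :> R by rewrite /csq /=; ring.
(* These coefficients cancel the values at i, and those of the next combination cancel the values at
   - i; each quotient is then evaluated at the opposite point. *)
have [||h hE hle] := comb b (- a) 'i; [by left|by rewrite -/a -/b; ring|].
have [||h' hE' hle'] := comb a^* b^* (- 'i); [by right| |].
  by rewrite gmi gmi1 mulrN !mulfV ?fmorph_eq0// addNr.
have [_ k1] := hb h; have [k2 _] := hb h'.
have e1 : csq h.[- 'i] * 4 = (A + B) ^+ 2 / (A * B).
  have := congr1 (fun p => csq p.[- 'i]) hE; rewrite hornerM csqM hornerXsubC.
  rewrite -opprD csqN i2 => <-; rewrite hornerD !hornerZ gmi gmi1.
  have -> : b * - (a^*)^-1 + - a * (b^*)^-1 = - ((A + B)%:C / (a^* * b^*)).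
    have -> : (A + B)%:C = a * a^* + b * b^* by rewrite !mulJc -rmorphD.
    field.
    by rewrite !fmorph_eq0 a0 b0.
  by rewrite csqN csqM csqV csqR csqM !csqJ.
have e2 : csq h'.['i] * 4 = (A + B) ^+ 2.
  have := congr1 (fun p => csq p.['i]) hE'; rewrite hornerM csqM hornerXsubC opprK i2 => <-.
  rewrite hornerD !hornerZ -/a -/b [a^* * a]mulrC [b^* * b]mulrC !mulJc.
  by rewrite -rmorphD csqR.
have l1 : (A + B) * e0 <= 8 * (A * B) * e.
  have : (A + B) ^+ 2 / (A * B) * e0 <= 4 * (2 * (A + B) * e).
    by rewrite -e1 /A /B; rewrite csqN in hle; lra.
  rewrite mulrAC ler_pdivrMr ?mulr_gt0// => h3; rewrite -(ler_pM2l (addr_gt0 A0 B0)).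
  rewrite (_ : (A + B) * ((A + B) * e0) = (A + B) ^+ 2 * e0); last by ring.
  by rewrite (le_trans h3)// le_eqVlt; apply/orP; left; apply/eqP; ring.
have l2 : (A + B) * e0 <= 8 * e.
  have : (A + B) ^+ 2 * e0 <= 4 * (2 * (A + B) * e).
    by rewrite -e2 /A /B; rewrite !csqJ in hle'; lra.
  move=> h3; rewrite -(ler_pM2l (addr_gt0 A0 B0)).
  rewrite (_ : (A + B) * ((A + B) * e0) = (A + B) ^+ 2 * e0); last by ring.
  by rewrite (le_trans h3)// le_eqVlt; apply/orP; left; apply/eqP; ring.
have s0 : 0 < A + B by rewrite addr_gt0.
have e_ge : 0 < e.
  by rewrite -(pmulr_rgt0 _ (_ : 0 < 8))// (lt_le_trans _ l2)// mulr_gt0.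
(* A and B are not controlled separately. As 4 A B <= (A + B)^2, the bound [l1] gives e0 <= 2 (A +
   B) e, and [l2] then eliminates A + B: e0^2 <= 16 e^2, against e < e0 / 5. *)
have l3 : e0 <= 2 * (A + B) * e.
  rewrite -(ler_pM2l s0) (le_trans l1)//.
  rewrite (_ : (A + B) * (2 * (A + B) * e) = (2 * (A + B) ^+ 2) * e); last by ring.
  by rewrite ler_pM2r//; have := sqr_ge0 (A - B); nra.
have l4 : e0 * e0 <= 16 * e * e.
  rewrite (@le_trans _ _ (2 * (A + B) * e * e0))//; first by rewrite ler_pM2r.
  rewrite (_ : 2 * (A + B) * e * e0 = 2 * e * ((A + B) * e0)); last by ring.
  rewrite (_ : 16 * e * e = 2 * e * (8 * e)); last by ring.
  by rewrite ler_pM2l// mulr_gt0.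
have : 16 * e * e < e0 * e0 by nra.
by rewrite ltNge l4.
Qed.

End ChristoffelFunction.

(** * Polynomial majorants and determinacy *)

Section DeterminateChristoffel.
Context {R : realType}.
Local Notation C := R[i].
Local Notation RB := (measurableTypeR R).
Implicit Types (q : {poly R}) (f g : R -> R).
Variable mu : {measure set RB -> \bar R}.
Hypothesis hm : finite_moments mu.

(** The upper integral over polynomial majorants; its value at - f is minus the lower integral of f,
    the supremum over polynomial minorants. *)
Definition upper_mom f : R :=
  inf [set mom mu q | q in [set q | forall t, f t <= q.[t]]].

Let lb f : polybd f -> exists B, lbound [set mom mu q | q in [set q | forall t, f t <= q.[t]]] B.
Proof.
move=> [p hp]; exists (- mom mu p) => _ [q hq <-]; rewrite -momN//.
apply: le_mom => // t; rewrite hornerN (le_trans _ (hq t))//.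
by have := hp t; rewrite ler_norml => /andP[].
Qed.

Lemma upper_mom_le f q : polybd f -> (forall t, f t <= q.[t]) ->
  upper_mom f <= mom mu q.
Proof. by move=> pf fq; apply: ge_inf; [have [B ?] := lb pf; exists B|exists q]. Qed.

Lemma le_upper_mom f x : polybd f ->
  (forall q, (forall t, f t <= q.[t]) -> x <= mom mu q) -> x <= upper_mom f.
Proof.
move=> [p hp] h; apply: lb_le_inf; last by move=> _ [q hq <-]; exact: h.
by exists (mom mu p), p => //= t; rewrite (le_trans _ (hp t))// ler_norm.
Qed.

Lemma upper_mom_sublinear :
  sublinear (V := R -> R^o) polybd upper_mom.
Proof.
split.
- apply/eqP; rewrite eq_le; apply/andP; split.
    rewrite -(mom0 hm).
    by apply: upper_mom_le => [|t]; [exact: polybd_cst|rewrite horner0].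
  apply: le_upper_mom; first exact: polybd_cst.
  by move=> q hq; apply: mom_ge0 => t; exact: hq.
- move=> f g pf pg; rewrite -lerBlDr; apply: le_upper_mom => // p hp.
  rewrite lerBlDr -lerBlDl; apply: le_upper_mom => // q hq.
  rewrite lerBlDl -momD//; apply: upper_mom_le; first exact: polybdD.
  by move=> t; rewrite hornerD lerD.
- move=> a f a0 pf; apply/eqP; rewrite eq_le; apply/andP; split.
    rewrite mulrC -ler_pdivrMr//; apply: le_upper_mom => // q hq.
    rewrite ler_pdivrMr// mulrC -momZ//; apply: upper_mom_le; first exact: polybdZ.
    by move=> t; rewrite hornerZ ler_pM2l.
  apply: le_upper_mom => [|q hq]; first exact: polybdZ.
  rewrite mulrC -ler_pdivlMr// mulrC -momZ//; apply: upper_mom_le => // t.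
  by rewrite hornerZ mulrC ler_pdivlMr// mulrC; exact: hq.
Qed.

Local Notation f0 := (fun t : R => (1 + t ^+ 2)^-1).

Let polybd_f0 : polybd f0.
Proof.
apply: (@polybd_bounded _ 1) => t.
have t0 : 0 < 1 + t ^+ 2 by have := sqr_ge0 t; lra.
by rewrite ger0_norm ?invr_ge0 ?(ltW t0)// invf_le1// lerDl sqr_ge0.
Qed.

(* A linear functional below [upper_mom] is positive and has the moments of mu;
   Hahn-Banach prescribes its value at one function. *)
Lemma exists_moment_solution (s : R) : exists nu : {measure set RB -> \bar R},
  [/\ finite_moments nu, forall q, mom mu q = mom nu q &
      s * (\int[nu]_t f0 t)%R = upper_mom (fun t => s * f0 t)].
Proof.
pose f := fun t => s * f0 t.
have pf : polybd f by exact: polybdZ.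
have [L [LD LZ LS Lf]] := @hahn_banach R (R -> R^o) polybd (polybd_cst 0)
  (@polybdD R) (@polybdZ R) upper_mom f upper_mom_sublinear pf.
have LD' g h : polybd g -> polybd h -> L (fun t => g t + h t) = L g + L h := LD g h.
have LZ' a g : polybd g -> L (fun t => a * g t) = a * L g := LZ a g.
have mono g h : polybd g -> polybd h -> (forall t, g t <= h t) -> L g <= L h.
  move=> pg ph gh; have := LS (fun t => g t - h t) (polybdB pg ph).
  have -> : L (fun t => g t - h t) = L g - L h.
    have := LD' _ _ pg (polybdZ (-1) ph); rewrite LZ'// mulN1r => <-.
    by congr L; apply/funext => t; rewrite mulN1r.
  have : upper_mom (fun t => g t - h t) <= mom mu 0.
    by apply: upper_mom_le => [|t]; [exact: polybdB|rewrite horner0 subr_le0].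
  by rewrite mom0//; lra.
have Lq q : L (horner q) = mom mu q.
  have le1 p : L (horner p) <= mom mu p.
    by rewrite (le_trans (LS _ (polybd_horner p)))// upper_mom_le//; exact: polybd_horner.
  apply/eqP; rewrite eq_le le1/= -lerN2 -momN//.
  rewrite (le_trans _ (le1 _))//.
  have := LZ' (-1) _ (polybd_horner q); rewrite mulN1r => <-.
  rewrite le_eqVlt; apply/orP; left; apply/eqP; congr L; apply/funext => t.
  by rewrite hornerN mulN1r.
have [nu [fm hmom hf0]] := @exists_representing_measure R L LD' LZ' mono.
exists nu; split => // [q|]; first by rewrite -Lq.
by rewrite -hf0 -LZ'// Lf.
Qed.

Theorem determinate_christoffel : determinate mu -> christoffel_vanishes mu.
Proof.
move=> [_ det]; apply: contrapT => /(christoffel_lower_bound hm)[e0 e00 hb].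
have key s : s * (\int[mu]_t f0 t)%R = upper_mom (fun t => s * f0 t).
  have [nu [fm hmom <-]] := exists_moment_solution s.
  have eqm := det nu fm (same_momentsP hm fm hmom).
  congr (_ * _); rewrite /Rintegral; congr fine.
  by apply: eq_measure_integral => D mD _; rewrite eqm.
(* A majorant q2 of f0 and a majorant q1 of - f0 squeeze f0 between - q1 and q2. By [key] the two
   upper integrals add up to 0, which is the contradiction. *)
have gap : e0 / 5 <= upper_mom (fun t => 1 * f0 t) + upper_mom (fun t => -1 * f0 t).
  rewrite -lerBlDr; apply: le_upper_mom; first exact: polybdZ.
  move=> q2 hq2; rewrite lerBlDr -lerBlDl; apply: le_upper_mom; first exact: polybdZ.
  move=> q1 hq1; rewrite lerBlDl -momD//.
  have -> : q2 + q1 = q2 - (- q1) by rewrite opprK.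
  apply: (squeeze_contradiction hm e00 hb) => t.
    by have := hq1 t; rewrite mulN1r hornerN; lra.
  by have := hq2 t; rewrite mul1r.
have : 0 < e0 / 5 by rewrite divr_gt0.
by rewrite -!key in gap; lra.
Qed.

End DeterminateChristoffel.

(** * A density criterion for determinacy *)

Section RationalFunctions.
Context {R : realType}.
Local Notation C := R[i].
Local Notation RB := (measurableTypeR R).
Implicit Types (p r s : {poly C}) (q : {poly R}) (h u : R -> C) (w : C).

Definition cmeasurable h :=
  measurable_fun setT (fun t : RB => complex.Re (h t)) /\
  measurable_fun setT (fun t : RB => complex.Im (h t)).

Lemma cmeasurableM h u : cmeasurable h -> cmeasurable u ->
  cmeasurable (fun t => h t * u t).
Proof.
move=> [hr hi] [ur ui]; split.
  under eq_fun do rewrite RejM.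
  by apply: measurable_funB; exact: measurable_funM.
under eq_fun do rewrite ImjM.
by apply: measurable_funD; exact: measurable_funM.
Qed.

Lemma cmeasurable_horner p : cmeasurable (fun t => p.[t%:C]).
Proof.
split.
  under eq_fun do rewrite -horner_reP.
  exact: measurable_horner.
under eq_fun do rewrite -horner_imP.
exact: measurable_horner.
Qed.

Lemma cmeasurable_cauchy w : complex.Im w != 0 ->
  cmeasurable (fun t => (t%:C - w)^-1).
Proof.
case: w => x y /= y0.
pose q : {poly R} := ('X - x%:P) ^+ 2 + (y ^+ 2)%:P.
have qE t : q.[t] = (t - x) ^+ 2 + (y ^+ 2).
  by rewrite hornerD horner_exp hornerXsubC hornerC.
have q0 t : q.[t] != 0.
  by rewrite qE gt_eqF// ltr_wpDl ?sqr_ge0// lt_def sqrf_eq0 y0 sqr_ge0.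
have mq := measurable_hornerV q0.
split.
  rewrite (_ : (fun t : RB => _) = fun t => (t - x) * (q.[t])^-1); last first.
    by apply/funext => t; rewrite qE /= sub0r sqrrN.
  apply: measurable_funM => //; exact: measurable_funB.
rewrite (_ : (fun t : RB => _) = fun t => y * (q.[t])^-1); last first.
  by apply/funext => t; rewrite qE /= sub0r sqrrN mulNr opprK.
by apply: measurable_funM.
Qed.

Variables (mu nu : {measure set RB -> \bar R}).
Hypotheses (hmu : finite_moments mu) (hnu : finite_moments nu).
Hypothesis hmom : forall q, mom mu q = mom nu q.
Hypothesis hdense : forall w, complex.Im w != 0 -> forall eps : R, 0 < eps ->
  exists s : {poly C}, mom mu (sqn (1 - ('X - w%:P) * s)) < eps.

(** Since r is an arbitrary complex polynomial, the factors 1 / (t - w) can be brought into h one at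
    a time. *)
Definition equal_integrals h := [/\ cmeasurable h, exists B, forall t, csq (h t) <= B &
  forall r, (\int[mu]_t complex.Re (h t * r.[t%:C]))%R =
            (\int[nu]_t complex.Re (h t * r.[t%:C]))%R].

Lemma Re_mul_le (x y : C) (eta : R) : 0 < eta ->
  `|complex.Re (x * y)| <= eta * csq x + csq y / eta.
Proof.
case: x y => [a b] [c d] e0; rewrite /csq /=.
have h (s t : R) : 2 * `|s * t| <= eta * s ^+ 2 + t ^+ 2 / eta.
  rewrite normrM -(ler_pM2r e0) [leRHS]mulrDl divfK ?gt_eqF//.
  rewrite -(real_normK (x := s)) ?num_real// -(real_normK (x := t)) ?num_real//.
  by have := sqr_ge0 (eta * `|s| - `|t|); nra.
have := h a c; have := h b d; have := ler_normB (a * c) (b * d).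
have := normr_ge0 (a * c); have := normr_ge0 (b * d).
by rewrite (mulrDl (c ^+ 2)) (mulrDr eta); lra.
Qed.

Lemma integrable_Re_mul (m : {measure set RB -> \bar R}) h B r :
  finite_moments m -> cmeasurable h -> (forall t, csq (h t) <= B) ->
  m.-integrable setT (EFin \o (fun t : RB => complex.Re (h t * r.[t%:C]))).
Proof.
move=> hm mh hB; apply: (@integrable_dominated _ _ hm _ (B%:P + sqn r)).
  exact: (cmeasurableM mh (cmeasurable_horner r)).1.
move=> t; rewrite hornerD hornerC horner_sqn.
by rewrite (le_trans (Re_mul_le _ _ ltr01))// mul1r divr1 lerD2r.
Qed.

Lemma equal_integrals1 : equal_integrals (fun=> 1).
Proof.
split.
- by split.
- by exists 1 => t; rewrite csqR expr1n.
- move=> r; have := hmom (reP r); rewrite /mom.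
  have e (m : {measure set RB -> \bar R}) : (\int[m]_t complex.Re (1 * r.[t%:C]))%R = (\int[m]_t (reP r).[t])%R.
    by apply: eq_Rintegral => t _; rewrite horner_reP mul1r.
  by rewrite !e.
Qed.

(** With p = 1 - (t - w) s, the function r / (t - w) is r s + r p / (t - w). The first term is
    covered by the hypothesis on h; the second is small for both measures, because int |p|^2 is a
    moment functional and has the same value for nu. *)
Lemma equal_integrals_cauchy h w : complex.Im w != 0 -> equal_integrals h ->
  equal_integrals (fun t => h t * (t%:C - w)^-1).
Proof.
move=> w0 [mh [B hB] hE]; pose u t : C := (t%:C - w)^-1.
have y0 : 0 < complex.Im w ^+ 2 by rewrite lt_def sqrf_eq0 w0 sqr_ge0.
have tw t : t%:C - w != 0.
  by apply: contra_neq w0 => /(congr1 (@complex.Im R)); case: (w) => a b /=; lra.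
have uB t : csq (u t) <= (complex.Im w ^+ 2)^-1.
  rewrite csqV lef_pV2 ?posrE ?csq_gt0//.
  by case: (w) => x y; rewrite /csq /= sub0r sqrrN lerDr sqr_ge0.
have mhu : cmeasurable (fun t => h t * u t) by apply: cmeasurableM => //; exact: cmeasurable_cauchy.
have B0 : 0 <= B by rewrite (le_trans _ (hB 0))// csq_ge0.
have hub t : csq (h t * u t) <= B / complex.Im w ^+ 2.
  by rewrite csqM ler_pM// csq_ge0.
split => //; first by exists (B / complex.Im w ^+ 2).
move=> r; apply: eq_dist_le => e e0.
pose D := B / complex.Im w ^+ 2 * mom mu (sqn r) + 1.
have sqn0 (m : {measure set RB -> \bar R}) p : 0 <= mom m (sqn p).
  by apply: mom_ge0 => t; rewrite horner_sqn csq_ge0.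
have Bw : 0 <= B / complex.Im w ^+ 2 by rewrite divr_ge0// ltW.
have D0 : 0 < D by rewrite ltr_wpDl// mulr_ge0.
(* The weight in [Re_mul_le]: with this eta and the s chosen next, each of the two terms there
   integrates to at most e / 4. *)
pose eta := e / (4 * D); have eta0 : 0 < eta by rewrite divr_gt0// mulr_gt0.
have [s hs] := hdense w0 (mulr_gt0 eta0 (divr_gt0 e0 (ltr0n _ 4))).
set p := 1 - ('X - w%:P) * s in hs.
have split_r t : complex.Re (h t * u t * r.[t%:C]) =
    complex.Re (h t * (r * s).[t%:C]) + complex.Re (h t * u t * (r * p).[t%:C]).
  rewrite -RejD; congr complex.Re; rewrite /p !(hornerM, hornerD, hornerN, hornerC, hornerX) /u.
  by field; exact: tw.
have splitI (m : {measure set RB -> \bar R}) : finite_moments m ->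
    (\int[m]_t complex.Re (h t * u t * r.[t%:C]))%R =
    (\int[m]_t complex.Re (h t * (r * s).[t%:C]))%R +
    (\int[m]_t complex.Re (h t * u t * (r * p).[t%:C]))%R.
  move=> hm; rewrite -RintegralD//; [|exact: integrable_Re_mul hB|exact: integrable_Re_mul hub].
  by apply: eq_Rintegral => t _; exact: split_r.
have err (m : {measure set RB -> \bar R}) : finite_moments m -> (forall q, mom mu q = mom m q) ->
    `|(\int[m]_t complex.Re (h t * u t * (r * p).[t%:C]))%R| <= e / 2.
  move=> hm hmm.
  have iR : m.-integrable setT (EFin \o (fun t : RB => complex.Re (h t * u t * (r * p).[t%:C]))).
    exact: integrable_Re_mul hub.
  rewrite (le_trans (le_normr_Rintegral _ _))//.
  pose Z : {poly R} := (eta * (B / complex.Im w ^+ 2)) *: sqn r + eta^-1 *: sqn p.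
  apply: (@le_trans _ _ (mom m Z)).
    apply: le_Rintegral => //; first exact: (integrable_norm iR).
      exact: integrable_horner.
    move=> t _; rewrite hornerD !hornerZ !horner_sqn hornerM mulrA.
    rewrite (le_trans (Re_mul_le _ _ eta0))// [_ / eta]mulrC lerD2r -[leRHS]mulrA ler_wpM2l ?(ltW eta0)//.
    by rewrite csqM ler_wpM2r// csq_ge0.
  rewrite momD// !momZ// -!hmm -mulrA.
  have h1 : eta * (B / complex.Im w ^+ 2 * mom mu (sqn r)) <= e / 4.
    have <- : eta * D = e / 4 by rewrite /eta; field; rewrite gt_eqF.
    by rewrite ler_wpM2l ?(ltW eta0)// lerDl.
  have h2 : eta^-1 * mom mu (sqn p) <= e / 4.
    by rewrite mulrC ler_pdivrMr// mulrC ltW.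
  by lra.
rewrite (splitI mu)// (splitI nu)// hE.
rewrite addrAC opprD addrA subrr add0r addrC.
rewrite (le_trans (ler_normD _ _))// normrN.
by have := err mu hmu (fun=> erefl); have := err nu hnu hmom; lra.
Qed.

Lemma equal_integrals_prod (l : seq C) : (forall w, w \in l -> complex.Im w != 0) ->
  equal_integrals (fun t => \prod_(w <- l) (t%:C - w)^-1).
Proof.
elim: l => [|w l IH] hl.
  rewrite (_ : (fun t : R => _) = fun=> 1); first exact: equal_integrals1.
  by apply/funext => t; rewrite big_nil.
rewrite (_ : (fun t : R => _) = fun t => \prod_(w <- l) (t%:C - w)^-1 * (t%:C - w)^-1); last first.
  by apply/funext => t; rewrite big_cons mulrC.
apply: equal_integrals_cauchy; first by apply: hl; rewrite mem_head.
by apply: IH => z zl; apply: hl; rewrite in_cons zl orbT.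
Qed.

(** q has no real root, so 1 / q is a product of factors 1 / (t - w) with nonreal w, times the
    inverse of the leading coefficient, which is taken as r. *)
Lemma equal_integral_hornerV q : (forall t, 1 <= q.[t]) ->
  (\int[mu]_t (q.[t])^-1)%R = (\int[nu]_t (q.[t])^-1)%R.
Proof.
move=> q1; have [l lE] := closed_field_poly_normal (cP q).
have hl w : w \in l -> complex.Im w != 0.
  move=> wl; apply/eqP => w0.
  have : (cP q).[w] = 0.
    apply/eqP; rewrite lE hornerZ mulf_eq0; apply/orP; right.
    by rewrite -[_ == 0]/(root _ w) root_prod_XsubC.
  have -> : w = (complex.Re w)%:C by case: w w0 {wl} => a b /= ->.
  rewrite horner_cP => /complexI e; have := q1 (complex.Re w).
  by rewrite e ler10.
have [_ _ /(_ (lead_coef (cP q))^-1%:P)] := equal_integrals_prod hl.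
have e (m : {measure set RB -> \bar R}) :
  (\int[m]_t complex.Re (\prod_(w <- l) (t%:C - w)^-1 * ((lead_coef (cP q))^-1%:P).[t%:C]))%R =
  (\int[m]_t (q.[t])^-1)%R.
  apply: eq_Rintegral => t _; rewrite hornerC.
  rewrite prodfV mulrC -invfM.
  have -> : lead_coef (cP q) * \prod_(w <- l) (t%:C - w) = (q.[t])%:C.
    rewrite -horner_cP [in RHS]lE hornerZ horner_prod; congr (_ * _).
    by apply: eq_bigr => w _; rewrite hornerXsubC.
  by rewrite -fmorphV.
by rewrite !e.
Qed.

End RationalFunctions.

(** * From rational functions to intervals *)

Section IntervalApproximation.
Context {R : realType}.
Local Notation C := R[i].
Local Notation RB := (measurableTypeR R).

(** In other terms, m v^m <= v + ... + v^m <= v / (1 - v). *)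
Lemma mul_exp_bound (v : R) m : 0 <= v -> v < 1 -> m%:R * v ^+ m * (1 - v) <= v.
Proof.
move=> v0 v1; elim: m => [|m IH]; first by rewrite !mul0r.
have vm : v ^+ m <= 1 by rewrite exprn_ile1// ltW.
have vm0 : 0 <= v ^+ m by rewrite exprn_ge0.
rewrite -natr1 exprS.
rewrite (_ : _ * _ = v * (m%:R * v ^+ m * (1 - v)) + v * (1 - v) * v ^+ m); last by ring.
have h1 : v * (m%:R * v ^+ m * (1 - v)) <= v * v by rewrite ler_wpM2l.
have h2 : v * (1 - v) * v ^+ m <= v * (1 - v).
  by rewrite ler_piMr// mulr_ge0//; lra.
lra.
Qed.

(** Its inverse tends to the indicator of the open interval ]a - r, a + r[. The factor m sends the
    endpoints, where the power stays 1, to 0. Inside, v = ((t - a) / r)^2 < 1, and the exponent 2 m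
    gives m v^(2 m) = (m v^m)^2 / m, which tends to 0. *)
Definition bump (a r : R) (m : nat) : {poly R} :=
  1 + m%:R *: ((r^-1 *: ('X - a%:P)) ^+ 2) ^+ (2 * m).

Lemma horner_bump a r m t : (bump a r m).[t] = 1 + m%:R * (((t - a) / r) ^+ 2) ^+ (2 * m).
Proof. by rewrite hornerD hornerC hornerZ !horner_exp hornerZ hornerXsubC [r^-1 * _]mulrC. Qed.

Lemma bump_ge1 a r m t : 1 <= (bump a r m).[t].
Proof. by rewrite horner_bump lerDl mulr_ge0// exprn_ge0// sqr_ge0. Qed.

Lemma bump_inv_bounds a r m t : 0 <= ((bump a r m).[t])^-1 <= 1.
Proof.
have h := bump_ge1 a r m t; have h0 := lt_le_trans ltr01 h.
by rewrite invr_ge0 ltW//= invf_le1.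
Qed.

Lemma bump_cvg a r t : 0 < r -> exists K, forall m, (0 < m)%N ->
  `|\1_(`]a - r, a + r[%classic) t - ((bump a r m).[t])^-1| <= K / m%:R :> R.
Proof.
move=> r0; pose v := ((t - a) / r) ^+ 2.
have v0 : 0 <= v by exact: sqr_ge0.
have ind : \1_(`]a - r, a + r[%classic) t = (v < 1)%R%:R :> R.
  rewrite indicE mem_setE in_itv/= /v expr_div_n ltr_pdivrMr ?exprn_gt0// mul1r.
  rewrite -ltr_distlC -[in RHS](real_normK (x := t - a)) ?num_real// distrC.
  by rewrite ltr_pXn2r ?nnegrE// ltW.
rewrite ind; have [v1|v1] := ltP v 1.
  exists ((v / (1 - v)) ^+ 2) => m m0.
  have m0' : 0 < m%:R :> R by rewrite ltr0n.
  have h := bump_ge1 a r m t; have h0 := lt_le_trans ltr01 h.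
  have /andP[_ h1] := bump_inv_bounds a r m t.
  rewrite ger0_norm ?subr_ge0//.
  have w0 : 0 < 1 - v by rewrite subr_gt0.
  have hm : m%:R * v ^+ m <= v / (1 - v) by rewrite ler_pdivlMr// mul_exp_bound.
  have -> : 1 - ((bump a r m).[t])^-1 = ((bump a r m).[t])^-1 * ((bump a r m).[t] - 1).
    by rewrite mulrBr mulVf ?gt_eqF// mulr1.
  apply: (@le_trans _ _ ((bump a r m).[t] - 1)).
    by rewrite ler_piMl// subr_ge0.
  rewrite horner_bump -/v addrAC subrr add0r ler_pdivlMr// mulnC exprM.
  rewrite (_ : _ * _ * _ = (m%:R * v ^+ m) ^+ 2); last by ring.
  have vv : 0 <= v / (1 - v) by apply: divr_ge0; [exact: v0|exact: ltW].
  have mv : 0 <= m%:R * v ^+ m by apply: mulr_ge0 => //; exact: exprn_ge0.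
  by rewrite lerXn2r.
exists 1 => m m0; have m0' : 0 < m%:R :> R by rewrite ltr0n.
have /andP[h1 _] := bump_inv_bounds a r m t.
rewrite sub0r normrN ger0_norm// div1r.
have vm : 1 <= v ^+ (2 * m) by rewrite exprn_ege1.
have hb : m%:R <= (bump a r m).[t].
  rewrite horner_bump -/v; have : m%:R <= m%:R * v ^+ (2 * m) by rewrite ler_peMr// ltW.
  lra.
by rewrite lef_pV2 ?posrE// (lt_le_trans m0').
Qed.

Lemma cvg_Rintegral_bump (mu : {measure set RB -> \bar R}) a r :
  finite_moments mu -> 0 < r ->
  (fun n => ((\int[mu]_t ((bump a r n.+1).[t])^-1)%R)%:E) @ \oo -->
    mu `]a - r, a + r[%classic.
Proof.
move=> hm r0; have fin := finite_moments_fin_num hm.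
have mb n : measurable_fun setT (fun t : RB => ((bump a r n.+1).[t])^-1).
  by apply: measurable_hornerV => t; rewrite gt_eqF// (lt_le_trans ltr01)// bump_ge1.
have bb n t : `|((bump a r n.+1).[t])^-1| <= 1.
  by have /andP[h1 h2] := bump_inv_bounds a r n.+1 t; rewrite ger0_norm.
have i1 : mu.-integrable setT (EFin \o (fun=> 1 : R)).
  by apply: (@integrable_bounded _ _ _ 1) => // t; rewrite normr1.
have ib n : mu.-integrable setT (EFin \o (fun t : RB => ((bump a r n.+1).[t])^-1)).
  exact: (@integrable_bounded _ _ _ 1).
have := @dominated_cvg _ _ _ mu setT measurableT
  (fun n t => (((bump a r n.+1).[t])^-1)%:E) (fun t => (\1_(`]a - r, a + r[%classic) t)%:E)
  (fun=> 1%:E) _ _ _ _ _.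
rewrite integral_indic// setIT.
rewrite (_ : (fun n => (\int[mu]_t (((bump a r n.+1).[t])^-1)%:E)%E) =
  (fun n => ((\int[mu]_t ((bump a r n.+1).[t])^-1)%R)%:E)); last first.
  by apply/funext => n; rewrite /Rintegral fineK// integrable_fin_num//; exact: ib.
apply => //.
- by move=> n; apply/measurable_EFinP.
- move=> t _; apply/cvg_EFin; first by near=> n.
  have [K hK] := bump_cvg a t r0.
  apply/cvgrPdist_le => e e0; exists (Num.truncn (`|K| / e)) => // n /= hn.
  rewrite (le_trans (hK n.+1 _))// ler_pdivrMr ?ltr0n//.
  rewrite (le_trans (ler_norm _))// mulrC -ler_pdivrMr// ltW//.
  by rewrite (lt_le_trans (truncnS_gt _))// ler_nat ltnS.
- by move=> n t _; rewrite lee_fin.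
Unshelve. all: by end_near. Qed.

(** Half-open intervals are decreasing intersections of open ones, and they form a pi-system that
    generates the Borel sets. *)
Lemma measure_eq_open_intervals (mu nu : {measure set RB -> \bar R}) :
  mu setT \is a fin_num -> nu setT \is a fin_num ->
  (forall a r, 0 < r -> mu `]a - r, a + r[%classic = nu `]a - r, a + r[%classic) ->
  forall D : set RB, measurable D -> nu D = mu D.
Proof.
move=> fmu fnu h.
have hoo a b : mu `]a, b[%classic = nu `]a, b[%classic.
  have [ab|ba] := ltP a b; last by rewrite set_itv_ge ?measure0// bnd_simp -leNgt.
  have ea : (a + b) / 2 - (b - a) / 2 = a by field.
  have eb : (a + b) / 2 + (b - a) / 2 = b by field.
  by have := h ((a + b) / 2) ((b - a) / 2); rewrite ea eb divr_gt0 ?subr_gt0// => /(_ isT).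
have lt_fin (m : {measure set RB -> \bar R}) (A : set RB) : m setT \is a fin_num -> measurable A -> (m A < +oo)%E.
  move=> fm mA; rewrite (@le_lt_trans _ _ (m setT))//.
    by apply: le_measure; rewrite ?inE.
  by rewrite -ge0_fin_numE.
have hoc a b : mu `]a, b]%classic = nu `]a, b]%classic.
  have bI : `]a, b]%classic = \bigcap_n `]a, b + n.+1%:R^-1[%classic.
    apply/seteqP; split => [t /= + n _|t hI] /=; rewrite !in_itv/=.
      by case/andP => -> tb; rewrite (le_lt_trans tb)// ltrDl invr_gt0.
    have := hI 0%N I; rewrite /= in_itv/= => /andP[-> _]/=.
    rewrite leNgt; apply/negP => bt.
    have tb0 : 0 < t - b by rewrite subr_gt0.
    have := hI (Num.truncn (t - b)^-1) I; rewrite /= in_itv/= => /andP[_].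
    apply/negP; rewrite -leNgt -lerBrDl -[leRHS]invrK lef_pV2 ?posrE ?invr_gt0//.
    by rewrite ltW// truncnS_gt.
  have c (m : {measure set RB -> \bar R}) : m setT \is a fin_num ->
      (m \o (fun n => `]a, b + n.+1%:R^-1[%classic)) x @[x --> \oo] --> m `]a, b]%classic.
    move=> fm; rewrite bI; apply: nonincreasing_cvg_mu => //.
    - exact: lt_fin.
    - by apply: bigcap_measurable.
    - apply/nonincreasing_seqP => n; apply/subsetPset => t /=; rewrite !in_itv/=.
      case/andP => -> tb /=; rewrite (lt_le_trans tb)// lerD2l lef_pV2 ?posrE//.
      by rewrite ler_nat.
  apply: cvg_unique (c _ fmu) _ => //.
  rewrite (_ : mu \o _ = nu \o (fun n => `]a, b + n.+1%:R^-1[%classic)); first exact: c.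
  by apply/funext => n; exact: hoo.
move=> D mD.
apply: (@measure_unique _ _ RB (@ocitv R) (fun n => `](- n%:R), n%:R]%classic)) => //.
- by move=> A B; exact: ocitvI.
- by move=> n; exact: is_ocitv.
- exact: (bigcup_itvT false false).
- by move=> _ [[a b] _ <-] /=; rewrite hoc.
- by move=> n; exact: lt_fin.
Qed.

Theorem moment_unique (mu nu : {measure set RB -> \bar R}) :
    finite_moments mu -> finite_moments nu -> same_moments mu nu ->
    (forall w : C, complex.Im w != 0 -> forall eps : R, 0 < eps ->
       exists s : {poly C}, mom mu (sqn (1 - ('X - w%:P) * s)) < eps) ->
  forall D : set RB, measurable D -> nu D = mu D.
Proof.
move=> hmu hnu hs hd.
have fmu := finite_moments_fin_num hmu; have fnu := finite_moments_fin_num hnu.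
apply: measure_eq_open_intervals => // a r r0.
have hmom := same_moments_mom hmu hnu hs.
have c1 := cvg_Rintegral_bump (a := a) hmu r0.
have c2 := cvg_Rintegral_bump (a := a) hnu r0.
apply: cvg_unique c1 _ => //.
rewrite (_ : (fun n => _) = (fun n => ((\int[nu]_t ((bump a r n.+1).[t])^-1)%R)%:E))//.
apply/funext => n; congr (_%:E).
by apply: equal_integral_hornerV => // t; exact: bump_ge1.
Qed.

End IntervalApproximation.

(** * Moments of the spectral measure *)

Section Density.
Context d (T : measurableType d) (R : realType).
Variables (m : {measure set T -> \bar R}) (w : T -> R).
Hypothesis w0 : forall t, 0 <= w t.
Hypothesis mw : measurable_fun setT w.
Local Open Scope ereal_scope.

(** The two proofs are arguments so that the measure structure can be attached to the term
    [density w0 mw]. *)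
Definition density of (forall t, (0 <= w t)%R) & measurable_fun setT w :=
  fun D : set T => \int[m]_(t in D) (w t)%:E.
Local Notation nu := (density w0 mw).

Let density0 : nu set0 = 0. Proof. exact: integral_set0. Qed.

Let density_ge0 D : 0 <= nu D.
Proof. by apply: integral_ge0 => t _; rewrite lee_fin. Qed.

Let density_sigma_additive : semi_sigma_additive nu.
Proof.
move=> F mF tF mUF; rewrite /density; apply: cvg_toP.
  apply: ereal_nondecreasing_is_cvgn => j k jk.
  apply: lee_sum_nneg_natr => // i _ _; apply: integral_ge0 => t _.
  by rewrite lee_fin.
rewrite ge0_integral_bigcup//=.
- by apply/measurable_funTS/measurableT_comp.
- by move=> t _; rewrite lee_fin.
Qed.

HB.instance Definition _ := isMeasure.Build _ _ _ nu
  density0 density_ge0 density_sigma_additive.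

Import HBNNSimple.

Lemma ge0_integral_density (f : T -> \bar R) : (forall x, 0 <= f x) ->
  measurable_fun setT f ->
  \int[nu]_x f x = \int[m]_x (f x * (w x)%:E).
Proof.
move=> f0 mf; pose h := nnsfun_approx measurableT mf.
have mwE : measurable_fun setT (EFin \o w) by exact/measurable_EFinP.
have -> : \int[nu]_x f x = limn (fun n => \int[nu]_x (h n x)%:E).
  rewrite -monotone_convergence//.
  - apply: eq_integral => x _; apply/esym/cvg_lim => //.
    exact: cvg_nnsfun_approx.
  - by move=> n; apply/measurable_EFinP.
  - by move=> n x _; rewrite lee_fin.
  - by move=> x _ a b ab; rewrite lee_fin; exact/lefP/nd_nnsfun_approx.
have -> : \int[m]_x (f x * (w x)%:E) = limn (fun n => \int[m]_x ((h n x)%:E * (w x)%:E)).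
  rewrite -monotone_convergence//.
  - apply: eq_integral => x _; apply/esym/cvg_lim => //.
    by apply: cvgeZr => //; exact: cvg_nnsfun_approx.
  - by move=> n; apply: emeasurable_funM => //; apply/measurable_EFinP.
  - by move=> n x _; rewrite mule_ge0 ?lee_fin.
  - move=> x _ a b ab; rewrite lee_wpmul2r ?lee_fin//.
    exact/lefP/nd_nnsfun_approx.
congr (limn _); apply/funext => n.
have fE x : (h n x)%:E = \sum_(y \in range (h n)) (y * \1_(h n @^-1` [set y]) x)%:E.
  by rewrite fimfunE -fsumEFin.
have mind y : measurable_fun setT (fun x => (y * \1_(h n @^-1` [set y]) x)%:E).
  by apply/measurable_EFinP; apply: measurable_funM => //; exact: measurable_indic.
transitivity (\sum_(y \in range (h n)) \int[nu]_x (y * \1_(h n @^-1` [set y]) x)%:E).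
  under eq_integral do rewrite fE.
  rewrite ge0_integral_fsum//.
  by move=> y x _; exact: nnfun_muleindic_ge0.
transitivity (\sum_(y \in range (h n)) \int[m]_x ((y * \1_(h n @^-1` [set y]) x)%:E * (w x)%:E)); last first.
  rewrite -ge0_integral_fsum//.
  - apply: eq_integral => x _; rewrite fE ge0_mule_fsuml// => y.
    exact: nnfun_muleindic_ge0.
  - by move=> y; exact: emeasurable_funM.
  - by move=> y x _; rewrite mule_ge0 ?lee_fin//; exact: nnfun_muleindic_ge0.
apply: eq_fsbigr => y; rewrite inE => -[x0 _ yE].
have y0 : (0 <= y)%R by rewrite -yE.
under eq_integral do rewrite EFinM.
rewrite integralZl_indic_nnsfun// integral_indic// setIT.
under eq_integral do rewrite -muleA.
rewrite ge0_integralZl ?lee_fin//; last 2 first.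
- by apply: emeasurable_funM => //; apply/measurable_EFinP; exact: measurable_indic.
- by move=> x _; rewrite mule_ge0 ?lee_fin.
congr (_ * _); transitivity (\int[m]_(x in h n @^-1` [set y]) (w x)%:E) => //.
by rewrite integral_mkcond; apply: eq_integral => x _; rewrite muleC epatch_indic.
Qed.

End Density.

(** * Differences of measures with a density *)

Section SignedDensity.
Context {R : realType}.
Local Notation RB := (measurableTypeR R).
Implicit Types m mu nu : {measure set RB -> \bar R}.

(** The additive form avoids subtracting measures; P will be a set on which the signed density has
    constant sign. *)
Lemma ge0_integral_eq_density mu nu m (w : RB -> R) (P : set RB) (g : RB -> R) :
    measurable P -> (forall t, 0 <= w t) -> measurable_fun setT w ->
    (forall B, measurable B -> B `<=` P -> mu B = (nu B + \int[m]_(t in B) (w t)%:E)%E) ->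
    (forall t, 0 <= g t) -> measurable_fun setT g ->
  (\int[mu]_(t in P) (g t)%:E =
   \int[nu]_(t in P) (g t)%:E + \int[m]_(t in P) (g t * w t)%:E)%E.
Proof.
move=> mP w0 mw h g0 mg.
have mgE : measurable_fun P (fun t => (g t)%:E) by apply/measurable_EFinP/measurable_funTS.
have dmE (D : set RB) : measurable D ->
    (\int[density m w0 mw]_(t in D) (g t)%:E = \int[m]_(t in D) (g t * w t)%:E)%E.
  move=> mD; rewrite integral_mkcond ge0_integral_density.
  - rewrite [RHS]integral_mkcond; apply: eq_integral => t _.
    by rewrite !patchE; case: ifP; rewrite ?mul0e// EFinM.
  - by move=> t; rewrite patchE; case: ifP => // _; rewrite lee_fin.
  - apply/(measurable_restrictT _ mD)/measurable_EFinP/measurable_funTS => //.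
rewrite -dmE// -ge0_integral_measure_add//; last by move=> t _; rewrite lee_fin.
apply: eq_measure_integral => B mB BP.
by rewrite h//; apply/esym; exact: measure_addE.
Qed.

End SignedDensity.

Section SignedDensity.
Context {R : realType}.
Local Notation RB := (measurableTypeR R).
Variables (m mu1 mu2 : {measure set RB -> \bar R}) (w : RB -> R).
Hypotheses (fin1 : mu1 setT \is a fin_num) (fin2 : mu2 setT \is a fin_num).
Hypothesis iw : m.-integrable setT (EFin \o w).
Hypothesis mu12 : forall B, measurable B ->
  fine (mu1 B) - fine (mu2 B) = (\int[m]_(t in B) w t)%R.

Let mw : measurable_fun setT w.
Proof. by apply/measurable_EFinP; exact: measurable_int iw. Qed.

Let fin (mu : {measure set RB -> \bar R}) B : mu setT \is a fin_num -> measurable B ->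
  mu B \is a fin_num.
Proof.
move=> h mB; rewrite ge0_fin_numE//; apply: (@le_lt_trans _ _ (mu setT)).
  by apply: le_measure; rewrite ?inE.
by rewrite -ge0_fin_numE.
Qed.

Let ibw B : measurable B -> (\int[m]_(t in B) (w t)%:E)%E \is a fin_num.
Proof. by move=> mB; apply: integrable_fin_num => //; exact: integrableS iw. Qed.

(** Hahn decomposition by the sign of w: on P the measure mu1 is mu2 plus a density, and off P the
    roles are exchanged. Finiteness of the integrals of g then yields the integrability of g w. *)
Lemma signed_density_ge0 (g : RB -> R) : (forall t, 0 <= g t) ->
    mu1.-integrable setT (EFin \o g) -> mu2.-integrable setT (EFin \o g) ->
  m.-integrable setT (EFin \o (fun t => g t * w t)) /\
  (\int[m]_t (g t * w t))%R = (\int[mu1]_t g t)%R - (\int[mu2]_t g t)%R.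
Proof.
move=> g0 i1 i2; have mg : measurable_fun setT g by apply/measurable_EFinP; exact: measurable_int i1.
pose P : set RB := [set t | 0 <= w t].
have mP : measurable P.
  rewrite (_ : P = w @^-1` `[0, +oo[%classic); first by rewrite -[_ @^-1` _]setTI; exact: mw.
  by apply/seteqP; split => t /=; rewrite in_itv/= andbT.
have mN : measurable (~` P) by exact: measurableC.
pose wp t := Num.max (w t) 0; pose wn t := Num.max (- w t) 0.
have mwp : measurable_fun setT wp by exact: measurable_maxr.
have mwn : measurable_fun setT wn by apply: measurable_maxr => //; exact: measurable_funN.
have wp0 t : 0 <= wp t by rewrite le_max lexx orbT.
have wn0 t : 0 <= wn t by rewrite le_max lexx orbT.
have wpE t : P t -> wp t = w t by rewrite /P /= => h; exact/max_idPl.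
have wnE t : (~` P) t -> wn t = - w t.
  by rewrite /P /= => /negP; rewrite -ltNge => h; apply/max_idPl; lra.
have e1 : (\int[mu1]_(t in P) (g t)%:E =
    \int[mu2]_(t in P) (g t)%:E + \int[m]_(t in P) (g t * wp t)%:E)%E.
  apply: ge0_integral_eq_density => // B mB BP.
  rewrite (eq_integral (fun t => (w t)%:E)); last first.
    by move=> t /[!inE] tB; rewrite wpE//; exact: BP.
  rewrite -(fineK (fin fin1 mB)) -(fineK (fin fin2 mB)) -(fineK (ibw mB)) -EFinD.
  by congr EFin; have := mu12 mB; rewrite /Rintegral; lra.
have e2 : (\int[mu2]_(t in ~` P) (g t)%:E =
    \int[mu1]_(t in ~` P) (g t)%:E + \int[m]_(t in ~` P) (g t * wn t)%:E)%E.
  apply: ge0_integral_eq_density => // B mB BP.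
  rewrite (eq_integral (fun t => - (w t)%:E)%E); last first.
    by move=> t /[!inE] tB; rewrite wnE ?EFinN//; exact: BP.
  rewrite integralN; last first.
    apply: fin_num_adde_defr; apply: integrable_pos_fin_num => //.
    exact: integrableS iw.
  rewrite -(fineK (fin fin1 mB)) -(fineK (fin fin2 mB)) -(fineK (ibw mB)) -EFinN -EFinD.
  by congr EFin; have := mu12 mB; rewrite /Rintegral; lra.
have iS (mu : {measure set RB -> \bar R}) B : mu.-integrable setT (EFin \o g) -> measurable B ->
    (\int[mu]_(t in B) (g t)%:E)%E \is a fin_num.
  by move=> ig mB; apply: integrable_fin_num => //; exact: integrableS ig.
have gw0 (B : set RB) (u : RB -> R) : (forall t, 0 <= u t) ->
    (0 <= \int[m]_(t in B) (g t * u t)%:E)%E.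
  by move=> u0; apply: integral_ge0 => t _; rewrite lee_fin mulr_ge0.
have f1 : (\int[m]_(t in P) (g t * wp t)%:E)%E \is a fin_num.
  have := iS _ _ i1 mP; rewrite e1 fin_numD => /andP[]//.
have f2 : (\int[m]_(t in ~` P) (g t * wn t)%:E)%E \is a fin_num.
  have := iS _ _ i2 mN; rewrite e2 fin_numD => /andP[]//.
have mgw : measurable_fun setT (fun t => g t * w t) by exact: measurable_funM.
have iP : m.-integrable P (EFin \o (fun t => g t * w t)).
  apply/integrableP; split; first exact/measurable_EFinP/measurable_funTS.
  rewrite (eq_integral (fun t => (g t * wp t)%:E)); first by rewrite -ge0_fin_numE// gw0.
  move=> t /[!inE] Pt; rewrite /= ger0_norm; first by rewrite wpE.
  by rewrite mulr_ge0.
have iN : m.-integrable (~` P) (EFin \o (fun t => g t * w t)).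
  apply/integrableP; split; first exact/measurable_EFinP/measurable_funTS.
  rewrite (eq_integral (fun t => (g t * wn t)%:E)); first by rewrite -ge0_fin_numE// gw0.
  move=> t /[!inE] Pt; rewrite wnE//= normrM (ger0_norm (g0 t)) ler0_norm//.
  by have := wn0 t; rewrite wnE// oppr_ge0.
have iU : m.-integrable (P `|` ~` P) (EFin \o (fun t => g t * w t)).
  apply/integrableP; split; first exact/measurable_EFinP/measurable_funTS.
  rewrite ge0_integral_setU//.
  - rewrite lte_add_pinfty//; [by case/integrableP : iP|by case/integrableP : iN].
  - by apply/measurable_funTS; do 2 apply: measurableT_comp => //; exact/measurable_EFinP.
  - by rewrite disj_set2E setICr.
have dPN : [disjoint P & ~` P] by rewrite disj_set2E setICr.
split; first by rewrite -(setvU P) setUC.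
have sp (mu : {measure set RB -> \bar R}) (f : RB -> R) : mu.-integrable (P `|` ~` P) (EFin \o f) ->
    (\int[mu]_t f t)%R = (\int[mu]_(t in P) f t)%R + (\int[mu]_(t in ~` P) f t)%R.
  by move=> h; rewrite -Rintegral_setU// setUCr.
rewrite (sp m)// (sp mu1) ?setUv// (sp mu2) ?setUv//.
have r1 : (\int[m]_(t in P) (g t * w t))%R =
    (\int[mu1]_(t in P) g t)%R - (\int[mu2]_(t in P) g t)%R.
  rewrite [X in _ = X - _]/Rintegral e1 fineD//; last exact: iS i2 mP.
  rewrite addrAC subrr add0r; congr fine; apply: eq_integral => t /[!inE] Pt.
  by rewrite wpE.
have r2 : (\int[m]_(t in ~` P) (g t * w t))%R =
    (\int[mu1]_(t in ~` P) g t)%R - (\int[mu2]_(t in ~` P) g t)%R.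
  rewrite [X in _ = _ - X]/Rintegral e2 fineD//; last exact: iS i1 mN.
  rewrite opprD addrA subrr add0r -[LHS]opprK; congr (- _).
  rewrite -mulN1r -RintegralZl//.
  by apply: eq_Rintegral => t /[!inE] Pt; rewrite wnE// mulN1r mulrN.
by rewrite r1 r2; ring.
Qed.

Lemma signed_density (f : RB -> R) :
    mu1.-integrable setT (EFin \o f) -> mu2.-integrable setT (EFin \o f) ->
  m.-integrable setT (EFin \o (fun t => f t * w t)) /\
  (\int[m]_t (f t * w t))%R = (\int[mu1]_t f t)%R - (\int[mu2]_t f t)%R.
Proof.
move=> i1 i2.
pose fp t := Num.max (f t) 0; pose fn t := Num.max (- f t) 0.
have fE t : f t = fp t - fn t.
  by rewrite /fp /fn; case: (leP (f t) 0) => h; case: (leP (- f t) 0) => h'; lra.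
have fp0 t : 0 <= fp t by rewrite le_max lexx orbT.
have fn0 t : 0 <= fn t by rewrite le_max lexx orbT.
have ip (mu : {measure set RB -> \bar R}) : mu.-integrable setT (EFin \o f) -> mu.-integrable setT (EFin \o fp).
  exact: integrable_funrpos.
have in_ (mu : {measure set RB -> \bar R}) : mu.-integrable setT (EFin \o f) -> mu.-integrable setT (EFin \o fn).
  exact: integrable_funrneg.
have [ipw pE] := signed_density_ge0 fp0 (ip _ i1) (ip _ i2).
have [inw nE] := signed_density_ge0 fn0 (in_ _ i1) (in_ _ i2).
have wE : (fun t => f t * w t) = (fun t => fp t * w t - fn t * w t).
  by apply/funext => t; rewrite fE mulrBl.
have sub (mu : {measure set RB -> \bar R}) : mu.-integrable setT (EFin \o f) ->
    (\int[mu]_t f t)%R = (\int[mu]_t fp t)%R - (\int[mu]_t fn t)%R.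
  move=> h; rewrite -RintegralB//; [|exact: ip|exact: in_].
  by apply: eq_Rintegral => t _; rewrite fE.
split; first by rewrite wE; exact: (integrableB measurableT ipw inw).
rewrite !sub// (_ : (\int[m]_t (f t * w t))%R = (\int[m]_t (fp t * w t - fn t * w t))%R); last first.
  by apply: eq_Rintegral => t _; rewrite fE mulrBl.
by rewrite RintegralB// pE nE; ring.
Qed.

End SignedDensity.

(** * The inner product of l_2 *)

Section InnerProduct.
Context {R : realType}.
Local Notation C := R[i].
Local Notation CC := (R[i] : numClosedFieldType).
Implicit Types (f g h : nat -> C).

Lemma complex_norm_le (z : C) : `|z| <= (`|complex.Re z| + `|complex.Im z|)%:C.
Proof.
have -> : `|z| = (Normc.normc z)%:C by case: z.
rewrite lecR -(ler_pXn2r (n := 2)) ?nnegrE ?addr_ge0//; last by case: z => a b /=; exact: sqrtr_ge0.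
rewrite csq_normc /csq -(real_normK (x := complex.Re z)) ?num_real//.
rewrite -(real_normK (x := complex.Im z)) ?num_real//.
have := normr_ge0 (complex.Re z); have := normr_ge0 (complex.Im z); nra.
Qed.

Lemma cvg_complex (u : nat -> CC) (x y : R) :
  (fun n => complex.Re (u n)) @ \oo --> x -> (fun n => complex.Im (u n)) @ \oo --> y ->
  u @ \oo --> (x +i* y : CC).
Proof.
move=> /cvgrPdist_le hx /cvgrPdist_le hy; apply/cvgrPdist_le => e e0.
have [eE e0'] : e = (complex.Re e)%:C /\ 0 < complex.Re e.
  have : (0 : C) < (e : C) by [].
  by rewrite ltcE /= => /andP[/eqP ei er]; split => //; case: e ei {e0 er} => a b /= ->.
have e2 : 0 < complex.Re e / 2 by rewrite divr_gt0.
near=> n; rewrite (le_trans (complex_norm_le _))// eE lecR.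
have h1 : `|x - complex.Re (u n)| <= complex.Re e / 2 by near: n; exact: hx.
have h2 : `|y - complex.Im (u n)| <= complex.Re e / 2 by near: n; exact: hy.
case: (u n) h1 h2 => a b /= h1 h2.
by rewrite (le_trans (lerD h1 h2))//; lra.
Unshelve. all: by end_near. Qed.

Lemma norm_sqE f k : norm_sq f k = csq (f k).
Proof. exact: csq_normc. Qed.

Lemma l2_dominated (u : nat -> R) f g : l2 f -> l2 g ->
  (forall k, `|u k| <= csq (f k) + csq (g k)) -> cvgn (series u).
Proof.
move=> hf hg h; apply: normed_cvg.
apply: (@series_le_cvg _ _ (fun k => norm_sq f k + norm_sq g k)).
- by move=> k; exact: normr_ge0.
- by move=> k; rewrite !norm_sqE addr_ge0 ?csq_ge0.
- by move=> k; rewrite !norm_sqE; exact: h.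
rewrite (_ : series _ = series (norm_sq f) + series (norm_sq g)); first exact: is_cvgD.
by apply/funext => n; rewrite /series/= big_split.
Qed.

Lemma Re_conj_mul_abs (x y : C) : `|complex.Re (x^* * y)| <= csq x + csq y.
Proof.
case: x y => [a b] [c d]; rewrite /csq /= ler_norml.
have := sqr_ge0 (a - c); have := sqr_ge0 (b - d).
by have := sqr_ge0 (a + c); have := sqr_ge0 (b + d); move=> *; apply/andP; split; nra.
Qed.

Lemma Im_conj_mul_abs (x y : C) : `|complex.Im (x^* * y)| <= csq x + csq y.
Proof.
case: x y => [a b] [c d]; rewrite /csq /= ler_norml.
have := sqr_ge0 (a - d); have := sqr_ge0 (b - c).
by have := sqr_ge0 (a + d); have := sqr_ge0 (b + c); move=> *; apply/andP; split; nra.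
Qed.

Lemma Re_series (u : nat -> C) n :
  complex.Re (series u n) = series (fun k => complex.Re (u k)) n.
Proof. by rewrite /series/= Rej_sum. Qed.

Lemma Im_series (u : nat -> C) n :
  complex.Im (series u n) = series (fun k => complex.Im (u k)) n.
Proof. by rewrite /series/= Imj_sum. Qed.

(** [inner] is a bare limit, so its algebraic rules rest on this convergence; it is absolute in the
    real and imaginary parts, which are dominated by |f k|^2 + |g k|^2. *)
Lemma cvg_inner f g : l2 f -> l2 g ->
  series (fun k => (f k)^* * g k : CC) @ \oo --> (inner f g : CC).
Proof.
move=> hf hg.
have cr : cvgn (series (fun k => complex.Re ((f k)^* * g k))).
  by apply: (l2_dominated hf hg) => k; exact: Re_conj_mul_abs.
have ci : cvgn (series (fun k => complex.Im ((f k)^* * g k))).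
  by apply: (l2_dominated hf hg) => k; exact: Im_conj_mul_abs.
have c : series (fun k => (f k)^* * g k : CC) @ \oo -->
   (limn (series (fun k => complex.Re ((f k)^* * g k))) +i*
   limn (series (fun k => complex.Im ((f k)^* * g k))) : CC).
  apply: cvg_complex.
    by under eq_fun do rewrite Re_series.
  by under eq_fun do rewrite Im_series.
by apply: cvgP c.
Qed.

Lemma inner_eq f g (l : CC) : series (fun k => (f k)^* * g k : CC) @ \oo --> l ->
  inner f g = l.
Proof. by move=> h; apply: cvg_lim h; exact: norm_hausdorff. Qed.

Lemma l2_lin (a : C) f g : l2 f -> l2 g -> l2 (fun k => a * f k + g k).
Proof.
move=> hf hg; apply: (@series_le_cvg _ _ (fun k => 2 * csq a * norm_sq f k + 2 * norm_sq g k)).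
- by move=> k; rewrite norm_sqE csq_ge0.
- by move=> k; rewrite !norm_sqE addr_ge0// ?mulr_ge0 ?csq_ge0.
- by move=> k; rewrite !norm_sqE (le_trans (csqD_le _ _))// csqM mulrDr mulrA.
rewrite (_ : series _ = (2 * csq a) \*: series (norm_sq f) + 2 \*: series (norm_sq g)).
  by apply: is_cvgD; exact: is_cvgZr.
by apply/funext => n; rewrite /series/= big_split/= -!mulr_sumr.
Qed.

Lemma inner_linr (a : C) f g h : l2 f -> l2 g -> l2 h ->
  inner h (fun k => a * f k + g k) = a * inner h f + inner h g.
Proof.
move=> hf hg hh; apply: inner_eq.
rewrite (_ : series _ = a \*: series (fun k => (h k)^* * f k) + series (fun k => (h k)^* * g k)).
  by apply: cvgD; [apply: cvgZr; exact: cvg_inner|exact: cvg_inner].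
apply/funext => n.
transitivity (a * series (fun k => (h k)^* * f k) n + series (fun k => (h k)^* * g k) n) => //.
rewrite /series/= mulr_sumr -big_split/=.
by apply: eq_bigr => k _; ring.
Qed.

Lemma inner_conj f g : l2 f -> l2 g -> inner g f = (inner f g)^*.
Proof.
move=> hf hg; apply: inner_eq.
have c := cvg_inner hf hg.
apply/cvgrPdist_le => e e0; move/cvgrPdist_le : c => /(_ _ e0).
apply: filterS => n; rewrite -[X in X <= _](norm_conjC) rmorphB /=.
suff -> : (series (fun k => (f k)^* * g k) n)^* = series (fun k => (g k)^* * f k) n by [].
rewrite /series/= rmorph_sum; apply: eq_bigr => k _.
by rewrite rmorphM /= conjCK mulrC.
Qed.

Lemma inner_linl (a : C) f g h : l2 f -> l2 g -> l2 h ->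
  inner (fun k => a * f k + g k) h = a^* * inner f h + inner g h.
Proof.
move=> hf hg hh; rewrite inner_conj//; last exact: l2_lin.
by rewrite inner_linr// rmorphD rmorphM /= -!inner_conj.
Qed.

Lemma inner_self f : l2 f -> series (fun k => csq (f k)) @ \oo --> complex.Re (inner f f).
Proof.
move=> hf.
have hf' : cvgn (series (fun k => csq (f k))).
  by have := hf; rewrite /l2/= (_ : norm_sq f = fun k => csq (f k))//; apply/funext => k; exact: norm_sqE.
have -> : inner f f = limn (series (fun k => csq (f k))) +i* 0.
  apply: inner_eq; apply: cvg_complex.
    under eq_fun => n.
      rewrite Re_series (_ : series _ n = series (fun k => csq (f k)) n); last first.
        by rewrite /series/=; apply: eq_bigr => k _; rewrite mulrC mulJc.
      over.
    exact: hf'.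
  under eq_fun => n.
    rewrite Im_series (_ : series _ n = 0); last first.
      by rewrite /series/=; apply: big1 => k _; rewrite mulrC mulJc.
    over.
  exact: cvg_cst.
exact: hf'.
Qed.

Definition seq_of (p : {poly C}) : nat -> C := fun k => p`_k.

Lemma inner_seq_of_cvg (p : {poly C}) g :
  series (fun k => (p`_k)^* * g k : CC) @ \oo --> (\sum_(k < size p) (p`_k)^* * g k : CC).
Proof.
apply: cvg_near_cst; exists (size p) => // n /= pn.
rewrite /series/= -(big_mkord xpredT (fun k => (p`_k)^* * g k)).
rewrite (@big_cat_nat _ _ _ (size p))//= [X in _ + X]big_nat_cond [X in _ + X]big1 ?addr0// => k /andP[/andP[pk _] _].
by rewrite nth_default// rmorph0 mul0r.
Qed.

Lemma inner_seq_of (p : {poly C}) g :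
  inner (seq_of p) g = \sum_(k < size p) (p`_k)^* * g k.
Proof. exact/inner_eq/inner_seq_of_cvg. Qed.

Lemma inner_seq_of_ip (p s : {poly C}) : inner (seq_of p) (seq_of s) = ip p s.
Proof. exact: inner_seq_of. Qed.

Lemma l2_seq_of (p : {poly C}) : l2 (seq_of p).
Proof.
apply: (@cvgP _ _ (\sum_(k < size p) csq p`_k)).
apply: cvg_near_cst; exists (size p) => // n /= pn.
rewrite /series/= -(big_mkord xpredT (fun k => csq p`_k)).
under eq_bigr do rewrite norm_sqE /seq_of.
rewrite (@big_cat_nat _ _ _ (size p))//= [X in _ + X]big_nat_cond [X in _ + X]big1 ?addr0// => k /andP[/andP[pk _] _].
by rewrite nth_default// csq0.
Qed.

Lemma seq_of_lin (a : C) (p s : {poly C}) :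
  seq_of (a *: p + s) = fun k => a * seq_of p k + seq_of s k.
Proof. by apply/funext => k; rewrite /seq_of coefD coefZ. Qed.

End InnerProduct.

(** * Mixed spectral forms and powers of J *)

Section SpectralMoments.
Context {R : realType}.
Local Notation C := R[i].
Local Notation RB := (measurableTypeR R).
Implicit Types (f g h : nat -> C) (B D : set RB).

(** The hypothesis is the symmetry of the form at f and g, which lets two vectors suffice for
    polarization. With af and ag free it applies to E(B) as well as to J; [1 * g k + f k] is the
    shape used in [linear_operator]. *)
Lemma Re_inner_polarization f g af ag : l2 f -> l2 g -> l2 af -> l2 ag ->
  complex.Re (inner g af) = complex.Re (inner f ag) ->
  complex.Re (inner (fun k => 1 * g k + f k) (fun k => 1 * ag k + af k)) -
  complex.Re (inner (fun k => -1 * g k + f k) (fun k => -1 * ag k + af k)) =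
  4 * complex.Re (inner f ag).
Proof.
move=> hf hg haf hag e.
rewrite !inner_linr//; [|exact: l2_lin..].
rewrite !inner_linl//.
move: e; case: (inner g ag) (inner f ag) (inner g af) (inner f af) => [a b] [c d] [u v] [x y] /=.
lra.
Qed.

Variables (J : operator R) (q b : nat -> R) (E : set R -> operator R).
Variable rho : {measure set RB -> \bar R}.
Hypothesis saJ : self_adjoint J.
Hypothesis exJ : extends (jacobi0 q b) J.
Hypothesis hE : resolution_of_identity J E.
Hypothesis hrho : quadratic_measure E (basis_vec 0) rho.

Let linJ : linear_operator J. Proof. by case: saJ. Qed.

Let dom_l2 f : dom J f -> l2 f.
Proof. by have [h _ _ _] := linJ; exact: h. Qed.

Let J_l2 f : dom J f -> l2 (J f).
Proof. by have [_ h _ _] := linJ; exact: h. Qed.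

Let dom_lin (a : C) f g : dom J f -> dom J g -> dom J (fun k => a * f k + g k).
Proof. by have [_ _ _ h] := linJ => hf hg; have [] := h a _ _ hf hg. Qed.

Let J_lin (a : C) f g : dom J f -> dom J g ->
  J (fun k => a * f k + g k) = fun k => a * J f k + J g k.
Proof. by have [_ _ _ h] := linJ => hf hg; have [] := h a _ _ hf hg. Qed.

Let J_sym f g : dom J f -> dom J g -> inner (J f) g = inner f (J g).
Proof.
have [_ _ h] := saJ => hf hg.
by have [_ _ ->] := (h g (J g)).2 (conj hg erefl).
Qed.

Let projE D : measurable D -> orthogonal_projection (E D).
Proof. by have [[h _ _ _] _] := hE; exact: h. Qed.

Let E_l2 D f : measurable D -> l2 f -> l2 (E D f).
Proof.
move=> mD hf; have [[_ h _ _] dE _ _] := projE mD.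
by apply: h; rewrite dE.
Qed.

Let E_lin D (a : C) f g : measurable D -> l2 f -> l2 g ->
  E D (fun k => a * f k + g k) = fun k => a * E D f k + E D g k.
Proof.
move=> mD hf hg; have [[_ _ _ h] dE _ _] := projE mD.
by have [] := h a f g _ _; rewrite ?dE.
Qed.

Let E_sym D f g : measurable D -> l2 f -> l2 g -> inner (E D f) g = inner f (E D g).
Proof. by move=> mD hf hg; have [_ _ _ ->] := projE mD. Qed.

Let E_I D D' f : measurable D -> measurable D' -> l2 f ->
  E (D `&` D') f = E D (E D' f).
Proof. by have [[_ _ h _] _] := hE => mD mD' hf; exact: h. Qed.

Let measE f : l2 f -> exists mu, quadratic_measure E f mu.
Proof. by have [[_ _ _ h] _] := hE; exact: h. Qed.

Let dom_sqr f (mu : {measure set RB -> \bar R}) : l2 f -> quadratic_measure E f mu ->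
  dom J f -> (\int[mu]_t (t ^+ 2)%:E < +oo)%E.
Proof. by have [_ h] := hE => hf hmu; have [[]] := h _ _ hf hmu. Qed.

Let sqr_dom f (mu : {measure set RB -> \bar R}) : l2 f -> quadratic_measure E f mu ->
  (\int[mu]_t (t ^+ 2)%:E < +oo)%E -> dom J f.
Proof. by have [_ h] := hE => hf hmu; have [[]] := h _ _ hf hmu. Qed.

Let first_moment f (mu : {measure set RB -> \bar R}) : quadratic_measure E f mu ->
  dom J f -> inner f (J f) = (\int[mu]_t (t : R))%:C.
Proof. by have [_ h] := hE => hmu hf; have [_] := h _ _ (dom_l2 hf) hmu; apply. Qed.

Let qm_fin f (mu : {measure set RB -> \bar R}) : quadratic_measure E f mu -> mu setT \is a fin_num.
Proof. by move=> ->. Qed.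

Let integrable_id f (mu : {measure set RB -> \bar R}) : quadratic_measure E f mu -> dom J f ->
  mu.-integrable setT (EFin \o (fun t : RB => t : R)).
Proof.
move=> hmu hf; apply: (@le_integrable _ _ _ _ _ measurableT _ (fun t : RB => (1 + t ^+ 2)%:E)).
- exact/measurable_EFinP.
- move=> t _; rewrite /= lee_fin [leRHS]ger0_norm ?addr_ge0 ?sqr_ge0//.
  by have := sqr_ge0 (t - 1); have := sqr_ge0 (t + 1); rewrite ler_norml; nra.
have -> : (fun t : RB => (1 + t ^+ 2)%:E) = (cst 1%:E) \+ (fun t => (t ^+ 2)%:E).
  by apply/funext => t; rewrite /= EFinD.
apply: integrableD => //.
  apply: (@integrable_bounded _ mu (cst 1) 1) => //; first exact: qm_fin hmu.
  by move=> t; rewrite normr1.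
apply/integrableP; split; first by apply/measurable_EFinP; exact: measurable_funX.
rewrite (eq_integral (fun t : RB => (t ^+ 2)%:E)); first exact: dom_sqr (dom_l2 hf) hmu hf.
by move=> t _; rewrite gee0_abs// lee_fin sqr_ge0.
Qed.

(** The measures of g projected by E(D) and by E of the complement add up to that of g, so the
    second moment of the first one is finite. *)
Lemma dom_E D g : measurable D -> dom J g -> dom J (E D g).
Proof.
move=> mD dg; have hg := dom_l2 dg.
have mN : measurable (~` D) by exact: measurableC.
have [mu hmu] := measE hg.
have [mu1 hmu1] := measE (E_l2 mD hg).
have [mu2 hmu2] := measE (E_l2 mN hg).
have restr D' (nu : {measure set RB -> \bar R}) : measurable D' ->
    quadratic_measure E (E D' g) nu -> forall B, measurable B -> nu B = mu (B `&` D').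
  move=> mD' hnu B mB; rewrite hnu// hmu; last exact: measurableI.
  rewrite -E_I// E_sym//; last exact/E_l2/hg/measurableI.
  by rewrite -E_I//; [rewrite setIC -setIA setIid|exact: measurableI].
have addE : forall B, measurable B -> measure_add mu1 mu2 B = mu B.
  move=> B mB; rewrite measure_addE (restr _ _ mD hmu1)// (restr _ _ mN hmu2)//.
  rewrite -setDE addeC -measureDI//.
apply: (sqr_dom (E_l2 mD hg) hmu1).
apply: le_lt_trans (dom_sqr hg hmu dg).
have m2 : measurable_fun [set: RB] (fun t : RB => (t ^+ 2)%:E).
  by apply/measurable_EFinP; exact: measurable_funX.
have pos (t : RB) : (0 <= (t ^+ 2)%:E)%E by rewrite lee_fin sqr_ge0.
have -> : (\int[mu]_t (t ^+ 2)%:E = \int[measure_add mu1 mu2]_t (t ^+ 2)%:E)%E.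
  by apply: eq_measure_integral => B mB _; exact/esym/addE.
by rewrite ge0_integral_measure_add// leeDl// integral_ge0.
Qed.

(** The resolution of the identity provides first moments for <f, E(.) f> only. Polarization writes
    4 Re <g, E(.) f> as a difference of two such measures, with density 4 w against m, and the
    formula carries over. *)
Lemma Re_inner_J_integral f g (m : {measure set RB -> \bar R}) (w : RB -> R) :
    dom J f -> dom J g -> m.-integrable setT (EFin \o w) ->
    (forall B, measurable B -> complex.Re (inner g (E B f)) = (\int[m]_(t in B) w t)%R) ->
  m.-integrable setT (EFin \o (fun t : RB => t * w t)) /\
  (\int[m]_t (t * w t))%R = complex.Re (inner g (J f)).
Proof.
move=> df dg iw hw; have hf := dom_l2 df; have hg := dom_l2 dg.
have dp := dom_lin 1 df dg; have dm := dom_lin (-1) df dg.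
have [mu1 hmu1] := measE (dom_l2 dp); have [mu2 hmu2] := measE (dom_l2 dm).
have i4w : m.-integrable setT (EFin \o (fun t => 4 * w t)).
  exact: (integrableZl measurableT 4 iw).
have h12 B : measurable B ->
    fine (mu1 B) - fine (mu2 B) = (\int[m]_(t in B) (4 * w t))%R.
  move=> mB; rewrite RintegralZl//; last exact: integrableS iw.
  rewrite hmu1// hmu2//= !E_lin// -hw// Re_inner_polarization//; do ?exact: E_l2.
  by rewrite -E_sym// inner_conj//; [case: (inner _ _)|exact: E_l2].
have [i4 e4] := signed_density (qm_fin hmu1) (qm_fin hmu2) i4w h12
  (integrable_id hmu1 dp) (integrable_id hmu2 dm).
have tw : (fun t : RB => t * w t) = fun t => 4^-1 * (t * (4 * w t)).
  by apply/funext => t; field.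
have itw : m.-integrable setT (EFin \o (fun t : RB => t * w t)).
  rewrite tw; exact: (integrableZl measurableT 4^-1 i4).
split => //; rewrite tw RintegralZl// e4.
have := Re_inner_polarization hg hf (J_l2 dg) (J_l2 df).
rewrite -!J_lin// (first_moment hmu1 dp) (first_moment hmu2 dm) /= => ->; first by field.
rewrite -J_sym// inner_conj//; [by case: (inner _ _)|exact: J_l2].
Qed.

Local Notation v n := (seq_of (iter n (Jop q b) 1)).

Lemma dom_seq_of (p : {poly C}) : dom J (seq_of p).
Proof.
apply: exJ.1; exists (size p) => k pk.
by rewrite /seq_of nth_default.
Qed.

Lemma J_seq_of (p : {poly C}) : J (seq_of p) = seq_of (Jop q b p).
Proof.
rewrite exJ.2; first by apply/funext => k; rewrite /seq_of coef_Jop.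
by exists (size p) => k pk; rewrite /seq_of nth_default.
Qed.

Lemma basis_vec0 : basis_vec 0 = seq_of (1 : {poly C}).
Proof. by apply/funext => k; rewrite /seq_of /basis_vec coef1. Qed.

(** The induction needs all Borel D: it says that <e_1, E(.) J_0^n e_1> has density t^n against rho.
    Then <E(D) e_1, E(.) J_0^n e_1> has density t^n on D, and its first moment is the next case; D
    the whole line also gives the integrability of t^(n+1). *)
Lemma spectral_moments n :
  rho.-integrable setT (fun t : RB => (t ^+ n)%:E) /\
  forall D, measurable D ->
    inner (basis_vec 0) (E D (v n)) = (\int[rho]_(t in D) t ^+ n)%:C.
Proof.
have h0 : l2 (basis_vec 0 : nat -> C) by rewrite basis_vec0; exact: l2_seq_of.
have d0 : dom J (basis_vec 0) by rewrite basis_vec0; exact: dom_seq_of.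
elim: n => [|n [IH1 IH2]].
  split.
    apply: (@integrable_bounded _ rho (fun t : RB => t ^+ 0) 1) => //.
      exact: qm_fin hrho.
    by move=> t; rewrite expr0 normr1.
  move=> D mD; rewrite /= -basis_vec0.
  have -> : (\int[rho]_(t in D) t ^+ 0)%R = complex.Re (inner (basis_vec 0) (E D (basis_vec 0))).
    under eq_Rintegral do rewrite expr0.
    by rewrite Rintegral_cst// mul1r hrho.
  have : inner (basis_vec 0) (E D (basis_vec 0)) = (inner (basis_vec 0) (E D (basis_vec 0)))^*.
    by rewrite -[LHS]E_sym// [LHS]inner_conj//; exact: E_l2.
  by case: (inner _ _) => x y [] h; congr (_ +i* _); lra.
have dv := dom_seq_of (iter n (Jop q b) 1); have hv := dom_l2 dv.
have JvE : J (v n) = v n.+1 by rewrite J_seq_of.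
have hv1 : l2 (v n.+1) by exact: l2_seq_of.
have shift D B : measurable D -> measurable B ->
    inner (E D (basis_vec 0)) (E B (v n)) = (\int[rho]_(t in B) ((fun t : RB => t ^+ n) \_ D) t)%:C.
  move=> mD mB; rewrite E_sym//; last exact: E_l2.
  rewrite -E_I// IH2; last exact: measurableI.
  by congr (_%:C); rewrite setIC Rintegral_mkcondr.
have iD D : measurable D -> rho.-integrable setT (EFin \o ((fun t : RB => t ^+ n) \_ D)).
  move=> mD; rewrite -restrict_EFin; apply: (integrable_mkcond _ mD).1.
  exact: (integrableS measurableT mD (@subsetT _ _) IH1).
have key D : measurable D ->
    rho.-integrable setT (EFin \o (fun t : RB => t * ((fun t : RB => t ^+ n) \_ D) t)) /\
    (\int[rho]_t (t * ((fun t : RB => t ^+ n) \_ D) t))%R =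
    complex.Re (inner (E D (basis_vec 0)) (J (v n))).
  move=> mD; apply: Re_inner_J_integral => //.
  - exact: dom_E.
  - exact: iD.
  - by move=> B mB; rewrite shift.
(* The same lemma for i E(D) e_1: as [inner] is antilinear on the left, this turns imaginary parts
   into real ones, and the density is 0. *)
have key_im D : measurable D -> complex.Im (inner (E D (basis_vec 0)) (J (v n))) = 0.
  move=> mD; have [_ _ dz _] := linJ.
  have dG := dom_E mD d0.
  have dG' := dom_lin 'i dG dz.
  have Im_i g : l2 g -> complex.Re (inner (fun k => 'i * E D (basis_vec 0) k + 0) g) =
      complex.Im (inner (E D (basis_vec 0)) g).
    move=> hg; rewrite inner_linl//; [|exact: E_l2|exact: dom_l2].
    have -> : inner (fun=> 0) g = 0.
      have z0 : inner (seq_of (0 : {poly C})) g = 0.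
        by rewrite inner_seq_of size_poly0 big_ord0.
      by rewrite -[RHS]z0; congr (inner _ g); apply/funext => k; rewrite /seq_of coef0.
    by rewrite addr0; case: (inner _ _) => x y /=; lra.
  have [||_] := @Re_inner_J_integral (v n) _ rho (fun=> 0) dv dG' _ _.
  - by apply: (@integrable_bounded _ rho (fun=> 0) 0) => // [|t]; [exact: qm_fin hrho|rewrite normr0].
  - move=> B mB; rewrite Im_i; last exact: E_l2.
    by rewrite shift//= /Rintegral integral0.
  rewrite Im_i; last by rewrite JvE.
  by under eq_Rintegral do rewrite mulr0; rewrite /Rintegral integral0 => <-.
split.
  have [+ _] := key _ measurableT.
  rewrite (_ : (fun t : RB => _) = (fun t : RB => t ^+ n.+1))//.
  by apply/funext => t; rewrite patchE in_setT exprS.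
move=> D mD; rewrite -[LHS]E_sym// -JvE.
have [_ eR] := key _ mD; have eI := key_im _ mD.
rewrite (_ : (\int[rho]_(t in D) t ^+ n.+1)%R = complex.Re (inner (E D (basis_vec 0)) (J (v n)))).
  by move: eI; case: (inner _ _) => x y /= ->.
rewrite -eR Rintegral_mkcond; apply: eq_Rintegral => t _.
by rewrite !patchE; case: ifP => _; rewrite ?mulr0// exprS.
Qed.

Lemma spectral_finite_moments : finite_moments rho.
Proof. by move=> n; exact: (spectral_moments n).1. Qed.

End SpectralMoments.

(** * Polynomials in J_0 *)

Section PolynomialModel.
Context {R : realType}.
Local Notation C := R[i].
Local Notation RB := (measurableTypeR R).
Variables (q b : nat -> R).
Hypothesis b0 : forall k, 0 < b k.
Implicit Types (p s f g : {poly C}).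

(* [polyJ p] is p(J_0) e_1; in [Jop], unlike in [p], the coefficients are the
   entries of a sequence and not those of a polynomial in t. *)
Definition polyJ p : {poly C} := \sum_(j < size p) p`_j *: iter j (Jop q b) 1.

Lemma polyJE p N : (size p <= N)%N -> polyJ p = \sum_(j < N) p`_j *: iter j (Jop q b) 1.
Proof.
move=> pN; rewrite /polyJ.
rewrite (big_ord_widen_cond _ (fun=> true) (fun k => p`_k *: iter k (Jop q b) 1) pN).
rewrite big_mkcond/=; apply: eq_bigr => k _; case: ltnP => // fk.
by rewrite nth_default// scale0r.
Qed.

Lemma polyJ_is_linear : linear polyJ.
Proof.
move=> a p s; pose N := maxn (size p) (size s).
have pN : (size p <= N)%N by exact: leq_maxl.
have sN : (size s <= N)%N by exact: leq_maxr.
rewrite (polyJE pN) (polyJE sN) (@polyJE _ N); last first.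
  rewrite (leq_trans (size_polyD _ _))// geq_max sN andbT.
  by rewrite (leq_trans (size_scale_leq _ _)).
rewrite scaler_sumr -big_split/=; apply: eq_bigr => k _.
by rewrite coefD coefZ scalerDl scalerA.
Qed.

HB.instance Definition _ := GRing.isLinear.Build C {poly C} {poly C} _ polyJ
  polyJ_is_linear.

Lemma polyJB p s : polyJ (p - s) = polyJ p - polyJ s.
Proof. exact: linearB. Qed.

Lemma polyJD p s : polyJ (p + s) = polyJ p + polyJ s.
Proof. exact: linearD. Qed.

Lemma polyJZ (a : C) p : polyJ (a *: p) = a *: polyJ p.
Proof. exact: linearZ. Qed.

Lemma polyJ_shift p s : (size s <= (size p).+1)%N -> s`_0 = 0 ->
  (forall k, s`_k.+1 = p`_k) -> polyJ s = Jop q b (polyJ p).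
Proof.
move=> sp s0 sS.
rewrite (polyJE sp) big_ord_recl s0 scale0r add0r /polyJ (raddf_sum (Jop q b)).
by apply: eq_bigr => k _; rewrite sS [RHS]linearZ.
Qed.

Lemma polyJ_mulX p : polyJ ('X * p) = Jop q b (polyJ p).
Proof.
apply: polyJ_shift => [||k]; rewrite ?coefXM//.
have [->|p0] := eqVneq p 0; first by rewrite mulr0 size_poly0.
by rewrite mulrC size_mulX.
Qed.

Lemma polyJ1 : polyJ 1 = 1.
Proof. by rewrite /polyJ size_poly1 big_ord1 coef1 scale1r. Qed.

Lemma polyJ_subX p : polyJ (('X - 'i%:P) * p) = Jshift q b (polyJ p).
Proof. by rewrite mulrBl polyJB polyJ_mulX mul_polyC polyJZ. Qed.

Lemma polyJ_subXn m p : polyJ (('X - 'i%:P) ^+ m * p) = iter m (Jshift q b) (polyJ p).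
Proof. by elim: m => [|m IH]; rewrite ?expr0 ?mul1r// exprS -mulrA polyJ_subX IH. Qed.

Lemma Jop_Xn n : Jop q b 'X^(n.+1) = (b n.+1)%:C *: 'X^(n.+2) + (q n.+1)%:C *: 'X^(n.+1) +
  (b n)%:C *: 'X^n.
Proof.
have e (c : nat -> R) i j : (c i)%:C * (i == j)%:R = (c j)%:C * (i == j)%:R.
  by case: eqP => [->|]//; rewrite !mulr0.
apply/polyP => k; rewrite coef_Jop !(coefD, coefZ, coefXn).
case: k => [|k] /=; rewrite !coefXn !eqSS.
  by rewrite (e b 0%N n) /= !mulr0n !mulr0 !add0r.
by rewrite (e b k n.+1) (e (fun i => q i.+1) k n) (e b k.+1 n).
Qed.

(** Each b n is nonzero, so the three-term recurrence can be solved for the next basis vector; two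
    consecutive ones are carried along. *)
Lemma polyJ_surj f : exists p, polyJ p = f.
Proof.
have XS n : exists p s, polyJ p = 'X^n :> {poly C} /\ polyJ s = 'X^(n.+1) :> {poly C}.
  elim: n => [|n [p [s [pE sE]]]].
    have e : Jop q b 1 = (b 0)%:C *: 'X + (q 0)%:C *: 1.
      apply/polyP => k; rewrite coef_Jop !(coefD, coefZ, coefX, coef1).
      by case: k => [|[|k]] /=; rewrite !coef1 /= ?mulr0 ?mulr1 ?addr0 ?add0r.
    exists 1, ((b 0)%:C^-1 *: ('X * 1 - (q 0)%:C *: 1)); rewrite expr0 expr1.
    split; first exact: polyJ1.
    rewrite polyJZ polyJB polyJ_mulX polyJZ polyJ1 e.
    rewrite addrK scalerA mulVf ?scale1r//.
    by rewrite fmorph_eq0 gt_eqF.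
  exists s, ((b n.+1)%:C^-1 *: ('X * s - ((q n.+1)%:C *: s + (b n)%:C *: p))); split => //.
  rewrite polyJZ polyJB polyJD polyJ_mulX.
  rewrite !polyJZ sE pE Jop_Xn.
  rewrite -[X in X - _]addrA addrK scalerA mulVf ?scale1r//.
  by rewrite fmorph_eq0 gt_eqF.
have /choice[P hP] n : exists p, polyJ p = 'X^n :> {poly C}.
  by have [p [s [h _]]] := XS n; exists p.
exists (\sum_(k < size f) f`_k *: P k); rewrite linear_sum /=.
under eq_bigr do rewrite linearZ /= hP.
by rewrite -poly_def coefK.
Qed.

Lemma ip_conj f g : ip g f = (ip f g)^*.
Proof.
have [h1 h2] := (leq_maxl (size f) (size g), leq_maxr (size f) (size g)).
rewrite (ipE _ h2) (ipE _ h1) rmorph_sum; apply: eq_bigr => k _.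
by rewrite rmorphM /= conjCK mulrC.
Qed.

Lemma ip_is_linear f : linear_for *%R (ip f).
Proof.
move=> a g h; rewrite /ip mulr_sumr -big_split/=; apply: eq_bigr => k _.
by rewrite coefD coefZ; ring.
Qed.

HB.instance Definition _ f := GRing.isLinear.Build C {poly C} C _ (ip f) (ip_is_linear f).

Lemma ip_iter_Jop i f g : ip (iter i (Jop q b) f) g = ip f (iter i (Jop q b) g).
Proof. by elim: i f => // i IH f; rewrite [X in ip X _]iterSr IH Jop_sym. Qed.

Lemma ip1 f : ip 1 f = f`_0.
Proof. by rewrite /ip size_poly1 big_ord1 coef1 /= rmorph1 mul1r. Qed.

Variable rho : {measure set RB -> \bar R}.
Hypothesis hm : finite_moments rho.
Hypothesis hmom : forall n, (iter n (Jop q b) 1)`_0 = (mom rho 'X^n)%:C.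

(** Both sides are the Hankel form of the moments: by symmetry of J_0, <J_0^i e_1, J_0^j e_1>
    depends on i + j only. *)
Lemma mom_sqn_polyJ p : mom rho (sqn p) = n2 (polyJ p).
Proof.
have -> : mom rho (sqn p) = mom rho (\sum_(i < size p) \sum_(j < size p)
    complex.Re ((p`_i)^* * p`_j) *: 'X^(i + j)).
  apply: eq_mom => t; rewrite horner_sqn horner_sum.
  have -> : csq p.[t%:C] = complex.Re ((p.[t%:C])^* * p.[t%:C]) by rewrite mulrC mulJc.
  rewrite horner_coef rmorph_sum mulr_suml Rej_sum; apply: eq_bigr => i _.
  rewrite mulr_sumr Rej_sum horner_sum; apply: eq_bigr => j _.
  rewrite hornerZ hornerXn rmorphM rmorphXn /= conj_realc.
  rewrite (_ : _ * _ = (p`_i)^* * p`_j * (t ^+ (i + j))%:C); last first.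
    by rewrite exprD rmorphM !rmorphXn /=; ring.
  by rewrite Rej_mulr.
have ipJ i j : ip (iter i (Jop q b) 1) (iter j (Jop q b) 1) = (mom rho 'X^(i + j))%:C.
  by rewrite ip_iter_Jop ip1 -iterD hmom.
have -> : n2 (polyJ p) = complex.Re (ip (polyJ p) (polyJ p)) by rewrite ipff.
rewrite mom_sum// [ip (polyJ p) (polyJ p)](_ : _ = \sum_(i < size p) \sum_(j < size p)
    (p`_i)^* * p`_j * (mom rho 'X^(i + j))%:C).
  rewrite Rej_sum; apply: eq_bigr => i _; rewrite mom_sum// Rej_sum.
  by apply: eq_bigr => j _; rewrite momZ// Rej_mulr.
rewrite ip_conj [ip (polyJ p) (polyJ p)]linear_sum /= rmorph_sum /=.
apply: eq_bigr => i _; rewrite linearZ /= rmorphM /= -ip_conj [X in _ * X]linear_sum /= mulr_sumr.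
by apply: eq_bigr => j _; rewrite linearZ /= ipJ mulrA.
Qed.

End PolynomialModel.

(** * Density of polynomials in L_2(rho) *)

Section Approximation.
Context {R : realType}.
Local Notation C := R[i].
Local Notation RB := (measurableTypeR R).
Variable rho : {measure set RB -> \bar R}.
Hypothesis hm : finite_moments rho.
Implicit Types (p s : {poly C}) (phi psi : R -> C).

Definition approximable phi := cmeasurable phi /\ forall eps : R, 0 < eps ->
  exists p : {poly C}, (\int[rho]_t (csq (phi t - p.[t%:C]))%:E < eps%:E)%E.

Lemma cmeasurableD phi psi : cmeasurable phi -> cmeasurable psi ->
  cmeasurable (fun t => phi t + psi t).
Proof.
move=> [hr hi] [ur ui]; split.
  under eq_fun do rewrite RejD; exact: measurable_funD.
under eq_fun do rewrite ImjD; exact: measurable_funD.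
Qed.

Lemma cmeasurable_cst (c : C) : cmeasurable (fun=> c).
Proof. by split; exact: measurable_cst. Qed.

Lemma cmeasurableB phi psi : cmeasurable phi -> cmeasurable psi ->
  cmeasurable (fun t => phi t - psi t).
Proof.
move=> hp hq; rewrite (_ : (fun t => _) = fun t => phi t + (-1) * psi t).
  by apply: cmeasurableD => //; apply: cmeasurableM => //; exact: cmeasurable_cst.
by apply/funext => t; rewrite mulN1r.
Qed.

Lemma measurable_csq phi : cmeasurable phi ->
  measurable_fun setT (fun t : RB => (csq (phi t))%:E).
Proof.
move=> [hr hi]; apply/measurable_EFinP.
by apply: measurable_funD; exact: measurable_funX.
Qed.

Lemma integral_csqD_le phi psi : cmeasurable phi -> cmeasurable psi ->
  (\int[rho]_t (csq (phi t + psi t))%:E <=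
   2%:E * (\int[rho]_t (csq (phi t))%:E + \int[rho]_t (csq (psi t))%:E))%E.
Proof.
move=> hp hq; have csq0' (z : C) : (0 <= (csq z)%:E)%E by rewrite lee_fin csq_ge0.
have mp := measurable_csq hp; have mq := measurable_csq hq.
rewrite -ge0_integralD//.
have nn (t : RB) : setT t -> (0 <= (csq (phi t))%:E + (csq (psi t))%:E)%E.
  by move=> _; rewrite adde_ge0.
have mm : measurable_fun setT (fun t : RB => (csq (phi t))%:E + (csq (psi t))%:E)%E.
  exact: emeasurable_funD.
rewrite -ge0_integralZl_EFin//.
apply: ge0_le_integral => //.
- exact: (measurable_csq (cmeasurableD hp hq)).
- by apply: emeasurable_funM => //; exact: measurable_cst.
- by move=> t _; rewrite -EFinD -EFinM lee_fin csqD_le.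
Qed.

Lemma approximable_lim phi : cmeasurable phi ->
  (forall eps : R, 0 < eps -> exists2 psi, approximable psi &
     (\int[rho]_t (csq (phi t - psi t))%:E < eps%:E)%E) ->
  approximable phi.
Proof.
move=> mphi h; split => // eps eps0; have e4 : 0 < eps / 4 by rewrite divr_gt0.
have [psi [mpsi hpsi] close] := h _ e4; have [p hp] := hpsi _ e4.
exists p; have mp := cmeasurable_horner p.
rewrite (_ : (fun t : RB => (csq (phi t - p.[t%:C]))%:E) =
  fun t => (csq ((phi t - psi t) + (psi t - p.[t%:C])))%:E); last first.
  by apply/funext => t; rewrite addrA subrK.
apply: le_lt_trans (integral_csqD_le (cmeasurableB mphi mpsi) (cmeasurableB mpsi mp)) _.
rewrite (_ : eps%:E = 2%:E * ((eps / 4)%:E + (eps / 4)%:E))%E; last first.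
  by rewrite -EFinD -EFinM; congr EFin; field.
by rewrite lte_pmul2l// lteD.
Qed.

Lemma approximableD phi psi : approximable phi -> approximable psi ->
  approximable (fun t => phi t + psi t).
Proof.
move=> [mphi hphi] [mpsi hpsi]; split; first exact: cmeasurableD.
move=> eps eps0; have e4 : 0 < eps / 4 by rewrite divr_gt0.
have [p hp] := hphi _ e4; have [s hs] := hpsi _ e4; exists (p + s).
rewrite (_ : (fun t : RB => (csq (phi t + psi t - (p + s).[t%:C]))%:E) =
  fun t => (csq ((phi t - p.[t%:C]) + (psi t - s.[t%:C])))%:E); last first.
  by apply/funext => t; rewrite hornerD opprD addrACA.
apply: le_lt_trans (integral_csqD_le (cmeasurableB mphi (cmeasurable_horner p))
  (cmeasurableB mpsi (cmeasurable_horner s))) _.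
rewrite (_ : eps%:E = 2%:E * ((eps / 4)%:E + (eps / 4)%:E))%E; last first.
  by rewrite -EFinD -EFinM; congr EFin; field.
by rewrite lte_pmul2l// lteD.
Qed.

Lemma approximableZ (c : C) phi : approximable phi -> approximable (fun t => c * phi t).
Proof.
move=> [mphi hphi]; split.
  by apply: cmeasurableM => //; exact: cmeasurable_cst.
move=> eps eps0; pose k := csq c + 1.
have k0 : 0 < k by rewrite ltr_wpDl// csq_ge0.
have [p hp] := hphi _ (divr_gt0 eps0 k0); exists (c *: p).
apply: (@le_lt_trans _ _ (\int[rho]_t (k%:E * (csq (phi t - p.[t%:C]))%:E))%E).
  apply: ge0_le_integral => //.
  - by move=> t _; rewrite lee_fin csq_ge0.
  - exact: (measurable_csq (cmeasurableB (cmeasurableM (cmeasurable_cst c) mphi) (cmeasurable_horner _))).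
  - apply: emeasurable_funM; first exact: measurable_cst.
    exact: (measurable_csq (cmeasurableB mphi (cmeasurable_horner p))).
  - move=> t _; rewrite hornerZ -mulrBr csqM -EFinM lee_fin ler_wpM2r ?csq_ge0//.
    by rewrite lerDl.
have nn (t : RB) : setT t -> (0 <= (csq (phi t - p.[t%:C]))%:E)%E.
  by move=> _; rewrite lee_fin csq_ge0.
have mm : measurable_fun setT (fun t : RB => (csq (phi t - p.[t%:C]))%:E).
  exact: (measurable_csq (cmeasurableB mphi (cmeasurable_horner p))).
rewrite ge0_integralZl_EFin//; last exact: ltW.
rewrite (_ : eps%:E = k%:E * (eps / k)%:E)%E; last first.
  by rewrite -EFinM; congr EFin; field; rewrite gt_eqF.
by rewrite lte_pmul2l// lte_fin.
Qed.

Lemma approximable0 : approximable (fun=> 0).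
Proof.
split; first exact: cmeasurable_cst.
move=> eps eps0; exists 0; under eq_integral do rewrite horner0 subr0 csq0.
by rewrite integral0 lte_fin.
Qed.

Lemma approximable_sum (I : Type) (r : seq I) (F : I -> R -> C) :
  (forall i, approximable (F i)) -> approximable (fun t => \sum_(i <- r) F i t).
Proof.
move=> h; elim: r => [|i r IH].
  by under eq_fun do rewrite big_nil; exact: approximable0.
by under eq_fun do rewrite big_cons; exact: approximableD.
Qed.

Hypothesis approximable_indic : forall D : set RB, measurable D ->
  approximable (fun t => (\1_D t)%:C).

Import HBNNSimple.

Lemma approximable_nnsfun (h : {nnsfun RB >-> R}) : approximable (fun t => (h t)%:C).
Proof.
rewrite (_ : (fun t : R => _) = fun t => \sum_(y <- finmap.enum_fset (fset_set (range h))) (y%:C * (\1_(h @^-1` [set y]) t)%:C)); last first.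
  apply/funext => t; rewrite fimfunE fsbig_finite//= rmorph_sum.
  by apply: eq_bigr => y _; rewrite rmorphM.
apply: approximable_sum => y; apply: approximableZ.
exact: approximable_indic.
Qed.

(** Simple functions increase to f, and f^2 dominates the squared differences. *)
Lemma approximable_ge0 (f : R -> R) : (forall t, 0 <= f t) ->
  measurable_fun setT (f : RB -> R) -> (\int[rho]_t (f t ^+ 2)%:E < +oo)%E ->
  approximable (fun t => (f t)%:C).
Proof.
move=> f0 mf fi; apply: approximable_lim; first by split => //; exact: measurable_cst.
move=> eps eps0.
have mfE : measurable_fun setT (EFin \o (f : RB -> R)) by exact/measurable_EFinP.
pose h := nnsfun_approx measurableT mfE.
have hcvg t : (h n t) @[n --> \oo] --> f t.
  have c : (EFin \o h^~ t) @ \oo --> (f t)%:E.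
    by apply: (@cvg_nnsfun_approx _ _ _ _ measurableT _ mfE) => // x _; rewrite lee_fin.
  exact: (fine_cvg c).
have hle n t : h n t <= f t.
  have nd : nondecreasing_seq (fun n => h n t).
    by move=> i j ij; exact/lefP/nd_nnsfun_approx.
  by rewrite -(cvg_lim _ (hcvg t))//; apply: nondecreasing_cvgn_le => //; exact: cvgP (hcvg t).
have mdiff n : measurable_fun setT (fun t : RB => ((f t - h n t) ^+ 2)%:E).
  by apply/measurable_EFinP; apply: measurable_funX; exact: measurable_funB.
have c := @dominated_cvg _ _ _ rho setT measurableT
  (fun n t => ((f t - h n t) ^+ 2)%:E) (fun=> 0%E) (fun t => (f t ^+ 2)%:E) mdiff _ _ _ _.
have {}c : (\int[rho]_t ((f t - h n t) ^+ 2)%:E)%E @[n --> \oo] --> 0%E.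
  have := c; rewrite integral0; apply => //.
  - move=> t _; apply/cvg_EFin; first by near=> n.
    have d : f t - h n t @[n --> \oo] --> 0.
      by rewrite -[X in _ --> X](subrr (f t)); apply: cvgB => //; exact: cvg_cst.
    by rewrite -[X in _ --> X](mulr0 0); under eq_fun do rewrite /= expr2; exact: cvgM.
  - apply/integrableP; split.
      by apply/measurable_EFinP; exact: measurable_funX.
    rewrite (eq_integral (fun t : RB => (f t ^+ 2)%:E))//.
    by move=> t _; rewrite gee0_abs// lee_fin sqr_ge0.
  - move=> n t _; rewrite lee_fin ger0_norm ?sqr_ge0//.
    by rewrite lerXn2r ?nnegrE ?subr_ge0// gerBl.
have [fin_near /cvgr_lt/(_ _ eps0) lt_near] := (fine_cvgP _ _).1 c.
have [N _ /(_ N (leqnn N)) hN] : \forall n \near \oo,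
    (\int[rho]_t ((f t - h n t) ^+ 2)%:E < eps%:E)%E.
  near=> n; have fn : (\int[rho]_t ((f t - h n t) ^+ 2)%:E)%E \is a fin_num.
    by near: n; exact: fin_near.
  by rewrite -(fineK fn) lte_fin; near: n; exact: lt_near.
exists (fun t => (h N t)%:C); first exact: approximable_nnsfun.
by under eq_integral do rewrite -rmorphB csqR.
Unshelve. all: by end_near. Qed.

Lemma approximable_L2 (phi : R -> C) : cmeasurable phi ->
  (\int[rho]_t (csq (phi t))%:E < +oo)%E -> approximable phi.
Proof.
move=> [mr mi] fi.
have ge0_case (f : RB -> R) : (forall t, 0 <= f t) -> (forall t, f t ^+ 2 <= csq (phi t)) ->
    measurable_fun setT f -> approximable (fun t => (f t)%:C).
  move=> f0 fle mf; apply: approximable_ge0 => //.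
  apply: le_lt_trans fi; apply: ge0_le_integral => //.
  - by move=> t _; rewrite lee_fin sqr_ge0.
  - by apply/measurable_EFinP; exact: measurable_funX.
  - exact: measurable_csq.
  - by move=> t _; rewrite lee_fin fle.
have sq (x y : R) : (Num.max x 0) ^+ 2 <= x ^+ 2 + y ^+ 2.
  by case: (leP x 0) => x0; rewrite ?expr0n ?addr_ge0 ?sqr_ge0//= lerDl sqr_ge0.
have sp (x : R) : x = Num.max x 0 - Num.max (- x) 0.
  by case: (leP x 0) => h; case: (leP (- x) 0) => h'; lra.
have max0 (x : R) : 0 <= Num.max x 0 by rewrite le_max lexx orbT.
have a1 : approximable (fun t => (Num.max (complex.Re (phi t)) 0)%:C).
  by apply: (ge0_case) => //; [move=> t; exact: sq|exact: measurable_maxr].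
have a2 : approximable (fun t => (Num.max (- complex.Re (phi t)) 0)%:C).
  apply: (ge0_case) => //; first by move=> t; rewrite (le_trans (sq _ (complex.Im (phi t))))// sqrrN.
  by apply: measurable_maxr => //; exact: measurable_funN.
have a3 : approximable (fun t => (Num.max (complex.Im (phi t)) 0)%:C).
  apply: (ge0_case) => //; first by move=> t; rewrite (le_trans (sq _ (complex.Re (phi t))))// addrC.
  exact: measurable_maxr.
have a4 : approximable (fun t => (Num.max (- complex.Im (phi t)) 0)%:C).
  apply: (ge0_case) => //; first by move=> t; rewrite (le_trans (sq _ (complex.Re (phi t))))// sqrrN addrC.
  by apply: measurable_maxr => //; exact: measurable_funN.
have -> : phi = (fun t => ((Num.max (complex.Re (phi t)) 0)%:C + (-1) * (Num.max (- complex.Re (phi t)) 0)%:C) +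
  'i * ((Num.max (complex.Im (phi t)) 0)%:C + (-1) * (Num.max (- complex.Im (phi t)) 0)%:C)).
  by apply/funext => t; rewrite !mulN1r -!rmorphB -!sp [LHS]complexE.
by do ![apply: approximableD|apply: approximableZ].
Qed.

End Approximation.

Section SpectralApproximation.
Context {R : realType}.
Local Notation C := R[i].
Local Notation RB := (measurableTypeR R).
Implicit Types (p f : {poly C}) (D : set RB).

Variables (J : operator R) (q b : nat -> R) (E : set R -> operator R).
Variable rho : {measure set RB -> \bar R}.
Hypothesis b0 : forall k, 0 < b k.
Hypothesis saJ : self_adjoint J.
Hypothesis exJ : extends (jacobi0 q b) J.
Hypothesis hE : resolution_of_identity J E.
Hypothesis hrho : quadratic_measure E (basis_vec 0) rho.

Let hm : finite_moments rho := spectral_finite_moments saJ exJ hE hrho.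

Let l2_e0 : l2 (basis_vec 0 : nat -> C).
Proof. by rewrite basis_vec0; exact: l2_seq_of. Qed.

Lemma spectral_moment0 n : (iter n (Jop q b) 1)`_0 = (mom rho 'X^n)%:C.
Proof.
have := (spectral_moments saJ exJ hE hrho n).2 setT measurableT.
have [[_ ET _ _] _] := hE; rewrite ET; last exact: l2_seq_of.
rewrite basis_vec0 inner_seq_of_ip ip1 => ->.
by rewrite momXn.
Qed.

Lemma mom_sqn_n2 p : mom rho (sqn p) = n2 (polyJ q b p).
Proof. by apply: mom_sqn_polyJ => //; exact: spectral_moment0. Qed.

(** With u = E(D) e_1, expanding the square gives int |1_D - p|^2 d rho = |u|^2 - 2 Re <u, p(J_0)
    e_1> + |p(J_0) e_1|^2. By [polyJ_surj], p can be chosen so that p(J_0) e_1 is a truncation f of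
    u; what remains is |u|^2 - |f|^2, the tail of a convergent series. *)
Lemma approximable_indic D : measurable D -> approximable rho (fun t => (\1_D t)%:C).
Proof.
move=> mD; split.
  split; [exact: measurable_indic|exact: measurable_cst].
move=> eps eps0.
have [[projE _ _ _] _] := hE.
have [[_ E_l2 _ _] domE E_idem E_sym] := projE _ mD.
pose u := E D (basis_vec 0).
have l2u : l2 u by apply: E_l2; rewrite domE.
have rhoE : rho D = (complex.Re (inner u u))%:E.
  by rewrite (hrho mD) E_sym// E_idem.
have Lsum (I : Type) (r : seq I) (a : I -> C) (v : I -> {poly C}) :
    inner u (seq_of (\sum_(i <- r) a i *: v i)) = \sum_(i <- r) a i * inner u (seq_of (v i)).
  elim: r => [|i r IH].
    rewrite !big_nil inner_conj//; last exact: l2_seq_of.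
    by rewrite inner_seq_of size_poly0 big_ord0 rmorph0.
  by rewrite !big_cons seq_of_lin inner_linr// ?IH//; exact: l2_seq_of.
have LE p : complex.Re (inner u (seq_of (polyJ q b p))) = (\int[rho]_(t in D) (reP p).[t])%R.
  rewrite /polyJ Lsum Rej_sum.
  have -> : (\int[rho]_(t in D) (reP p).[t])%R =
      \sum_(j < size p) complex.Re p`_j * (\int[rho]_(t in D) t ^+ j)%R.
    under eq_Rintegral do rewrite horner_poly.
    rewrite -(big_mkord xpredT (fun j => complex.Re p`_j * (\int[rho]_(t in D) t ^+ j)%R)).
    under eq_Rintegral do rewrite -(big_mkord xpredT (fun j => complex.Re p`_j * _ ^+ j)).
    have i_j j : rho.-integrable D (EFin \o (fun t : RB => complex.Re p`_j * t ^+ j)).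
      apply: (@integrableS _ _ _ rho setT) => //.
      exact: (integrableZl measurableT (complex.Re p`_j) (hm j)).
    elim: (index_iota _ _) => [|j s IH].
      rewrite big_nil; under eq_Rintegral do rewrite big_nil.
      by rewrite /Rintegral integral0.
    rewrite big_cons; under eq_Rintegral do rewrite big_cons.
    rewrite RintegralD//; last first.
      rewrite (_ : EFin \o _ = (fun t => \sum_(j <- s) (complex.Re p`_j * t ^+ j)%:E)%E).
        by apply: integrable_sum => //= k _; exact: i_j.
      by apply/funext => t; rewrite /= sumEFin.
    rewrite IH RintegralZl//.
    by apply: (@integrableS _ _ _ rho setT) => //; exact: hm.
  apply: eq_bigr => j _; rewrite E_sym//; last exact: l2_seq_of.
  by rewrite (spectral_moments saJ exJ hE hrho j).2// Rej_mulr.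
have [N hN] : exists N, complex.Re (inner u u) - \sum_(k < N) csq (u k) < eps.
  have /cvgrPdist_lt/(_ _ eps0)[N _ /(_ N (leqnn N))] := inner_self l2u.
  by rewrite /series/= big_mkord => /(le_lt_trans (ler_norm _)) h; exists N.
pose f := \poly_(k < N) u k; have [p pE] := polyJ_surj q b0 f.
have sf : (size f <= N)%N by exact: size_poly.
have n2f : n2 f = \sum_(k < N) csq (u k).
  by rewrite (n2E sf); apply: eq_bigr => k _; rewrite coef_poly ltn_ord.
have Lf : inner u (seq_of f) = (n2 f)%:C.
  rewrite inner_conj//; last exact: l2_seq_of.
  rewrite inner_seq_of -[RHS]conj_realc -ipff; congr (_^*).
  apply: eq_bigr => k _; congr (_ * _).
  by rewrite coef_poly (leq_trans (ltn_ord k)).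
exists p.
have iD (h : RB -> R) : rho.-integrable setT (EFin \o h) ->
    rho.-integrable setT (EFin \o (h \_ D)).
  move=> ih; rewrite -restrict_EFin; apply: (integrable_mkcond _ mD).1.
  exact: (integrableS measurableT mD (@subsetT _ _) ih).
(* [_ \_ D] takes the value [point] outside D, which has to be 0 for the expansion below. *)
have pt0 : (point : R) = 0 by [].
have split_csq t : csq ((\1_D t)%:C - p.[t%:C]) =
    (sqn (1 : {poly C})).[t] * \1_D t - 2 * ((fun t => (reP p).[t]) \_ D) t + (sqn p).[t].
  rewrite !horner_sqn hornerC csqR expr1n mul1r patchE indicE horner_reP.
  case: (p.[t%:C]) => x y; rewrite /csq; case: (t \in D) => /=; rewrite ?pt0; ring.
rewrite (eq_integral (fun t => (\1_D t - 2 * ((fun t => (reP p).[t]) \_ D) t + (sqn p).[t])%:E)); last first.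
  by move=> t _; rewrite split_csq horner_sqn hornerC csqR expr1n mul1r.
have i1 : rho.-integrable setT (EFin \o (\1_D : RB -> R)).
  apply: (@integrable_bounded _ rho _ 1) => //; first exact: finite_moments_fin_num.
  by move=> t; rewrite indicE; case: (_ \in _); rewrite ?normr0 ?normr1.
have i2 := iD _ (integrable_horner (reP p) hm).
have i3 := integrable_horner (sqn p) hm.
have i2' : rho.-integrable setT (EFin \o (fun t => 2 * ((fun t : RB => (reP p).[t]) \_ D) t)).
  exact: (integrableZl measurableT 2 i2).
have i12 := integrableB measurableT i1 i2'.
have val : (\int[rho]_t (\1_D t - 2 * ((fun t => (reP p).[t]) \_ D) t + (sqn p).[t]))%R =
    complex.Re (inner u u) - n2 f.
  rewrite (RintegralD measurableT i12 i3) (RintegralB measurableT i1 i2').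
  rewrite RintegralZl// -Rintegral_mkcond -LE pE Lf -/(mom rho (sqn p)) mom_sqn_n2 pE.
  rewrite {1}/Rintegral integral_indic// setIT rhoE /=; ring.
have ii : (rho.-integrable setT (EFin \o (fun t => \1_D t - 2 * ((fun t : RB => (reP p).[t]) \_ D) t + (sqn p).[t]))).
  exact: (integrableD measurableT i12 i3).
rewrite -(fineK (integrable_fin_num measurableT ii)) lte_fin.
by rewrite -/(Rintegral _ _ _) val n2f.
Qed.

Lemma spectral_approximable (phi : R -> C) : cmeasurable phi ->
  (\int[rho]_t (csq (phi t))%:E < +oo)%E -> approximable rho phi.
Proof. by apply: approximable_L2; exact: approximable_indic. Qed.

End SpectralApproximation.

(** * Weighted measures and the index of determinacy *)

Section SupportAndWeights.
Context {R : realType}.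
Local Notation C := R[i].
Local Notation RB := (measurableTypeR R).
Implicit Types (mu rho : {measure set RB -> \bar R}) (p : {poly C}) (z w : C).

(** Each point off the support lies in a null interval with rational endpoints, and these are
    countably many. *)
Lemma negligible_setC_supp mu : mu.-negligible (~` supp mu).
Proof.
pose U (n : nat) : set RB := if unpickle n is Some (a, b) then
  if mu `](ratr a : R), ratr b[%classic == 0%E then `](ratr a : R), ratr b[%classic else set0
  else set0.
have nI n : mu.-negligible (U n).
  rewrite /U; case: (unpickle n) => [[a b]|]; last exact: negligible_set0.
  by case: eqP => [h|_]; [exact/negligibleP|exact: negligible_set0].
apply: negligibleS (negligible_bigcup nI) => t /existsNP[e /not_implyP[e0 h]].
have /rat_in_itvoo[a] : t - e < t by rewrite ltrBlDr ltrDl.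
have /rat_in_itvoo[b] : t < t + e by rewrite ltrDl.
rewrite !in_itv /= => /andP[tb be] /andP[ea at_].
exists (pickle (a, b)); [exact: I|rewrite /U pickleK].
have -> : mu `](ratr a : R), ratr b[%classic = 0%E.
  apply/eqP; rewrite eq_le measure_ge0 andbT leNgt; apply/negP => h'; apply: h.
  apply: (lt_le_trans h'); apply: le_measure; rewrite ?inE//; first exact: measurable_ball.
  move=> s; rewrite /= in_itv /= /ball /= => /andP[sa sb].
  by rewrite ltr_norml; lra.
by rewrite eqxx /= in_itv /= at_ tb.
Qed.

Lemma weightE z k (t : R) : weight z k t = (sqn ('X - z%:P) ^+ k).[t].
Proof. by rewrite /weight exprM csq_normc horner_exp horner_sqn hornerXsubC. Qed.

Lemma horner_sqnXsubi (t : R) : (sqn ('X - ('i : C)%:P)).[t] = 1 + t ^+ 2.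
Proof. by rewrite horner_sqn hornerXsubC /csq /=; ring. Qed.

Lemma csq_sub_le z : exists2 K : R, 0 < K & forall t : R, csq (t%:C - z) <= K * (1 + t ^+ 2).
Proof.
case: z => x y; exists (2 + 2 * x ^+ 2 + y ^+ 2) => [|t].
  by have := sqr_ge0 x; have := sqr_ge0 y; lra.
rewrite /csq /=; have := sqr_ge0 (t + x); have := sqr_ge0 t; have := sqr_ge0 x.
by have := sqr_ge0 y; have := mulr_ge0 (sqr_ge0 x) (sqr_ge0 t); have := mulr_ge0 (sqr_ge0 y) (sqr_ge0 t); lra.
Qed.

(** z has a positive distance to the support: at least |Im z| if this is nonzero, otherwise at least
    the radius of a null ball around z. With [csq_sub_le], the weights |t - z|^2 and |t - i|^2
    become comparable on the support. *)
Lemma csq_sub_ge rho z : ~ (exists2 t : R, supp rho t & z = t%:C) ->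
  exists2 K : R, 0 < K & forall t, supp rho t -> 1 + t ^+ 2 <= K * csq (t%:C - z).
Proof.
case: z => x y hz.
suff [d d0 hd] : exists2 d : R, 0 < d & forall t, supp rho t -> d <= csq (t%:C - (x +i* y)).
  exists (2 + (1 + 2 * x ^+ 2) / d) => [|t /hd ht].
    by rewrite ltr_wpDr// divr_ge0 ?(ltW d0)//; have := sqr_ge0 x; lra.
  have x2 : 1 + 2 * x ^+ 2 <= (1 + 2 * x ^+ 2) / d * csq (t%:C - (x +i* y)).
    rewrite -mulrA ler_peMr//; first by have := sqr_ge0 x; lra.
    by rewrite mulrC ler_pdivlMr// mul1r.
  have c2 : 1 + t ^+ 2 <= 2 * csq (t%:C - (x +i* y)) + (1 + 2 * x ^+ 2).
    by rewrite /csq /=; have := sqr_ge0 (t - 2 * x); have := sqr_ge0 y; lra.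
  by rewrite (le_trans c2)// [leRHS]mulrDl lerD2l.
have [y0|y0] := eqVneq y 0; last first.
  exists (y ^+ 2) => [|t _]; first by rewrite lt_def sqrf_eq0 y0 sqr_ge0.
  by rewrite /csq /= sub0r sqrrN lerDr sqr_ge0.
have /existsNP[e /not_implyP[e0 he]] : ~ supp rho x.
  by move=> hx; apply: hz; exists x => //; rewrite y0.
exists (e ^+ 2) => [|t ht]; first exact: exprn_gt0.
rewrite y0 /csq /= subr0 expr0n addr0 -[leRHS]real_normK ?num_real// lerXn2r ?nnegrE ?(ltW e0)//.
rewrite leNgt; apply/negP => te; apply: he.
apply: (lt_le_trans (ht (e - `|t - x|) _)); first by rewrite subr_gt0.
apply: le_measure; rewrite ?inE; [exact: measurable_ball|exact: measurable_ball|].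
move=> s; rewrite /ball /= => st.
rewrite (_ : x - s = - (t - x) + (t - s)); last by ring.
by rewrite (le_lt_trans (ler_normD _ _))// normrN -ltrBrDl.
Qed.

End SupportAndWeights.

Section WeightedMeasure.
Context {R : realType}.
Local Notation C := R[i].
Local Notation RB := (measurableTypeR R).
Implicit Types (p r s : {poly C}) (w : C).

Lemma le_mom_supp (rho : {measure set RB -> \bar R}) (u v : {poly R}) :
  finite_moments rho -> (forall t, 0 <= u.[t]) -> (forall t, 0 <= v.[t]) ->
  (forall t, supp rho t -> u.[t] <= v.[t]) -> mom rho u <= mom rho v.
Proof.
move=> hm u0 v0 uv; rewrite -lee_fin -!momE//.
have mE (w : {poly R}) : measurable_fun setT (fun t : RB => (w.[t])%:E).
  by apply/measurable_EFinP; exact: measurable_horner.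
apply: (@ae_ge0_le_integral _ _ _ rho setT measurableT) => //; do ?exact: mE.
- by move=> t _; rewrite lee_fin.
- by move=> t _; rewrite lee_fin.
have [N [mN N0 hN]] := negligible_setC_supp rho; exists N; split => // t /= h.
by apply: hN => st; apply: h => _; rewrite lee_fin uv.
Qed.

(** Otherwise the polynomial whose roots are the points of the support would have a squared modulus
    of integral 0. *)
Lemma infinite_supp (mu : {measure set RB -> \bar R}) : finite_moments mu ->
  (forall p, p != 0 -> 0 < mom mu (sqn p)) -> infinite_set (supp mu).
Proof.
move=> hm h /finite_seqP[l lE].
pose p : {poly C} := \prod_(x <- l) ('X - (x%:C)%:P).
have p0 : p != 0 by rewrite monic_neq0// monic_prod_XsubC.
have := h _ p0; rewrite ltNge => /negP; apply.
rewrite -[leRHS](mom0 hm); apply: le_mom_supp => // [t|t|t].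
- by rewrite horner_sqn csq_ge0.
- by rewrite horner0.
rewrite lE /= => tl; rewrite horner_sqn horner0 /p horner_prod (big_rem t)//=.
by rewrite hornerXsubC subrr mul0r csq0.
Qed.

Variables (rho mu : {measure set RB -> \bar R}) (z : C) (k : nat).
Hypothesis hm : finite_moments rho.
Hypothesis muE : forall D : set RB, measurable D -> mu D = weighted z k rho D.

(** [mu] agrees with the weighted measure on measurable sets only, so that for k = 0 it can be rho
    itself. *)
Lemma ge0_integral_weighted (f : RB -> R) : (forall t, 0 <= f t) -> measurable_fun setT f ->
  (\int[mu]_t (f t)%:E = \int[rho]_t (f t * weight z k t)%:E)%E.
Proof.
move=> f0 mf.
rewrite (@eq_measure_integral _ _ _ _ (density rho (weight_ge0 z k) (measurable_weight z k))); last first.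
  by move=> B mB _; exact: muE.
rewrite ge0_integral_density//; first exact/measurable_EFinP.
Qed.

Lemma finite_moments_weighted : finite_moments mu.
Proof.
move=> n; apply/integrableP; split.
  by apply/measurable_EFinP; exact: measurable_funX.
under eq_integral do rewrite abse_EFin.
rewrite ge0_integral_weighted//; last first.
  by apply: measurableT_comp => //; exact: measurable_funX.
have /integrableP[_] := integrable_horner ('X^n * sqn ('X - z%:P) ^+ k) hm.
rewrite (eq_integral (fun t : RB => (`|t ^+ n| * weight z k t)%:E))//.
move=> t _; rewrite abse_EFin hornerM hornerXn -weightE normrM.
by rewrite [X in _ * X]ger0_norm// weight_ge0.
Qed.

Lemma mom_weighted (u : {poly R}) : (forall t, 0 <= u.[t]) ->
  mom mu u = mom rho (u * sqn ('X - z%:P) ^+ k).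
Proof.
move=> u0; congr fine; rewrite ge0_integral_weighted//; last exact: measurable_horner.
by apply: eq_integral => t _; rewrite hornerM -weightE.
Qed.

Lemma sqn_ge0 p (t : R) : 0 <= (sqn p).[t].
Proof. by rewrite horner_sqn csq_ge0. Qed.

End WeightedMeasure.

(** * Dense range and determinacy *)

Section SpectralEquivalence.
Context {R : realType}.
Local Notation C := R[i].
Local Notation RB := (measurableTypeR R).
Implicit Types (p f r s : {poly C}).

Variables (q b : nat -> R).
Hypothesis b0 : forall k, 0 < b k.

(** The last entry is b_0 ... b_(j-1), which is nonzero; hence p(J_0) e_1 determines p. *)
Lemma iter_Jop_triangular j : (size (iter j (Jop q b) 1%R) <= j.+1)%N /\
  (iter j (Jop q b) 1)`_j != 0.
Proof.
elim: j => [|j [sj cj]] /=; first by rewrite size_poly1 coef1 oner_eq0.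
split; first exact: leq_trans (size_Jop _ _ _) _.
rewrite coef_Jop /= (nth_default 0 sj) (nth_default 0 (leqW sj)).
by rewrite !mulr0 !addr0 mulf_neq0// fmorph_eq0 gt_eqF.
Qed.

Lemma polyJ_eq0 p : polyJ q b p = 0 -> p = 0.
Proof.
move=> h; apply/eqP; apply: contraT => p0.
have sp : (0 < size p)%N by rewrite lt0n size_poly_eq0.
have lt_sp : ((size p).-1 < size p)%N by rewrite prednK.
have := congr1 (fun f : {poly C} => f`_(size p).-1) h.
rewrite /polyJ coef_sum coef0 (bigD1 (Ordinal lt_sp))//=.
rewrite big1 ?addr0 => [/eqP|i].
  by rewrite coefZ mulf_eq0 (negPf (iter_Jop_triangular _).2) orbF -/(lead_coef p) lead_coef_eq0 (negPf p0).
rewrite -val_eqE /= => ip; rewrite coefZ [X in _ * X]nth_default ?mulr0//.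
apply: (leq_trans (iter_Jop_triangular _).1).
by rewrite ltn_neqAle ip -ltnS prednK ?ltn_ord.
Qed.

Lemma n2_gt0 f : f != 0 -> 0 < n2 f.
Proof.
move=> f0; apply: (@lt_le_trans _ _ (csq f`_(size f).-1)); last exact: csq_coef_le.
by rewrite csq_gt0 -/(lead_coef f) lead_coef_eq0.
Qed.

Lemma range_dense_step m : range_dense q b m ->
  (forall eps : R, 0 < eps -> exists2 p, p.['i] = 1 & n2 (iter m (Jshift q b) (polyJ q b p)) < eps) ->
  range_dense q b m.+1.
Proof.
move=> hd hc y eps eps0; have e4 : 0 < eps / 4 by rewrite divr_gt0.
have [g hg] := hd y _ e4; have [r rE] := polyJ_surj q b0 g.
have c0 : 0 < csq r.['i] + 1 by rewrite ltr_wpDl ?csq_ge0.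
have [p pi hp] := hc _ (divr_gt0 e4 c0).
(* [r - r(i) p] is divisible by [X - i] and close to [r]. *)
have : root (r - r.['i] *: p) 'i by rewrite /root !hornerE pi mulr1 subrr.
rewrite -dvdp_XsubCl => /divpK; rewrite mulrC; move: (_ %/ _) => s sE.
exists (polyJ q b s).
rewrite iterSr -polyJ_subX sE polyJB polyJZ rE linearB linearZ /=.
rewrite opprB addrA [y + _]addrC -addrA addrC.
apply: le_lt_trans (n2D_le _ _) _; rewrite n2Z.
have : csq r.['i] * n2 (iter m (Jshift q b) (polyJ q b p)) <= eps / 4.
  rewrite (le_trans (ler_wpM2l (csq_ge0 _) (ltW hp)))// mulrA ler_pdivrMr// mulrC ler_wpM2l ?ltW//.
  by rewrite ltrDl.
by move: hg; lra.
Qed.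

(** By [n2_iter_Jshift_ge] the polynomial that is good for the exponent m is good for every smaller
    one, which feeds each step of the induction. *)
Lemma range_dense_christoffel m :
  (forall eps : R, 0 < eps -> exists2 p, p.['i] = 1 & n2 (iter m (Jshift q b) (polyJ q b p)) < eps) ->
  range_dense q b m.+1.
Proof.
move=> hc; have hcj j : (j <= m)%N -> forall eps : R, 0 < eps ->
    exists2 p, p.['i] = 1 & n2 (iter j (Jshift q b) (polyJ q b p)) < eps.
  move=> jm eps /hc[p pi hp]; exists p => //; apply: le_lt_trans hp.
  by rewrite -(subnK jm) iterD; exact: n2_iter_Jshift_ge.
suff : forall j, (j <= m.+1)%N -> range_dense q b j by apply.
elim=> [_ y eps eps0|j IH jm].
  by exists y; rewrite subrr n2_0.
by apply: range_dense_step; [exact/IH/ltnW|exact: hcj].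
Qed.

End SpectralEquivalence.

Section DeterminacyCriterion.
Context {R : realType}.
Local Notation C := R[i].
Local Notation RB := (measurableTypeR R).
Implicit Types (p r s : {poly C}) (w : C).

Variables (J : operator R) (q b : nat -> R) (E : set R -> operator R).
Variable rho : {measure set RB -> \bar R}.
Hypothesis b0 : forall k, 0 < b k.
Hypothesis saJ : self_adjoint J.
Hypothesis exJ : extends (jacobi0 q b) J.
Hypothesis hE : resolution_of_identity J E.
Hypothesis hrho : quadratic_measure E (basis_vec 0) rho.

Let hm : finite_moments rho := spectral_finite_moments saJ exJ hE hrho.

Let mom_n2 p : mom rho (sqn p) = n2 (polyJ q b p) := mom_sqn_n2 saJ exJ hE hrho p.

Lemma mom_sqn_subXn m p : mom rho (sqn (('X - 'i%:P) ^+ m * p)) =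
  n2 (iter m (Jshift q b) (polyJ q b p)).
Proof. by rewrite mom_n2 polyJ_subXn. Qed.

(** The map from p to p(J_0) e_1 is isometric and onto, so a dense range means that the multiples of
    (t - i)^m approximate every polynomial, hence every square integrable function. *)
Lemma range_dense_approx m (phi : R -> C) : range_dense q b m -> cmeasurable phi ->
  (\int[rho]_t (csq (phi t))%:E < +oo)%E -> forall eps : R, 0 < eps ->
  exists s, (\int[rho]_t (csq (phi t - (('X - 'i%:P) ^+ m * s).[t%:C]))%:E < eps%:E)%E.
Proof.
move=> hd mphi fphi eps eps0; have e4 : 0 < eps / 4 by rewrite divr_gt0.
have [_ /(_ _ e4)[p hp]] := spectral_approximable b0 saJ exJ hE hrho mphi fphi.
have [g] := hd (polyJ q b p) _ e4; have [s <-] := polyJ_surj q b0 g => hs.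
exists s; set u := _ * s.
rewrite -polyJ_subXn -polyJB -mom_n2 -lte_fin -momE// in hs.
rewrite (_ : (fun t : RB => (csq (phi t - u.[t%:C]))%:E) =
  fun t => (csq ((phi t - p.[t%:C]) + (p - u).[t%:C]))%:E); last first.
  by apply/funext => t; rewrite hornerD hornerN addrA subrK.
apply: le_lt_trans (integral_csqD_le rho (cmeasurableB mphi (cmeasurable_horner p))
  (cmeasurable_horner (p - u))) _.
rewrite (_ : eps%:E = 2%:E * ((eps / 4)%:E + (eps / 4)%:E))%E; last first.
  by rewrite -EFinD -EFinM; congr EFin; field.
rewrite lte_pmul2l// lteD//.
by rewrite (eq_integral (fun t : RB => ((sqn (p - u)).[t])%:E))// => t _; rewrite horner_sqn.
Qed.

Variables (mu : {measure set RB -> \bar R}) (z : C) (k : nat).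
Hypothesis hz : ~ exists2 t : R, supp rho t & z = t%:C.
Hypothesis muE : forall D : set RB, measurable D -> mu D = weighted z k rho D.

Let hmu : finite_moments mu := finite_moments_weighted hm muE.

Let mom_mu p : mom mu (sqn p) = mom rho (sqn p * sqn ('X - z%:P) ^+ k).
Proof. by apply: mom_weighted => // t; rewrite sqn_ge0. Qed.

Lemma classM_weighted : classM mu.
Proof.
split => //; apply: infinite_supp => // p p0.
rewrite mom_mu (@eq_mom _ _ _ (sqn (('X - z%:P) ^+ k * p))) => [|t].
  rewrite mom_n2 n2_gt0//; apply: contra_neq p0 => /(polyJ_eq0 b0)/eqP.
  by rewrite mulf_eq0 expf_eq0 polyXsubC_eq0 andbF /= => /eqP.
by rewrite hornerM horner_exp !horner_sqn hornerM csqM horner_exp csqX mulrC.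
Qed.

Lemma range_dense_determinate : range_dense q b k.+1 -> determinate mu.
Proof.
move=> hd; split; first exact: classM_weighted.
move=> nu hnu hs; apply: moment_unique => // w w0 eps eps0.
have [K1 K10 hK1] := csq_sub_le z; have [K2 K20 hK2] := csq_sub_le w.
have tw (t : R) : t%:C - w != 0.
  by apply: contra_neq w0 => /(congr1 (@complex.Im R)); case: (w) => a c /=; lra.
have y0 : 0 < complex.Im w ^+ 2 by rewrite lt_def sqrf_eq0 w0 sqr_ge0.
(* Square integrable because |t - w| >= |Im w|. *)
pose phi (t : R) : C := (('X - 'i%:P) ^+ k.+1).[t%:C] * (t%:C - w)^-1.
have mphi : cmeasurable phi.
  by apply: cmeasurableM; [exact: cmeasurable_horner|exact: cmeasurable_cauchy].
have phiE t : csq (phi t) = (1 + t ^+ 2) ^+ k.+1 / csq (t%:C - w).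
  by rewrite csqM csqV horner_exp csqX -horner_sqn horner_sqnXsubi.
have fphi : (\int[rho]_t (csq (phi t))%:E < +oo)%E.
  pose v : {poly R} := (complex.Im w ^+ 2)^-1 *: (sqn ('X - 'i%:P) ^+ k.+1).
  have := ltry (mom rho v); rewrite -momE//; apply: le_lt_trans.
  apply: ge0_le_integral => //.
  - by move=> t _; rewrite lee_fin csq_ge0.
  - exact: measurable_csq.
  - by apply/measurable_EFinP; exact: measurable_horner.
  - move=> t _; rewrite lee_fin phiE hornerZ horner_exp horner_sqnXsubi mulrC.
    rewrite ler_wpM2r//; first by rewrite exprn_ge0// addr_ge0// sqr_ge0.
    rewrite lef_pV2 ?posrE ?csq_gt0//.
    by case: (w) => x y; rewrite /csq /= sub0r sqrrN lerDr sqr_ge0.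
(* K1^k compares |t - z|^(2 k) with (1 + t^2)^k, and K2 compares |t - w|^2 with 1 + t^2: the one
   power of t - i in excess of the weight pays for the factor t - w. *)
pose K := K1 ^+ k * K2; have K0 : 0 < K by rewrite mulr_gt0// exprn_gt0.
have [s hs'] := range_dense_approx hd mphi fphi (divr_gt0 eps0 K0).
exists s; rewrite -lte_fin -momE//; set u := _ * s in hs'.
rewrite (@ge0_integral_weighted _ rho mu z k)//; last 2 first.
- by move=> t; rewrite sqn_ge0.
- exact: measurable_horner.
have mpsi := measurable_csq (cmeasurableB mphi (cmeasurable_horner u)).
apply: (@le_lt_trans _ _ (\int[rho]_t (K%:E * (csq (phi t - u.[t%:C]))%:E))%E); last first.
  rewrite ge0_integralZl_EFin//; [|by move=> t _; rewrite lee_fin csq_ge0|exact: ltW].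
  rewrite (_ : eps%:E = K%:E * (eps / K)%:E)%E; last first.
    by rewrite -EFinM; congr EFin; field; rewrite gt_eqF.
  by rewrite lte_pmul2l// lte_fin.
apply: ge0_le_integral => //.
- by move=> t _; rewrite lee_fin mulr_ge0 ?sqn_ge0 ?weight_ge0.
- apply/measurable_EFinP; apply: measurable_funM; first exact: measurable_horner.
  exact: measurable_weight.
- by apply: emeasurable_funM => //; exact: measurable_cst.
- move=> t _; rewrite -EFinM lee_fin horner_sqn weightE horner_exp horner_sqn hornerXsubC.
  set r := (1 - _ * s).[_].
  have t2 : 0 < 1 + t ^+ 2 by rewrite ltr_wpDr// sqr_ge0.
  have -> : phi t - u.[t%:C] = (t%:C - 'i) ^+ k.+1 * ((t%:C - w)^-1 * r).
    rewrite /phi /u /r !(hornerE, horner_exp) /=.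
    by field; exact: tw.
  rewrite !csqM csqV csqX.
  have -> : csq (t%:C - 'i) = 1 + t ^+ 2 by rewrite -horner_sqnXsubi horner_sqn hornerXsubC.
  have h1 : csq (t%:C - z) ^+ k <= K1 ^+ k * (1 + t ^+ 2) ^+ k.
    by rewrite -exprMn lerXn2r ?nnegrE ?csq_ge0// mulr_ge0 ?ltW.
  have h2 : 1 <= K2 * (1 + t ^+ 2) / csq (t%:C - w).
    by rewrite ler_pdivlMr ?csq_gt0// mul1r.
  rewrite (_ : K * _ = csq r * ((K1 ^+ k * (1 + t ^+ 2) ^+ k) * (K2 * (1 + t ^+ 2) / csq (t%:C - w)))); last first.
    by rewrite /K exprS; ring.
  rewrite ler_wpM2l ?csq_ge0// -[leLHS]mulr1 ler_pM ?exprn_ge0 ?csq_ge0//.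
Qed.

(** The bound of |t - i|^(2 k) by |t - z|^(2 k) holds on the support, where [hz] keeps the latter
    away from 0; hence the comparison by [le_mom_supp]. *)
Lemma determinate_range_dense : determinate mu -> range_dense q b k.+1.
Proof.
move=> /(determinate_christoffel hmu) hc; apply: range_dense_christoffel => // eps eps0.
have [K K0 hK] := csq_sub_ge hz.
have Kk : 0 < K ^+ k by exact: exprn_gt0.
have [p pi hp] := hc _ (divr_gt0 eps0 Kk); exists p => //.
rewrite -mom_sqn_subXn; apply: (@le_lt_trans _ _ (mom rho (K ^+ k *: (sqn p * sqn ('X - z%:P) ^+ k)))).
  apply: le_mom_supp => // t; first by rewrite sqn_ge0.
    by rewrite hornerZ hornerM horner_exp; apply: mulr_ge0; [exact: ltW|apply: mulr_ge0; rewrite ?exprn_ge0 ?sqn_ge0].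
  move=> /hK st; rewrite hornerZ hornerM horner_exp !horner_sqn hornerM csqM horner_exp csqX.
  have -> : csq ('X - 'i%:P).[t%:C] = 1 + t ^+ 2 by rewrite -horner_sqnXsubi horner_sqn.
  rewrite mulrCA mulrC ler_wpM2l ?csq_ge0//.
  rewrite -exprMn lerXn2r ?nnegrE ?hornerXsubC//; first by rewrite addr_ge0// sqr_ge0.
  by rewrite mulr_ge0 ?csq_ge0// ltW.
by rewrite momZ// -mom_mu mulrC -ltr_pdivlMr.
Qed.

End DeterminacyCriterion.

(** * Transfer to the perturbed operator *)

Section SpectralMeasure.
Context {R : realType}.
Local Notation C := R[i].
Local Notation RB := (measurableTypeR R).

Lemma weighted0 (z : C) (mu : {measure set RB -> \bar R}) (D : set RB) :
  measurable D -> weighted z 0 mu D = mu D.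
Proof.
move=> mD; rewrite /weighted.
under eq_integral do rewrite /weight muln0 expr0.
by rewrite integral_cst// mul1e.
Qed.

Variables (J : operator R) (q b : nat -> R) (rho : {measure set RB -> \bar R}).
Hypothesis b0 : forall k, 0 < b k.
Hypothesis saJ : self_adjoint J.
Hypothesis exJ : extends (jacobi0 q b) J.
Hypothesis hrho : spectral_measure J rho.

Let nonreal_i : ~ (exists2 t : R, supp rho t & 'i = t%:C).
Proof. by move=> [t _ /(congr1 (@complex.Im R)) /= h]; have := oner_neq0 R; rewrite h eqxx. Qed.

Lemma determinate_weightedP (z : C) k : ~ (exists2 t : R, supp rho t & z = t%:C) ->
  determinate (weighted z k rho) <-> range_dense q b k.+1.
Proof.
move=> hz; have [E hE hq] := hrho; split.
  by move/(determinate_range_dense b0 saJ exJ hE hq hz (fun D _ => erefl)).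
exact: (range_dense_determinate b0 saJ exJ hE hq (fun D _ => erefl)).
Qed.

(** The case k = 0, where the weight is 1; i serves as a point off the support. *)
Lemma determinateP : determinate rho <-> range_dense q b 1.
Proof.
have [E hE hq] := hrho; have h D (mD : measurable D) := esym (@weighted0 'i rho D mD).
split; first exact: (determinate_range_dense b0 saJ exJ hE hq nonreal_i h).
exact: (range_dense_determinate b0 saJ exJ hE hq h).
Qed.

Lemma spectral_N_extremal : N_extremal rho.
Proof.
have [E hE hq] := hrho; have h D (mD : measurable D) := esym (@weighted0 'i rho D mD).
split; first exact: (classM_weighted b0 saJ exJ hE hq h).
move=> phi mr mi fin eps eps0.
have [||_ /(_ _ eps0)[p hp]] := spectral_approximable b0 saJ exJ hE hq (phi := phi).
- by split.
- by apply: le_lt_trans fin; under eq_integral do rewrite -csq_normc.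
by exists p; under eq_integral do rewrite csq_normc.
Qed.

End SpectralMeasure.

Theorem corollary4p20 (R : realType) (J Jt C : operator R)
    (rho rhot : {measure set (measurableTypeR R) -> \bar R})
    (hJ : jacobi_operator J) (hJt : jacobi_operator Jt)
    (hC : linear_operator C) (hrank : finite_rank C)
    (hsum : same_operator Jt (add_operator J C))
    (hrho : spectral_measure J rho) (hrhot : spectral_measure Jt rhot) :
  (determinate rho ->
     determinate rhot /\
     forall z zt : R[i],
       ~ (exists2 t : R, supp rho t & z = t%:C) ->
       ~ (exists2 t : R, supp rhot t & zt = t%:C) ->
       ind z rho = ind zt rhot) /\
  (indeterminate rho /\ N_extremal rho ->
     indeterminate rhot /\ N_extremal rhot).
Proof.
have [q [b [b0 saJ exJ]]] := hJ; have [q' [b' [b0' saJt exJt]]] := hJt.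
have [N agree] := finite_rank_agree exJ exJt hrank hsum.
have dense m : range_dense q b m <-> range_dense q' b' m.
  split; first exact: range_dense_agree agree.
  by apply: (@range_dense_agree _ _ _ _ _ N) => k /agree[-> ->].
have det := determinateP b0 saJ exJ hrho.
have dett := determinateP b0' saJt exJt hrhot.
split.
  move=> /det/dense/dett h; split => // z zt hz hzt.
  (* Both suprema run over the k for which the exponent k + 1 has a dense range, a condition without
     z and zt. *)
  rewrite /ind; congr (ereal_sup (_ @` _)); apply/seteqP; split => k /=.
    by move=> /(determinate_weightedP b0 saJ exJ hrho k hz)/dense/(determinate_weightedP b0' saJt exJt hrhot k hzt).
  by move=> /(determinate_weightedP b0' saJt exJt hrhot k hzt)/dense/(determinate_weightedP b0 saJ exJ hrho k hz).
(* As a spectral measure, rhot is N-extremal; its indeterminacy follows by contraposition. *)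
move=> [[_ ndet] _]; have ext := spectral_N_extremal b0' saJt exJt hrhot.
split => //; split; first exact: ext.1.
by move=> /dett/dense/det.
Qed.
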